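(* Let $k=12D$ with $D$ a power of $2$ (where $D=1=2^0$ is allowed). Then the Faber polynomial associated to the weight $2k$ modular form $E_k^2+E_{2k}$ is irreducible over $\mathbb{Q}$.
   Context: For even $k\ge 4$ and $z$ in the complex upper half-plane, let $E_k(z)=\frac12\sum_{(a,b)=1}\frac{1}{(az+b)^k}$ (sum over pairs of coprime integers $a,b$), the normalized level one Eisenstein series of weight $k$. Let $\Delta=(E_4^3-E_6^2)/1728$ and $j=E_4^3/\Delta$. For an even integer $K\ge 4$, write $K=12d+K'$ with unique integers $d\ge 0$ and $K'\in\{0,4,6,8,10,14\}$, with the convention $E_0=1$. For a modular form $f$ of weight $K$ and level one (i.e. for $\mathrm{SL}_2(\mathbb{Z})$), the quotient $f/(\Delta^{d}E_{K'})$ is a polynomial in $j$; the Faber polynomial associated to $f$ is this polynomial, i.e. the unique $P\in\mathbb{C}[x]$ with $f=\Delta^{d}E_{K'}\,P(j)$. (For $K=24D$ one has $d=2D$, $K'=0$. The Faber polynomial of $E_k^2+E_{2k}$ has rational coefficients.) *)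

(* Defs.v *)
From HB Require Import structures.
From mathcomp Require Import all_boot all_order all_algebra.
From mathcomp Require Import complex.
From mathcomp Require Import all_classical all_reals all_analysis.
From mathcomp.analysis.showcase Require Import summability.

Set Implicit Arguments.
Unset Strict Implicit.
Unset Printing Implicit Defensive.

Import Order.TTheory GRing.Theory Num.Theory.
Import numFieldNormedType.Exports.

Local Open Scope ring_scope.
Local Open Scope complex_scope.

Section Faber.
Context (R : realType).
Notation C := R[i].

(* [summability.sum] is the unconditional sum, i.e. the limit of the finite
   partial sums along the filter of finite subsets of [int * int]; the type
   [C^o] selects the normed C-module structure of C over itself.  The family
   is absolutely summable when k >= 3 and z is in the upper half-plane; no
   meaning is attached to the value otherwise, except that E_0 = 1 is the
   usual convention. *)
Definition eisenstein (k : nat) (z : C) : C :=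
  if k == 0%N then 1 else
  2^-1 * summability.sum
    (fun p : int * int =>
       (if coprimez p.1 p.2 then ((p.1%:~R * z + p.2%:~R) ^+ k)^-1 else 0)
         : C^o).

Definition Delta (z : C) : C :=
  (eisenstein 4 z ^+ 3 - eisenstein 6 z ^+ 2) / 1728%:R.

Definition jinv (z : C) : C := eisenstein 4 z ^+ 3 / Delta z.

(* [is_faber K f P]: P is the Faber polynomial of f, for f modular of weight K
   and level one.  For even K >= 4 the pair (d, K') exists and is unique. *)
Definition is_faber (K : nat) (f : C -> C) (P : {poly C}) : Prop :=
  exists d K' : nat,
    [/\ K = (12 * d + K')%N,
        K' \in [:: 0; 4; 6; 8; 10; 14]%N &
        forall z : C, 0 < complex.Im z ->
          f z = Delta z ^+ d * eisenstein K' z * P.[jinv z]].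

Definition irreducible_over_rat (P : {poly C}) : Prop :=
  exists2 Q : {poly rat}, P = map_poly ratr Q & irreducible_poly Q.

End Faber.

(* Main.v *)
Require Import Defs.
From HB Require Import structures.
From mathcomp Require Import all_boot all_order all_algebra.
From mathcomp Require Import complex.
From mathcomp Require Import all_classical all_reals all_analysis.
From mathcomp Require finmap.
From mathcomp.analysis.showcase Require Import summability.
From mathcomp Require Import ring lra zify.

(* The Laurent coefficients of the Weierstrass function of a lattice satisfy a quadratic
   recurrence in which [E_4] and [E_6] are the only parameters.  Comparing the lattice with
   its degeneration [Z] gives [E_(2m) = C_m(-3 E_4, 2 E_6) / C_m(-3, 2)], where [C_m] is the
   universal solution.  The recurrence is 2-integral and [C_(6D)(-3, b) = 2 + b^(2D)]
   modulo 4 when [D] is a power of 2.  With [k = 12 D], this yields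
   [E_k^2 + E_(2k) = 2 E_4^(6D) h(256 / j)] for a rational polynomial [h] of degree [2D] with
   [h_0 = 1], [v_2(h_D) >= -1], [v_2(h_(2D)) = -3] and all other coefficients 2-integral.  So
   the 2-adic Newton polygon of the Faber polynomial [2 x^(2D) h(256 / x)] is a single segment
   of slope [(16 D - 3) / (2 D)], which is in lowest terms, and the Eisenstein-Dumas criterion
   applies.  That this is the Faber polynomial follows because [j] is injective on the ray
   [i y], [y > 1]. *)

Set Implicit Arguments.
Unset Strict Implicit.
Unset Printing Implicit Defensive.

Import Order.TTheory GRing.Theory Num.Theory.
Import numFieldNormedType.Exports.

Local Open Scope ring_scope.

(** * 2-integral rationals *)

(** Only absolutely convergent sums are rearranged; neither [q]-expansions nor the transformation
    law nor values of zeta enter. The degenerate lattice serves to cancel zeta: the sums over both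
    lattices contain the factor [zeta(2m)], and the parameters [(-3, 2)] of the degeneration come
    from Euler's relations between its sums of exponents 2, 4 and 6. The constant 256: if [E_4 = 1],
    then [(2 E_6)^2 = 4 - 4 * 1728 / j = 4 - 27 * (256 / j)], which is [256 / j] modulo 4. The
    exponent -3: [C_(6D)(-3, 2)] is twice a 2-adic unit, so dividing by it gives the coefficient of
    [x^D] in the normalized [E_(12D)] valuation -1; squaring and then halving makes this
    [2 * (-1) - 1] at [x^(2D)]. As 3 is odd and [2 D] is a power of 2, the slope cannot be
    reduced. *)

Definition Zloc2 : {pred rat} := fun x => odd `|denq x|.

Lemma Zloc2P (x : rat) :
  reflect (exists n : int, exists2 m : nat, odd m & x * m%:R = n%:~R) (x \in Zloc2).
Proof.
apply: (iffP idP) => [x2|[n [m om xm]]].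
  exists (numq x), `|denq x|%N => //.
  by rewrite numqE -[(`|_|%N)%:R]/((`|denq x|%N : int)%:~R) absz_denq.
have /eqP : numq x * m%:Z = n * denq x.
  by apply: (@intr_inj rat); rewrite !intrM !numqE -xm /= pmulrn; ring.
rewrite -(inj_eq (@intr_inj rat)) => /eqP /intr_inj e.
have : (`|denq x| %| `|numq x| * m)%N.
  by rewrite -[m]/(absz m) -abszM e abszM dvdn_mull.
rewrite Gauss_dvdr; last by rewrite coprime_sym coprime_num_den.
by case/dvdnP => q em; move: om; rewrite em oddM => /andP[].
Qed.

Lemma Zloc2_subring : subring_closed Zloc2.
Proof.
split.
- by apply/Zloc2P; exists 1, 1%N.
- move=> x y /Zloc2P[n [m om e]] /Zloc2P[n' [m' om' e']]; apply/Zloc2P.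
  exists (n * m' - n' * m), (m * m')%N; first by rewrite oddM om.
  rewrite rmorphB !rmorphM /= -e -e'. by ring.
- move=> x y /Zloc2P[n [m om e]] /Zloc2P[n' [m' om' e']]; apply/Zloc2P.
  exists (n * n'), (m * m')%N; first by rewrite oddM om.
  rewrite !rmorphM /= -e -e'. by ring.
Qed.

HB.instance Definition _ := GRing.isSubringClosed.Build rat Zloc2 Zloc2_subring.

Lemma Zloc2_invodd (m : nat) : odd m -> (m%:R^-1 : rat) \in Zloc2.
Proof.
move=> om; apply/Zloc2P; exists 1, m => //.
by rewrite mulVf // pnatr_eq0; case: m om.
Qed.

(** * The Weierstrass recurrence *)

(* With [(p' / 2) ^ 2 = p ^ 3 + a p + b] for the Weierstrass function [p], [c m] is the
   coefficient of [s ^ (2 m)] in [s ^ 2 p(s)].  The relation for general [m] is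
   [p'' = 6 p ^ 2 + 2 a]; it is vacuous at [m = 3], hence the condition on [c 3]. *)
Definition wp_rec (R : comNzRingType) (a b : R) (c : nat -> R) : Prop :=
  [/\ c 0%N = 1, c 1%N = 0, - 7%:R * c 3%N = b &
      forall m, (2 * (m%:R * m%:R) - 5 * m%:R + 3) * c m =
                3 * (\sum_(i < m.+1) c i * c (m - i)%N) + a * (m == 2)%:R].

(** * The first integral of the Weierstrass equation *)

Section FirstOrder.
Variables (R : idomainType) (a b : R) (c : nat -> R).
Hypotheses (char0 : forall n : nat, (n.+1%:R : R) != 0) (hc : wp_rec a b c).

Definition theta (p : {poly R}) : {poly R} := 'X * p^`().

Lemma coef_theta p i : (theta p)`_i = i%:R * p`_i.
Proof.
by rewrite /theta coefXM coef_deriv; case: i => [|i] /=; rewrite ?mul0r // mulr_natl.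
Qed.

Lemma thetaD p q : theta (p + q) = theta p + theta q.
Proof. by rewrite /theta derivD mulrDr. Qed.
Lemma thetaN p : theta (- p) = - theta p.
Proof. by rewrite /theta derivN mulrN. Qed.
Lemma thetaM p q : theta (p * q) = theta p * q + p * theta q.
Proof. by rewrite /theta derivM; ring. Qed.
Lemma thetaC k : theta k%:P = 0.
Proof. by rewrite /theta derivC mulr0. Qed.
Lemma thetaX : theta 'X = 'X.
Proof. by rewrite /theta derivX mulr1. Qed.

(* [s ^ 6 ((p' / 2) ^ 2 - p ^ 3 - a p - b)] in terms of [x = s ^ 2 p] and ['X = s ^ 2]. *)
Definition wp_defect (x : {poly R}) : {poly R} :=
  (theta x - x) * (theta x - x) - x * x * x - a%:P * 'X * 'X * x - b%:P * 'X * 'X * 'X.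

(** This first integral is what makes 2-integrality provable. The second-order relation determines
    [c m] through the factor [(2 * m + 1) * (m - 3)], which is even for odd [m]; in the first-order
    relation the factor is the odd number [2 * n + 1]. Truncation at [N] does not affect the
    coefficients up to [N]. *)
Lemma wp_first_order N m : (3 <= N)%N -> (m <= N)%N ->
  (wp_defect (\poly_(i < N.+1) c i))`_m = 0.
Proof.
case: hc => c0 c1 c3 cm.
set x := \poly_(i < _) _.
move=> N3 mN.
have xE i : (i <= N)%N -> x`_i = c i by move=> iN; rewrite coef_poly ltnS iN.
pose e := 2%:P * theta (theta x) - 5%:P * theta x + 3%:P * x - 3%:P * (x * x)
   - a%:P * 'X^2.
have e0 i : (i <= N)%N -> e`_i = 0.
  move=> iN; rewrite /e !(coefB, coefD, coefCM, coefXn, coef_theta).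
  rewrite coefM (xE _ iN); under eq_bigr => j _.
    rewrite !xE; first over; first exact: leq_trans (leq_subr _ _) iN.
    by apply: leq_trans iN; rewrite -ltnS.
  transitivity ((2 * (i%:R * i%:R) - 5 * i%:R + 3) * c i -
    (3 * (\sum_(i0 < i.+1) c i0 * c (i - i0)%N) + a * (i == 2)%:R)); first by ring.
  by rewrite cm subrr.
(* The second-order equation says [theta W = 3 W] for the defect [W], which leaves only
   the coefficient of ['X ^ 3]. *)
have : theta (wp_defect x) - 3%:P * wp_defect x = (theta x - x) * e.
  rewrite /wp_defect /e; set u := theta x; rewrite !(thetaD, thetaN, thetaM, thetaC, thetaX) -/u.
  by rewrite !polyC_natr; ring.
move=> /(congr1 (fun p : {poly R} => p`_m)).
rewrite coefB coef_theta coefCM -mulrBl coefM big1 => [|i _]; last first.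
  by rewrite e0 ?mulr0 // (leq_trans (leq_subr _ _) mN).
move/eqP; rewrite mulf_eq0 => /orP[|/eqP//].
case: (ltngtP m 3) => [m3|m3|m3 _].
- have -> : m%:R - 3 = - (2 - m).+1%:R :> R.
    have -> : ((2 - m).+1 = 3 - m)%N by lia.
    by rewrite natrB ?opprB // ltnW.
  by rewrite oppr_eq0 (negPf (char0 _)).
- have -> : m%:R - 3 = (m - 4).+1%:R :> R.
    have -> : ((m - 4).+1 = m - 3)%N by lia.
    by rewrite natrB // ltnW.
  by rewrite (negPf (char0 _)).
rewrite m3 /wp_defect; set t := theta x - x.
have tE i : t`_i = i%:R * x`_i - x`_i by rewrite coefB coef_theta.
have C3 (p q : {poly R}) : (p * q)`_3 = p`_0 * q`_3 + (p`_1 * q`_2 + (p`_2 * q`_1 + p`_3 * q`_0)).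
  by rewrite coefM !big_ord_recl big_ord0 addr0.
have C2 (p q : {poly R}) : (p * q)`_2 = p`_0 * q`_2 + (p`_1 * q`_1 + p`_2 * q`_0).
  by rewrite coefM !big_ord_recl big_ord0 addr0.
have C1 (p q : {poly R}) : (p * q)`_1 = p`_0 * q`_1 + p`_1 * q`_0.
  by rewrite coefM !big_ord_recl big_ord0 addr0.
have C0 (p q : {poly R}) : (p * q)`_0 = p`_0 * q`_0 by rewrite coefM !big_ord_recl big_ord0 addr0.
rewrite !coefB !(C3, C2, C1, C0) !coefC !coefX /= !tE !xE ?(leq_trans _ N3) //.
rewrite c0 c1 -c3.
ring.
Qed.

(* Isolates [c n] in the coefficient of ['X ^ n] of the first-order equation. *)
Lemma wp_coef_lower n : (3 < n)%N ->
  (2 * n + 1)%:R * c n = (wp_defect (\poly_(i < n) c i))`_n.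
Proof.
move=> n3; case: hc => c0 c1 _ _.
have n1 : (1 < n)%N by lia.
have := wp_first_order (ltnW n3) (leqnn n).
have -> : \poly_(i < n.+1) c i = \poly_(i < n) c i + (c n)%:P * 'X^n.
  apply/polyP => i; rewrite coefD coefCM coefXn !coef_poly ltnS.
  by case: ltngtP => [|| ->] /=; rewrite ?mulr0 ?mulr1 ?addr0 ?add0r.
set y := \poly_(i < n) c i.
have y0 : y.[0] = 1 by rewrite horner_coef0 coef_poly (ltn_trans _ n1).
have t0 : (theta y).[0] = 0 by rewrite /theta hornerM hornerX mul0r.
have tX : theta 'X^n = n%:R * 'X^n.
  apply/polyP => i; rewrite coef_theta -(polyC_natr R n) coefCM coefXn.
  by case: eqP => [->|_]; rewrite ?mulr0.
(* The increment of [wp_defect] divided by ['X^n]. Only its constant term, [- (2 * n + 1) * c n],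
   reaches the coefficient of ['X^n]. *)
pose q := (c n)%:P * (2 * (n%:R - 1) * (theta y - y) - 3 * y * y)
  + 'X^n * ((n%:R - 1) * (n%:R - 1) * (c n)%:P * (c n)%:P - 3 * y * (c n)%:P * (c n)%:P
  - 'X^n * (c n)%:P * (c n)%:P * (c n)%:P) - a%:P * 'X * 'X * (c n)%:P.
have -> : wp_defect (y + (c n)%:P * 'X^n) = wp_defect y + q * 'X^n.
  rewrite /wp_defect /q !(thetaD, thetaM (c n)%:P, thetaC) tX; ring.
rewrite coefD coefMXn ltnn subnn -horner_coef0 /q.
rewrite !(hornerD, hornerN, hornerM, hornerC, hornerX, hornerXn, y0, t0).
rewrite -!polyC_natr !hornerC expr0n gtn_eqF ?(ltn_trans _ n1) //=.
by move/eqP; rewrite addr_eq0 => /eqP ->; rewrite natrD natrM; ring.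
Qed.

End FirstOrder.

(** * The recurrence modulo 2 and 4 *)

Notation Z2X := (polyOver Zloc2).

Lemma Z2X_odd (m : nat) (p : {poly rat}) : odd m -> m%:R * p \is a Z2X -> p \is a Z2X.
Proof.
move=> om hp; have hC : (m%:R^-1)%:P \is a Z2X by rewrite polyOverC Zloc2_invodd.
have := rpredM hC hp; rewrite -polyC_natr mulrA -polyCM mulVf ?mul1r //.
by rewrite pnatr_eq0 -lt0n odd_gt0.
Qed.

(** Scaling, instead of an existential quotient, lets the closure properties be inherited from
    [Z2X]. *)
Definition dvd2 (e : nat) : {pred {poly rat}} :=
  fun p => (2 ^+ e)^-1 *: p \is a Z2X.

Lemma dvd2_zmod e : zmod_closed (dvd2 e).
Proof.
split=> [|p q]; first by rewrite unfold_in scaler0 rpred0.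
by rewrite !unfold_in scalerBr; apply: rpredB.
Qed.
HB.instance Definition _ e := GRing.isZmodClosed.Build {poly rat} (dvd2 e) (dvd2_zmod e).

Lemma dvd2Mn e p : p \is a Z2X -> 2 ^+ e * p \in dvd2 e.
Proof.
move=> hp; rewrite unfold_in -mul_polyC mulrA.
have -> : 2 ^+ e = (2 ^+ e : rat)%:P by rewrite rmorphXn /= polyC_natr.
by rewrite -polyCM mulVf ?mul1r // expf_neq0.
Qed.

Lemma dvd2P e p : reflect (exists2 q, q \is a Z2X & p = 2 ^+ e * q) (p \in dvd2 e).
Proof.
apply: (iffP idP) => [hp|[q hq ->]]; last exact: dvd2Mn.
exists ((2 ^+ e)^-1 *: p); first exact: hp.
have -> : 2 ^+ e = (2 ^+ e : rat)%:P by rewrite rmorphXn /= polyC_natr.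
by rewrite mul_polyC scalerA divff ?scale1r // expf_neq0.
Qed.

Lemma dvd2_Z2X e p : p \in dvd2 e -> p \is a Z2X.
Proof. by case/dvd2P => q hq ->; rewrite rpredM // rpredX // rpred_nat. Qed.

Lemma dvd2M e f p q : p \in dvd2 e -> q \in dvd2 f -> p * q \in dvd2 (e + f).
Proof.
case/dvd2P=> p' hp' -> /dvd2P[q' hq' ->]; apply/dvd2P.
by exists (p' * q'); rewrite ?rpredM // exprD; ring.
Qed.

Lemma dvd2_0 p : (p \in dvd2 0) = (p \is a Z2X).
Proof. by rewrite unfold_in expr0 invr1 scale1r. Qed.

Lemma dvd2Ml e p q : p \is a Z2X -> q \in dvd2 e -> p * q \in dvd2 e.
Proof. by rewrite -dvd2_0 => hp hq; have := dvd2M hp hq. Qed.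

Lemma dvd2Mr e p q : p \in dvd2 e -> q \is a Z2X -> p * q \in dvd2 e.
Proof. by rewrite mulrC => *; apply: dvd2Ml. Qed.

Lemma dvd2_odd e (m : nat) p : odd m -> m%:R * p \in dvd2 e -> p \in dvd2 e.
Proof.
rewrite !unfold_in => om; rewrite scalerAr; exact: Z2X_odd.
Qed.

Lemma dvd2_X p : 'X * p \in dvd2 1 -> p \in dvd2 1.
Proof.
rewrite !unfold_in => /polyOverP h; apply/polyOverP => i.
by have := h i.+1; rewrite !coefZ coefXM.
Qed.

Lemma sum_conv_even (R : comNzRingType) (f : nat -> R) h :
  \sum_(i < (2 * h).+1) f i * f (2 * h - i)%N =
  f h * f h + 2 * \sum_(0 <= i < h) f i * f (2 * h - i)%N.
Proof.
rewrite -(big_mkord xpredT (fun i => f i * f (2 * h - i)%N)).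
rewrite (@big_cat_nat _ _ _ h) //=; last by lia.
rewrite (@big_cat_nat _ _ _ h.+1 h) //=; last by lia.
rewrite big_nat1; have -> : (2 * h - h = h)%N by lia.
rewrite [X in _ + (_ + X)](_ : _ = \sum_(0 <= i < h) f i * f (2 * h - i)%N); first ring.
rewrite -[h.+1]add0n big_addn; have -> : ((2 * h).+1 - h.+1 = h)%N by lia.
rewrite big_nat_rev /= big_nat_cond [RHS]big_nat_cond; apply: eq_bigr => i /andP[/andP[_ ih] _].
rewrite mulrC; congr (f _ * f _); lia.
Qed.

Lemma sum_conv_odd (R : comNzRingType) (f : nat -> R) h :
  \sum_(i < (2 * h).+2) f i * f ((2 * h).+1 - i)%N =
  2 * \sum_(0 <= i < h.+1) f i * f ((2 * h).+1 - i)%N.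
Proof.
rewrite -(big_mkord xpredT (fun i => f i * f ((2 * h).+1 - i)%N)).
rewrite (@big_cat_nat _ _ _ h.+1) //=; last by lia.
rewrite [X in _ + X](_ : _ = \sum_(0 <= i < h.+1) f i * f ((2 * h).+1 - i)%N); first ring.
rewrite -[X in \sum_(X <= i < _) _]add0n big_addn; have -> : ((2 * h).+2 - h.+1 = h.+1)%N by lia.
rewrite big_nat_rev /= big_nat_cond [RHS]big_nat_cond; apply: eq_bigr => i /andP[/andP[_ ih] _].
rewrite mulrC; congr (f _ * f _); lia.
Qed.

Lemma dvd2_2 p : p \is a Z2X -> 2 * p \in dvd2 1.
Proof. by move=> hp; apply/dvd2P; exists p; rewrite ?expr1. Qed.

(** With its odd counterpart, this is the Frobenius modulo 2: squaring a series squares the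
    coefficients and doubles the exponents, since the terms [i] and [2 * k - i] pair up. *)
Lemma coef_sqr_even (x : {poly {poly rat}}) k :
  x \is a polyOver (polyOver_pred Zloc2) -> (x * x)`_(2 * k) - x`_k * x`_k \in dvd2 1.
Proof.
move=> /polyOverP hx; rewrite coefM sum_conv_even addrC addKr.
by apply/dvd2_2/rpred_sum => i _; apply: rpredM; apply: hx.
Qed.

Lemma coef_sqr_odd (x : {poly {poly rat}}) k :
  x \is a polyOver (polyOver_pred Zloc2) -> (x * x)`_(2 * k).+1 \in dvd2 1.
Proof.
move=> /polyOverP hx; rewrite coefM sum_conv_odd.
by apply/dvd2_2/rpred_sum => i _; apply: rpredM; apply: hx.
Qed.

Section TwoAdic.
Variable c : nat -> {poly rat}.
Hypothesis hc : wp_rec (- 3) 'X c.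

Lemma polyrat_char0 n : (n.+1%:R : {poly rat}) != 0.
Proof. by rewrite -polyC_natr polyC_eq0 pnatr_eq0. Qed.

Lemma wp_c2 : 5 * c 2 = 3.
Proof.
case: hc => c0 c1 _ /(_ 2%N); rewrite !big_ord_recl big_ord0 /= /bump /= c0 c1 => h.
move: h; rewrite !(subn0, subn1, subnn) => h.
have -> : 5 * c 2 = 3 * (1 * c 2 + (0 * 0 + (c 2 * 1 + 0))) + - 3 * 1 -
  (2 * (2%:R * 2%:R) - 5 * 2%:R + 3) * c 2 + 3 by ring.
by rewrite -h subrr add0r.
Qed.

Lemma wp_c3 : - 7%:R * c 3 = 'X. Proof. by case: hc. Qed.

Lemma wp_int n : c n \is a Z2X.
Proof.
elim/ltn_ind: n => n IH.
have [c0 c1 c3 _] := hc.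
case: (leqP n 3) => [|n3].
  case: n {IH} => [|[|[|[|//]]]] _; rewrite ?c0 ?c1 ?rpred0 ?rpred1 //.
    by apply: (@Z2X_odd 5) => //; rewrite wp_c2 rpred_nat.
  apply: (@Z2X_odd 7) => //; rewrite -[X in X \is a _]opprK rpredN -mulNr c3.
  exact: polyOverX.
apply: (@Z2X_odd (2 * n + 1)%N); first by lia.
rewrite (wp_coef_lower polyrat_char0 hc n3).
have hy : \poly_(i < n) c i \is a polyOver (polyOver_pred Zloc2).
  by apply/polyOverP => i; rewrite coef_poly; case: ifP => [/IH|]; rewrite ?rpred0.
suff /polyOverP : wp_defect (- 3) 'X (\poly_(i < n) c i) \is a polyOver (polyOver_pred Zloc2) by apply.
rewrite /wp_defect; have hX : 'X \is a Z2X by apply: polyOverX.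
rewrite !(rpredB, rpredM, polyOverX, polyOverC, hX) ?polyOver_deriv //.
by rewrite rpredN rpred_nat.
Qed.

Definition halfconv h := \sum_(2 <= i < h) c i * c (2 * h - i)%N.

Lemma halfconv_int h : halfconv h \is a Z2X.
Proof. by apply: rpred_sum => i _; apply: rpredM; apply: wp_int. Qed.

(** At even index both factors on the left are odd, so [c (2 * h)] modulo 4 depends only on
    [c h ^ 2] modulo 4 and on the parity of [halfconv h]. *)
Lemma wp_double h : (1 < h)%N ->
  (4 * h + 1)%:R * (2 * h - 3)%:R * c (2 * h)%N = 3 * (c h * c h) + 6 * halfconv h.
Proof.
move=> h1; have [c0 c1 _ /(_ (2 * h)%N)] := hc.
rewrite sum_conv_even (@big_cat_nat _ _ _ 2) // big_ltn // big_nat1 c0 c1 -/(halfconv h).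
have -> : (2 * h == 2)%N = false by apply/negbTE; lia.
rewrite subn0 mul1r mul0r mulr0 !addr0 natrB; last by lia.
rewrite natrD !natrM => e; apply/eqP; rewrite -subr_eq0; apply/eqP.
transitivity ((2 * (2%:R * h%:R * (2%:R * h%:R)) - 5 * (2%:R * h%:R) + 3) * c (2 * h)%N
  - 3 * (c h * c h + 2 * (c (2 * h)%N + halfconv h))); first ring.
by rewrite e /= addr0 subrr.
Qed.

Lemma wp_double_mod2 h : (1 < h)%N -> c (2 * h)%N - c h * c h \in dvd2 1.
Proof.
move=> h1; apply: (@dvd2_odd _ ((4 * h + 1) * (2 * h - 3))%N); first by rewrite oddM; lia.
rewrite mulrBr natrM wp_double // natrB; last by lia.
have -> : 3 * (c h * c h) + 6 * halfconv h - (4 * h + 1)%:R * ((2 * h)%:R - 3%:R) * (c h * c h)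
  = 2 * (3 * halfconv h - ((4 * h%:R * h%:R) - 5 * h%:R - 3) * (c h * c h)).
  rewrite natrD !natrM; ring.
by apply: dvd2_2; rewrite !(rpredB, rpredM, rpred_nat, halfconv_int, wp_int).
Qed.

End TwoAdic.

Notation Z2XX := (polyOver (polyOver_pred Zloc2)).

Definition small (N : nat) (p : {poly {poly rat}}) :=
  p \is a Z2XX /\ forall i, (i <= N)%N -> p`_i \in dvd2 1.

Lemma smallD N p q : small N p -> small N q -> small N (p + q).
Proof.
move=> [p1 p2] [q1 q2]; split=> [|i iN]; first exact: rpredD.
by rewrite coefD rpredD ?p2 ?q2.
Qed.

Lemma smallN N p : small N p -> small N (- p).
Proof.
move=> [p1 p2]; split=> [|i iN]; first by rewrite rpredN.
by rewrite coefN rpredN p2.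
Qed.

Lemma smallB N p q : small N p -> small N q -> small N (p - q).
Proof. by move=> hp hq; apply: smallD => //; apply: smallN. Qed.

Lemma smallM N p q : q \is a Z2XX -> small N p -> small N (q * p).
Proof.
move=> hq [p1 p2]; split=> [|i iN]; first exact: rpredM.
rewrite coefM; apply: rpred_sum => j _; apply: dvd2Ml.
  by move/polyOverP: hq; apply.
by apply: p2; apply: leq_trans (leq_subr _ _) iN.
Qed.

Lemma small2 N p : p \is a Z2XX -> small N (2 * p).
Proof.
move=> hp; split=> [|i iN]; first by rewrite rpredM // rpred_nat.
rewrite -(polyC_natr _ 2) coefCM; apply: dvd2_2.
by move/polyOverP: hp; apply.
Qed.

Lemma Z2XX_X : ('X : {poly {poly rat}}) \is a Z2XX. Proof. exact: polyOverX. Qed.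
Lemma Z2XX_Y : (('X : {poly rat})%:P) \is a Z2XX.
Proof. by rewrite polyOverC; apply: polyOverX. Qed.

(** * Even and odd parts of the solution modulo 2 *)

Section OddPart.
Variable c : nat -> {poly rat}.
Hypothesis hc : wp_rec (- 3) 'X c.
Variable N : nat.
Hypothesis N3 : (3 <= N)%N.

Let x := \poly_(i < N.+1) c i.
Let E := \poly_(i < N.+1) (if odd i then 0 else c i).
Definition wp_odd := \poly_(i < N.+1) (if odd i then c i else 0).
(** The outer ['X] is the series variable [s ^ 2], the inner one the parameter [b] of the
    recurrence. *)
Let b : {poly {poly rat}} := 'X%:P.

Let xZ : x \is a Z2XX.
Proof. by apply: polyOver_poly => i _; apply: wp_int. Qed.
Let EZ : E \is a Z2XX.
Proof. by apply: polyOver_poly => i _; case: ifP => _; rewrite ?rpred0 ?(wp_int hc). Qed.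
Lemma wp_odd_over : wp_odd \is a Z2XX.
Proof. by apply: polyOver_poly => i _; case: ifP => _; rewrite ?rpred0 ?(wp_int hc). Qed.
Let OZ := wp_odd_over.
Let aZ : ((- 3)%:P : {poly {poly rat}}) \is a Z2XX.
Proof. by rewrite polyOverC rpredN rpred_nat. Qed.

Let xEO : x = E + wp_odd.
Proof.
apply/polyP => i; rewrite coefD !coef_poly; case: ifP => _; last by rewrite addr0.
by case: ifP => _; rewrite ?add0r ?addr0.
Qed.

Let xE i : (i <= N)%N -> x`_i = c i.
Proof. by move=> iN; rewrite coef_poly ltnS iN. Qed.

(** [theta] minus the identity multiplies the coefficient of index [i] by [i - 1], which modulo 2
    retains exactly the even indices. *)
Let small_theta : small N (theta x - x - E).
Proof.
split=> [|i iN].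
  by rewrite !rpredB // /theta rpredM // ?Z2XX_X // polyOver_deriv.
rewrite !coefB coef_theta xE // coef_poly ltnS iN.
have ci := wp_int hc i.
case: ifP => oi.
  rewrite subr0 -{2}[c i]mul1r -mulrBl -[1]/(1%:R) -natrB ?odd_gt0 //.
  have -> : (i - 1 = 2 * i./2)%N by lia.
  by rewrite natrM -mulrA; apply: dvd2_2; rewrite rpredM ?rpred_nat.
have -> : (i = 2 * i./2)%N by lia.
rewrite natrM (_ : _ - _ = 2 * (i./2%:R * c (2 * i./2)%N - c (2 * i./2)%N)); last by ring.
by apply: dvd2_2; rewrite rpredB ?rpredM ?rpred_nat ?(wp_int hc).
Qed.

(** By the Frobenius, [wp_double_mod2] says that [E] and [x ^ 2] agree modulo 2. Index 2 escapes the
    doubling relation and accounts for the term in ['X^2]. *)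
Let small_even : small N (E - x * x - (- 3)%:P * 'X^2).
Proof.
split=> [|i iN].
  by rewrite !rpredB ?rpredM ?Z2XX_X.
rewrite !coefB coefCM coefXn [E`_i]coef_poly ltnS iN.
have [c0 c1 _ _] := hc.
case: ifP => oi.
  have -> : (i == 2)%N = false by apply/negbTE; lia.
  rewrite mulr0 subr0 sub0r rpredN.
  have -> : (i = (2 * i./2).+1)%N by lia.
  exact: coef_sqr_odd.
have ei : (i = 2 * i./2)%N by lia.
case: (leqP i 3) => [i3|i3]; last first.
  have -> : (i == 2)%N = false by apply/negbTE; lia.
  rewrite mulr0 subr0.
  have := coef_sqr_even i./2 xZ; rewrite -ei xE; last by lia.
  have := @wp_double_mod2 _ hc i./2; rewrite -ei => /(_ ltac:(lia)) h1 h2.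
  by have := rpredB h1 h2; rewrite opprB addrA subrK.
have [i0|i2] : (i = 0)%N \/ (i = 2)%N by lia.
  rewrite i0 coefM big_ord_recl big_ord0 /= subn0 xE // c0 /=.
  by rewrite mulr0 subr0 mulr1 addr0 subrr rpred0.
have -> : (x * x)`_i = c 0 * c 2 + (c 1 * c 1 + c 2 * c 0).
  rewrite i2 -!xE //; try by lia.
  by rewrite coefM !big_ord_recl big_ord0 addr0.
rewrite i2 c0 c1 eqxx; apply: (@dvd2_odd _ 5) => //.
have -> : 5 * (c 2 - (1 * c 2 + (0 * 0 + c 2 * 1)) - - 3 * 1) = 15 - 5 * c 2 by ring.
rewrite wp_c2 //.
have -> : 15 - 3 = 2 * 6%:R :> {poly rat} by ring.
by apply: dvd2_2; rewrite rpred_nat.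
Qed.

(* Modulo 2, [theta] and squaring separate the even and odd parts; eliminating the even
   part leaves a quartic relation that is additive in the odd part. *)
Lemma wp_odd_relation :
  small N (b * 'X^3 * wp_odd - b ^+ 2 * 'X^6 - wp_odd ^+ 4 - (- 3)%:P * 'X^2 * wp_odd ^+ 2).
Proof.
set O := wp_odd.
have bZ : b \is a Z2XX by exact: Z2XX_Y.
have XZ := Z2XX_X.
have X3Z : b * 'X^3 \is a Z2XX by rewrite rpredM ?rpredX.
have hw : small N (wp_defect (- 3) 'X x).
  split=> [|i iN].
    by rewrite /wp_defect !(rpredB, rpredM) ?polyOver_deriv.
  by rewrite (wp_first_order polyrat_char0 hc) ?rpred0.
(* Modulo 2, inserting [theta x - x = E] and [x ^ 2 + a 'X^2 = E] into the first-order equation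
   gives [E ^ 2 = x E + b 'X^3], and [E - x] is the odd part up to sign. *)
have h1 : small N (O * E - b * 'X^3).
  have -> : O * E - b * 'X^3 = (- 1) * wp_defect (- 3) 'X x + (theta x - x + E) * (theta x - x - E)
      + x * (E - x * x - (- 3)%:P * 'X^2) - 2 * (b * 'X^3).
    rewrite /wp_defect -/b; set u := theta x; rewrite xEO -/O; ring.
  have tZ : theta x \is a Z2XX by rewrite rpredM ?polyOver_deriv.
  apply: smallB; last exact: small2.
  apply: smallD; last exact: smallM.
  apply: smallD; last by apply: smallM => //; rewrite rpredD ?rpredB.
  by apply: smallM => //; rewrite rpredN rpred1.
have h2 : small N (E - E * E - O * O - (- 3)%:P * 'X^2).
  have -> : E - E * E - O * O - (- 3)%:P * 'X^2 = (E - x * x - (- 3)%:P * 'X^2) + 2 * (E * O).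
    by rewrite xEO -/O; ring.
  by apply: smallD => //; apply: small2; rewrite rpredM.
(* After multiplication of [h2] by [O ^ 2], the even part occurs only in [O * E], which [h1]
   replaces by [b * 'X^3]. *)
have -> : b * 'X^3 * O - b ^+ 2 * 'X^6 - O ^+ 4 - (- 3)%:P * 'X^2 * O ^+ 2 =
  (O * O) * (E - E * E - O * O - (- 3)%:P * 'X^2) - O * (O * E - b * 'X^3)
  + (O * E - b * 'X^3) * (O * E - b * 'X^3) + 2 * (b * 'X^3 * (O * E - b * 'X^3)) by ring.
have OEZ : O * E - b * 'X^3 \is a Z2XX by case: h1.
apply: smallD; last by apply: small2; rewrite rpredM.
apply: smallD; last exact: smallM.
by apply: smallB; apply: smallM => //; rewrite rpredM.
Qed.

End OddPart.

(** * Coefficients of index [6 * 2 ^ m] modulo 4 *)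

Section ModFour.
Variable c : nat -> {poly rat}.
Hypothesis hc : wp_rec (- 3) 'X c.

(** The coefficient of ['X^(n + 3)] in [wp_odd_relation], with the truncation order chosen just
    large enough to see it. The term [b ^ 2 * 'X^6] is felt only at [n = 3]. *)
Lemma wp_odd_rel n : odd n ->
  let O := wp_odd c n.+3 in
  'X * c n - (n == 3)%:R * 'X ^+ 2 - (O ^+ 4)`_(n + 3) + 3 * (O ^+ 2)`_n.+1 \in dvd2 1.
Proof.
move=> on; set O := wp_odd c n.+3; cbv zeta.
have [_ /(_ (n + 3)%N)] := wp_odd_relation hc (isT : (3 <= n.+3)%N).
rewrite addn3 leqnn => /(_ isT); rewrite -/O.
rewrite -polyC_exp -!mulrA !(coefB, coefCM, coefXM, coefXn) /= coef_poly on.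
have -> : (n < n.+4)%N by lia.
rewrite (_ : (if n == 0%N then 0 else _) = (n == 3)%:R); last first.
  by clear; case: n => [|[|[|m]]] //=; rewrite coefX.
by rewrite mulNr opprK [X in _ - X - _ + _]mulrC.
Qed.

Lemma coef_wp_odd N i : (i <= N)%N -> (wp_odd c N)`_i = if odd i then c i else 0.
Proof. by move=> iN; rewrite coef_poly ltnS iN. Qed.

(* Modulo 2 the quartic relation expresses [b * c n] by [c k ^ 2] with [2 k = n + 1] and
   [c k ^ 4] with [4 k = n + 3]; both substitutions preserve the set of [2 ^ i + 1]. *)
Lemma wp_odd_vanish n : odd n -> (forall i, n <> 2 ^ i.+1 + 1)%N -> c n \in dvd2 1.
Proof.
elim/ltn_ind: n => n IH on hn.
have [c0 c1 _ _] := hc.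
case: (leqP n 1) => [n1|n1].
  by have -> : n = 1%N; [lia | rewrite c1 rpred0].
have n3 : (n == 3)%N = false by apply/eqP; apply: (hn 0%N).
have := wp_odd_rel on; cbv zeta; rewrite n3 mul0r subr0.
set O := wp_odd c _ => h.
have OZ : O \is a Z2XX by apply: wp_odd_over.
have cases k : (k < n)%N -> (forall i, k <> 2 ^ i.+1 + 1)%N -> O`_k \in dvd2 1.
  move=> kn hk; rewrite coef_wp_odd; last by lia.
  by case: ifP => ok; rewrite ?rpred0 // IH.
have sq2 : (O * O)`_n.+1 \in dvd2 1.
  have -> : n.+1 = (2 * (n.+1)./2)%N by lia.
  rewrite -[_`_ _](subrK (O`_(n.+1)./2 * O`_(n.+1)./2)) rpredD ?coef_sqr_even //.
  apply: dvd2Mr; last by move/polyOverP: OZ; apply.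
  apply: cases; first by lia.
  by move=> i e; apply: (hn i.+1); rewrite expnS; lia.
have sq4 : (O ^+ 4)`_(n + 3) \in dvd2 1.
  have OOZ : O * O \is a Z2XX by rewrite rpredM.
  have -> : O ^+ 4 = (O * O) * (O * O) by ring.
  have -> : (n + 3 = 2 * (n + 3)./2)%N by lia.
  rewrite -[_`_ _](subrK ((O * O)`_(n + 3)./2 * (O * O)`_(n + 3)./2)) rpredD ?coef_sqr_even //.
  apply: dvd2Mr; last by move/polyOverP: OOZ; apply.
  case: (boolP (odd (n + 3)./2)) => [od|ev].
    have -> : ((n + 3)./2 = (2 * (n + 3)./2./2).+1)%N by lia.
    exact: coef_sqr_odd.
  have -> : ((n + 3)./2 = 2 * (n + 3)./2./2)%N by lia.
  rewrite -[_`_ _](subrK (O`_((n + 3)./2./2) * O`_((n + 3)./2./2))) rpredD ?coef_sqr_even //.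
  apply: dvd2Mr; last by move/polyOverP: OZ; apply.
  apply: cases; first by lia.
  by move=> i e'; apply: (hn i.+2); rewrite !expnS; rewrite expnS in e'; lia.
apply: dvd2_X.
have -> : 'X * c n = ('X * c n - (O ^+ 4)`_(n + 3) + 3 * (O ^+ 2)`_n.+1) + (O ^+ 4)`_(n + 3)
  - 3 * (O * O)`_n.+1 by rewrite expr2; ring.
apply: rpredB; first by apply: rpredD; [exact: h | exact: sq4].
by apply: dvd2Ml => //; rewrite rpred_nat.
Qed.

Lemma wp_c5 : 11 * c 5 = 3 * (c 2 * c 3).
Proof.
have [c0 c1 _ /(_ 5%N)] := hc.
rewrite (@sum_conv_odd _ c 2) big_ltn // big_ltn // big_nat1 c0 c1.
set u := c 2; have -> : c ((2 * 2).+1 - 2)%N = c 3 by [].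
move: (c _) (c _) => v w.
rewrite -[(5 == 2)%N]/false mulr0 addr0 => e.
apply: (@mulfI _ 2); first by rewrite -(polyC_natr _ 2) polyC_eq0.
transitivity ((2 * (5 * 5) - 5 * 5 + 3) * w - 6 * w); first ring.
by rewrite e; ring.
Qed.

Definition eqm e (p q : {poly rat}) := p - q \in dvd2 e.

Lemma eqm_refl e p : eqm e p p.
Proof. by rewrite /eqm subrr rpred0. Qed.
Lemma eqm_trans e q p r : eqm e p q -> eqm e q r -> eqm e p r.
Proof. by move=> h1 h2; have := rpredD h1 h2; rewrite addrA subrK. Qed.
Lemma eqmD e p q r s : eqm e p q -> eqm e r s -> eqm e (p + r) (q + s).
Proof. by move=> h1 h2; rewrite /eqm opprD addrACA rpredD. Qed.
Lemma eqm_Z2X e p q : eqm e p q -> q \is a Z2X -> p \is a Z2X.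
Proof. by move=> h hq; rewrite -(subrK q p) rpredD // (dvd2_Z2X h). Qed.
Lemma eqmM e p q r s : q \is a Z2X -> s \is a Z2X ->
  eqm e p q -> eqm e r s -> eqm e (p * r) (q * s).
Proof.
move=> hq hs h1 h2; rewrite /eqm.
have -> : p * r - q * s = (p - q) * r + q * (r - s) by ring.
apply: rpredD; last exact: dvd2Ml.
by apply: dvd2Mr => //; apply: eqm_Z2X h2 _.
Qed.
Lemma eqm_sqr2 p q : q \is a Z2X -> eqm 1 p q -> eqm 2 (p * p) (q * q).
Proof.
move=> hq h; rewrite /eqm.
have -> : p * p - q * q = (p - q) * (p - q) + 2 * q * (p - q) by ring.
apply: rpredD; first by have := dvd2M h h.
by have := dvd2M (dvd2_2 hq) h.
Qed.

Let XZ : ('X : {poly rat}) \is a Z2X. Proof. exact: polyOverX. Qed.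

Lemma wp_c2_mod2 : eqm 1 (c 2) 1.
Proof.
apply: (@dvd2_odd _ 5) => //; rewrite mulrBr wp_c2 //.
have -> : 3 - 5%:R * 1 = 2 * (- 1) :> {poly rat} by ring.
by apply: dvd2_2; rewrite rpredN rpred1.
Qed.

Lemma wp_c3_mod2 : eqm 1 (c 3) 'X.
Proof.
apply: (@dvd2_odd _ 7) => //; have h := wp_c3 hc.
have -> : 7 * (c 3 - 'X) = 2 * (- 4%:R * 'X) + (- (- 7 * c 3) + 'X) by ring.
by rewrite h addNr addr0; apply: dvd2_2; rewrite rpredM // rpredN rpred_nat.
Qed.

Lemma wp_c5_mod2 : eqm 1 (c 5) 'X.
Proof.
apply: (@eqm_trans _ (c 2 * c 3)).
  apply: (@dvd2_odd _ 11) => //; have h := wp_c5.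
  have -> : 11 * (c 5 - c 2 * c 3) = 11 * c 5 - 3 * (c 2 * c 3) + 2 * (- 4%:R * (c 2 * c 3)) by ring.
  by rewrite h subrr add0r; apply: dvd2_2; rewrite !rpredM ?rpredN ?rpred_nat ?wp_int.
rewrite -['X]mul1r; apply: eqmM; rewrite ?rpred1 //; [exact: wp_c2_mod2 | exact: wp_c3_mod2].
Qed.

(** Modulo 2 the quartic relation at [n = 9] reads [b * c 9 = c 3 ^ 4 + c 5 ^ 2], because 12 is
    [4 * 3] and 10 is [2 * 5]. *)
Lemma wp_c9_mod2 : eqm 1 (c 9) ('X ^+ 3 + 'X).
Proof.
apply: dvd2_X.
have := @wp_odd_rel 9 isT; cbv zeta; rewrite mul0r subr0.
set O := wp_odd c _ => h.
have OZ : O \is a Z2XX by apply: wp_odd_over.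
have OOZ : O * O \is a Z2XX by rewrite rpredM.
have O3 : O`_3 = c 3 by rewrite coef_wp_odd.
have O5 : O`_5 = c 5 by rewrite coef_wp_odd.
have s6 : eqm 1 (O * O)`_6 ('X * 'X).
  apply: eqm_trans (@coef_sqr_even O 3 OZ) _.
  by rewrite O3; apply: eqmM => //; apply: wp_c3_mod2.
have s10 : eqm 1 (O * O)`_10 ('X * 'X).
  apply: eqm_trans (@coef_sqr_even O 5 OZ) _.
  by rewrite O5; apply: eqmM => //; apply: wp_c5_mod2.
have s12 : eqm 1 (O ^+ 4)`_12 ('X * 'X * ('X * 'X)).
  have -> : O ^+ 4 = (O * O) * (O * O) by ring.
  apply: eqm_trans (@coef_sqr_even (O * O) 6 OOZ) _.
  by apply: eqmM => //; rewrite rpredM.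
have -> : 'X * (c 9 - ('X ^+ 3 + 'X)) =
   ('X * c 9 - (O ^+ 4)`_(9 + 3) + 3 * (O ^+ 2)`_10)
  + ((O ^+ 4)`_12 - 'X * 'X * ('X * 'X)) + (- 3) * ((O * O)`_10 - 'X * 'X) + 2 * (- 2%:R * 'X * 'X).
  rewrite expr2 -[(9 + 3)%N]/12%N; ring.
apply: rpredD; last by apply: dvd2_2; rewrite !rpredM ?rpredN ?rpred_nat.
apply: rpredD; first exact: rpredD.
by apply: dvd2Ml; rewrite ?rpredN ?rpred_nat.
Qed.

Lemma halfconv3 : eqm 1 (halfconv c 3) 1.
Proof.
rewrite /halfconv big_nat1 -[(2 * 3 - 2)%N]/(2 * 2)%N -[1]mulr1.
apply: eqmM; rewrite ?rpred1 //; first exact: wp_c2_mod2.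
apply: eqm_trans (wp_double_mod2 hc _) _ => //; rewrite -[1]mulr1.
by apply: eqmM; rewrite ?rpred1 //; exact: wp_c2_mod2.
Qed.

(** The four products [c 2 * c 10], [c 3 * c 9], [c 4 * c 8], [c 5 * c 7] are [b ^ 2],
    [b ^ 4 + b ^ 2], 1 and 0 modulo 2, and the two [b ^ 2] cancel. The last one vanishes because 7
    is not of the form [2 ^ i + 1]. *)
Lemma halfconv6 : eqm 1 (halfconv c 6) (1 + 'X ^+ 4).
Proof.
have -> : halfconv c 6 = c 2 * c (2 * 5)%N + (c 3 * c 9 + (c (2 * 2)%N * c (2 * (2 * 2))%N + c 5 * c 7)).
  by rewrite /halfconv 3?big_ltn // big_nat1.
have c4 : eqm 1 (c (2 * 2)%N) (1 * 1).
  apply: eqm_trans (wp_double_mod2 hc _) _ => //.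
  by apply: eqmM; rewrite ?rpred1 //; exact: wp_c2_mod2.
have c8 : eqm 1 (c (2 * (2 * 2))%N) (1 * 1 * (1 * 1)).
  apply: eqm_trans (wp_double_mod2 hc _) _ => //.
  by apply: eqmM => //; rewrite ?rpredM ?rpred1.
have c10 : eqm 1 (c (2 * 5)%N) ('X * 'X).
  apply: eqm_trans (wp_double_mod2 hc _) _ => //.
  by apply: eqmM => //; exact: wp_c5_mod2.
have c7 : eqm 1 (c 7) 0.
  rewrite /eqm subr0; apply: wp_odd_vanish => // i.
  case: i => [|[|[|i]]] //; rewrite !expnS; have := expn_gt0 2 i; lia.
apply: (@eqm_trans _ (1 * ('X * 'X) + ('X * ('X ^+ 3 + 'X) + (1 * 1 * (1 * 1 * (1 * 1)) + 'X * 0)))).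
  have Z1 : (1 : {poly rat}) \is a Z2X by rewrite rpred1.
  apply: eqmD; first by apply: eqmM; rewrite ?rpredM //; exact: wp_c2_mod2.
  apply: eqmD.
    by apply: eqmM; rewrite ?rpredD ?rpredX //; [exact: wp_c3_mod2 | exact: wp_c9_mod2].
  apply: eqmD; first by apply: eqmM; rewrite ?rpredM.
  by apply: eqmM; rewrite ?rpred0 //; exact: wp_c5_mod2.
rewrite /eqm (_ : _ - _ = 2 * 'X ^+ 2); last by ring.
by apply: dvd2_2; rewrite rpredX.
Qed.

Lemma wp_odd_nonzero n : odd n -> c n \notin dvd2 1 -> exists i, (n = 2 ^ i.+1 + 1)%N.
Proof.
move=> on; case: (boolP [exists i : 'I_n, n == (2 ^ i.+1 + 1)%N]) => [/existsP[i /eqP e] _|].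
  by exists i.
rewrite negb_exists => /forallP h /negP []; apply: wp_odd_vanish => // i e.
have lin : (i < n)%N by rewrite e; apply: leq_trans (ltn_expl i (isT : (1 < 2)%N)) _; rewrite expnS; lia.
by have := h (Ordinal lin); rewrite /= -e eqxx.
Qed.

Lemma sum_pairs (R : zmodType) (F : nat -> R) g :
  \sum_(2 <= i < 2 * g.+1) F i = \sum_(1 <= j < g.+1) (F (2 * j)%N + F (2 * j).+1).
Proof.
elim: g => [|g IH]; first by rewrite !big_geq.
rewrite [RHS]big_nat_recr //= -IH.
have -> : (2 * g.+2 = (2 * g.+1).+2)%N by lia.
rewrite big_nat_recr /=; last by lia.
by rewrite big_nat_recr /=; [rewrite addrA | lia].
Qed.

Lemma eqm_sum_sqr (s : seq nat) (F : nat -> {poly rat}) :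
  (forall i, F i \is a Z2X) ->
  eqm 1 (\sum_(i <- s) F i * F i) ((\sum_(i <- s) F i) * (\sum_(i <- s) F i)).
Proof.
move=> hF; elim: s => [|i s IH]; first by rewrite !big_nil mulr0; apply: eqm_refl.
rewrite !big_cons; set A := \sum_(j <- s) F j.
apply: eqm_trans (eqmD (eqm_refl _ _) IH) _.
rewrite /eqm (_ : _ - _ = 2 * (- (F i * A))); last by rewrite -/A; ring.
by apply: dvd2_2; rewrite rpredN rpredM // rpred_sum.
Qed.

(** The two powers of 2 add up to [4 * g - 2], which is 6 modulo 8 for even [g]. This forces them to
    be 2 and 4, hence [g = 2]. *)
Lemma odd_split_pow2 p q g : (2 < g)%N -> ~~ odd g ->
  (2 ^ p.+1 + 1 + (2 ^ q.+1 + 1) = 4 * g)%N -> False.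
Proof.
move=> g2 og; rewrite !expnS.
case: p => [|p]; case: q => [|q]; rewrite ?expnS ?expn0; try lia.
  case: q => [|q]; rewrite ?expnS ?expn0; first by lia.
  have := expn_gt0 2 q; lia.
case: p => [|p]; rewrite ?expnS ?expn0; first by lia.
have := expn_gt0 2 p; lia.
Qed.

(** The products of two odd-index coefficients vanish modulo 2, since two indices [2 ^ i + 1] never
    add up to [4 * g]. A product of even-index coefficients is the square of the product at half the
    indices, and a sum of squares is a square modulo 2. The pair containing [c 2] drops out because
    [2 * g - 1] is not [2 ^ i + 1] either. *)
Lemma halfconv_double g : (2 < g)%N -> ~~ odd g ->
  eqm 1 (halfconv c (2 * g)) (halfconv c g * halfconv c g).
Proof.
move=> g2 og; rewrite {1}/halfconv.
have -> : (2 * g = 2 * g.-1.+1)%N by lia.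
rewrite sum_pairs prednK; last by lia.
rewrite -(addr0 (halfconv c g * _)) addrC big_ltn; last by lia.
have cZ n : c n \is a Z2X by apply: wp_int.
have hodd j : (j < g)%N -> c (2 * j).+1 * c (2 * (2 * g) - (2 * j).+1)%N \in dvd2 1.
  move=> jg; case: (boolP (c (2 * j).+1 \in dvd2 1)) => [h|h1]; first exact: dvd2Mr.
  case: (boolP (c (2 * (2 * g) - (2 * j).+1)%N \in dvd2 1)) => [h|h2]; first exact: dvd2Ml.
  have [|p hp] := wp_odd_nonzero _ h1; first by rewrite /= oddM.
  have [|q hq] := wp_odd_nonzero _ h2; first by lia.
  by exfalso; apply: (@odd_split_pow2 p q g) => //; rewrite -hp -hq; lia.
apply: eqmD.
  rewrite /eqm subr0 rpredD ?hodd //; last by lia.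
  apply: dvd2Ml => //.
  have -> : (2 * (2 * g) - 2 * 1 = 2 * (2 * g).-1)%N by lia.
  rewrite -[c _](subrK (c (2 * g).-1 * c (2 * g).-1)) rpredD //.
    by apply: wp_double_mod2 => //; lia.
  apply: dvd2Mr => //; apply: wp_odd_vanish => //; first by lia.
  case=> [|i]; rewrite !expnS ?expn0; first by lia.
  by have := expn_gt0 2 i; lia.
apply: (@eqm_trans _ (\sum_(2 <= j < g) c j * c (2 * g - j)%N * (c j * c (2 * g - j)%N))); last first.
  by apply: (@eqm_sum_sqr _ (fun j => c j * c (2 * g - j)%N)) => i; apply: rpredM; apply: cZ.
rewrite /eqm -sumrB big_nat_cond; apply: rpred_sum => j /andP[/andP[j2 jg] _].
rewrite addrAC; apply: rpredD; last by apply: hodd.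
rewrite -/(eqm 1 _ _).
have -> : (2 * (2 * g) - 2 * j = 2 * (2 * g - j))%N by lia.
have -> : c j * c (2 * g - j)%N * (c j * c (2 * g - j)%N) =
  (c j * c j) * (c (2 * g - j)%N * c (2 * g - j)%N) by ring.
by apply: eqmM; rewrite ?rpredM //; apply: wp_double_mod2 => //; lia.
Qed.

Lemma halfconv_pow2 m : eqm 1 (halfconv c (6 * 2 ^ m)) (1 + 'X ^+ (4 * 2 ^ m)).
Proof.
elim: m => [|m IH]; first exact: halfconv6.
have -> : (6 * 2 ^ m.+1 = 2 * (6 * 2 ^ m))%N by rewrite expnS; lia.
apply: eqm_trans (halfconv_double _ _) _; first by have := expn_gt0 2 m; lia.
  by rewrite oddM.
have XnZ n : ('X ^+ n : {poly rat}) \is a Z2X by rewrite rpredX.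
apply: eqm_trans (eqmM _ _ IH IH) _; rewrite ?rpredD ?rpred1 //.
have -> : (4 * 2 ^ m.+1 = 4 * 2 ^ m + 4 * 2 ^ m)%N by rewrite expnS; lia.
rewrite /eqm exprD (_ : _ - _ = 2 * ('X ^+ (4 * 2 ^ m))); last by ring.
by apply: dvd2_2; rewrite rpredX.
Qed.

(** Induction by doubling. For [n = 2 ^ m], the induction hypothesis modulo 2 already gives the
    square of [c (6 * n)] modulo 4, namely [b ^ (4 * n)]. With [halfconv_pow2] the right side of
    [wp_double] becomes [6 + 9 * b ^ (4 * n)], and its left factor [(24 * n + 1) * (12 * n - 3)] is
    1 modulo 4. *)
Theorem wp_mod4 m : eqm 2 (c (6 * 2 ^ m)%N) (2 + 'X ^+ (2 * 2 ^ m)).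
Proof.
have cZ n : c n \is a Z2X by apply: wp_int.
have four p : p \is a Z2X -> 4 * p \in dvd2 2.
  by move=> hp; apply/dvd2P; exists p => //; congr (_ * _); ring.
have two_two p : p \in dvd2 1 -> 2 * p \in dvd2 2.
  by case/dvd2P => q hq ->; rewrite mulrA -expr2; exact: dvd2Mn.
elim: m => [|m IH].
  rewrite /eqm; apply: (@dvd2_odd _ 39) => //.
  have h := @wp_double _ hc 3 isT.
  rewrite -[(4 * 3 + 1)%N]/13%N -[(2 * 3 - 3)%N]/3%N -[(2 * 3)%N]/6%N in h.
  rewrite -[(6 * 2 ^ 0)%N]/6%N -[(2 * 2 ^ 0)%N]/2%N.
  have -> : 39%:R * (c 6 - (2 + 'X ^+ 2)) =
    3 * (c 3 * c 3 - 'X * 'X) + 6%:R * (halfconv c 3 - 1) + 4 * (- 18%:R - 9%:R * ('X * 'X)).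
    transitivity (13%:R * 3%:R * c 6 - 39%:R * (2 + 'X * 'X)); first by ring.
    by rewrite h; ring.
  apply: rpredD; last first.
    by apply: four; rewrite !(rpredB, rpredM, rpredN, rpred_nat).
  apply: rpredD.
    apply: dvd2Ml; first by rewrite rpred_nat.
    by apply: eqm_sqr2 => //; exact: wp_c3_mod2.
  have -> : 6%:R * (halfconv c 3 - 1) = 3 * (2 * (halfconv c 3 - 1)) by ring.
  by apply: dvd2Ml; rewrite ?rpred_nat // two_two //; exact: halfconv3.
set n := (2 ^ m)%N in IH *.
have n0 : (0 < n)%N by rewrite expn_gt0.
have -> : (6 * 2 ^ m.+1 = 2 * (6 * n))%N by rewrite expnS /n; lia.
have -> : (2 * 2 ^ m.+1 = 4 * n)%N by rewrite expnS /n; lia.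
rewrite /eqm; apply: (@dvd2_odd _ ((4 * (6 * n) + 1) * (2 * (6 * n) - 3))); first by lia.
rewrite mulrBr natrM wp_double //; last by lia.
have h1 : eqm 2 (c (6 * n)%N * c (6 * n)%N) ('X ^+ (4 * n)).
  have -> : (4 * n = 2 * n + 2 * n)%N by lia.
  rewrite exprD; apply: eqm_sqr2; first by rewrite rpredX.
  have : 2 + 'X ^+ (2 * n) - 'X ^+ (2 * n) \in dvd2 1.
    by rewrite addrK -[2]mulr1; apply: dvd2_2; rewrite rpred1.
  apply: eqm_trans.
  by case/dvd2P: IH => q hq e; rewrite /eqm e exprS -mulrA; apply: dvd2_2; rewrite rpredM ?rpredX ?rpred_nat.
have h2 := halfconv_pow2 m; rewrite -/n in h2.
rewrite (_ : _ - _ = 3 * (c (6 * n)%N * c (6 * n)%N - 'X ^+ (4 * n))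
  + 3 * (2 * (halfconv c (6 * n) - (1 + 'X ^+ (4 * n))))
  + 4 * (3 + 3 * 'X ^+ (4 * n) -
      (72%:R * n%:R * n%:R - 15%:R * n%:R) * (2 + 'X ^+ (4 * n)))); last first.
  by rewrite natrB ?natrD ?natrM; [ring | lia].
apply: rpredD; last first.
  have YZ : ('X ^+ (4 * n) : {poly rat}) \is a Z2X by rewrite rpredX.
  apply: four; apply: rpredB; first by rewrite rpredD ?rpredM ?rpred_nat.
  apply: rpredM; last by rewrite rpredD ?rpred_nat.
  by apply: rpredB; rewrite -!natrM rpred_nat.
apply: rpredD; first by apply: dvd2Ml; rewrite ?rpred_nat.
by apply: dvd2Ml; rewrite ?rpred_nat // two_two.
Qed.

End ModFour.

(** * The Eisenstein-Dumas criterion *)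

(* [val2 0 = 0], hence the nonvanishing side conditions below. *)
Definition val2 (x : rat) : int := (logn 2 `|numq x|)%:Z - (logn 2 `|denq x|)%:Z.

Lemma val2_frac (n m : int) : n != 0 -> m != 0 ->
  val2 (n%:~R / m%:~R) = (logn 2 `|n|)%:Z - (logn 2 `|m|)%:Z.
Proof.
move=> n0 m0; set x := _ / _.
have x0 : x != 0 by rewrite mulf_neq0 ?invr_eq0 ?intr_eq0.
have e : numq x * m = n * denq x.
  apply: (@intr_inj rat); rewrite !intrM numqE /x mulrAC divfK ?intr_eq0 //.
have nx0 : numq x != 0 by rewrite numq_eq0.
have := congr1 (fun k : int => logn 2 `|k|) e.
rewrite !abszM !lognM ?absz_gt0 ?denq_neq0 // /val2; lia.
Qed.

Lemma val2E (x : rat) : x != 0 -> exists n m : int, [/\ n != 0, m != 0 & x = n%:~R / m%:~R].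
Proof.
by move=> x0; exists (numq x), (denq x); rewrite numq_eq0 denq_neq0 divq_num_den.
Qed.

Lemma val2M (x y : rat) : x != 0 -> y != 0 -> val2 (x * y) = val2 x + val2 y.
Proof.
move=> /val2E[n [m [n0 m0 ->]]] /val2E[n' [m' [n0' m0' ->]]].
have -> : n%:~R / m%:~R * (n'%:~R / m'%:~R) = (n * n')%:~R / (m * m')%:~R :> rat.
  by rewrite !intrM invfM; ring.
rewrite !val2_frac ?mulf_neq0 // !abszM !lognM ?absz_gt0 //; lia.
Qed.

Lemma val2_Zloc2 (x : rat) : x != 0 -> (x \in Zloc2) = (0 <= val2 x).
Proof.
move=> x0; have nx0 : (0 < `|numq x|)%N by rewrite absz_gt0 numq_eq0.
have dx0 : (0 < `|denq x|)%N by rewrite absz_gt0 denq_neq0.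
rewrite /val2 unfold_in /=; apply/idP/idP => [od|].
  by rewrite [logn 2 `|denq x|]lognE dvdn2 od !andbF subr0.
apply: contraLR => e; rewrite -ltNge subr_lt0.
have dd : (0 < logn 2 `|denq x|)%N by rewrite logn_gt0 mem_primes /= dx0 dvdn2 e.
have [->|] := posnP (logn 2 `|numq x|); first by [].
rewrite logn_gt0 mem_primes /= => /andP[_ nn].
have := coprime_num_den x; rewrite /coprime => /eqP g.
have : (2 %| gcdn `|numq x| `|denq x|)%N by rewrite dvdn_gcd nn dvdn2.
by rewrite g.
Qed.

Lemma val2X (x : rat) n : x != 0 -> val2 (x ^+ n) = n%:Z * val2 x.
Proof.
move=> x0; elim: n => [|n IH]; first by rewrite expr0 mul0r.
by rewrite exprS val2M ?expf_neq0 // IH; lia.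
Qed.

Lemma val2_2 : val2 2 = 1. Proof. by []. Qed.

Lemma val2V (x : rat) : x != 0 -> val2 x^-1 = - val2 x.
Proof.
move=> x0; apply/eqP; rewrite -addr_eq0 addrC -val2M ?invr_eq0 // mulfV //.
Qed.

Lemma val2_ge (x : rat) (k : int) : x != 0 -> (k <= val2 x) = (x * 2 ^ (- k) \in Zloc2).
Proof.
move=> x0; have k0 : (2 : rat) ^ (- k) != 0 by rewrite expfz_neq0.
rewrite val2_Zloc2 ?mulf_neq0 // val2M //.
suff -> : val2 (2 ^ (- k)) = - k by lia.
case: k {k0} => n.
  by rewrite -exprnN val2V ?expf_neq0 // val2X // mulr1.
by rewrite NegzE opprK -exprnP val2X // mulr1.
Qed.

Lemma val2D (x y : rat) (k : int) : x + y != 0 ->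
  (x != 0 -> k <= val2 x) -> (y != 0 -> k <= val2 y) -> k <= val2 (x + y).
Proof.
move=> xy0 hx hy; rewrite val2_ge // mulrDl rpredD //.
  by have [->|x0] := eqVneq x 0; [rewrite mul0r rpred0 | rewrite -val2_ge ?hx].
by have [->|x0] := eqVneq y 0; [rewrite mul0r rpred0 | rewrite -val2_ge ?hy].
Qed.

Lemma val2_sum (I : Type) (s : seq I) (P : pred I) (F : I -> rat) (k : int) :
  (forall i, P i -> F i != 0 -> k <= val2 (F i)) ->
  \sum_(i <- s | P i) F i != 0 -> k <= val2 (\sum_(i <- s | P i) F i).
Proof.
move=> hF; elim/big_rec: _ => [|i x Pi IH]; first by rewrite eqxx.
move=> s0; apply: val2D => //; exact: hF.
Qed.

Lemma val2N (x : rat) : val2 (- x) = val2 x.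
Proof. by rewrite /val2 numqN denqN abszN. Qed.

Lemma val2_dominant (x y : rat) : x != 0 -> (y != 0 -> val2 x < val2 y) ->
  x + y != 0 /\ val2 (x + y) = val2 x.
Proof.
move=> x0 hy; have [->|y0] := eqVneq y 0; first by rewrite addr0.
have lt := hy y0.
have xy0 : x + y != 0.
  by apply: contraTneq lt => /eqP; rewrite addr_eq0 => /eqP ->; rewrite val2N ltxx.
split=> //; apply/eqP; rewrite eq_le; apply/andP; split; last first.
  by apply: val2D => // _; exact: ltW.
rewrite leNgt; apply/negP => h.
have : val2 x + 1 <= val2 (x + y + - y).
  by apply: val2D; rewrite ?addrK // ?val2N; lia.
by rewrite addrK; lia.
Qed.

Lemma weight_lt (d n a b a' b' i j k l : int) : d * a + n * j < d * a' + n * k ->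
  d * b + n * i <= d * b' + n * l -> j + i = k + l -> d * (a + b) < d * (a' + b').
Proof.
move=> h1 h2 e; have : n * j + n * i = n * k + n * l by rewrite -!mulrDr e.
move: h1 h2; rewrite !mulrDr; lia.
Qed.

(** The sum of the two minimal weights is at least the lower bound for the product, which equals the
    total weight of the leading coefficients and also that of the constant coefficients. So all the
    inequalities are equalities, and the constant and leading coefficients of the factor of degree
    [r] have equal weight. *)
Lemma dumas_arith (d n s r vj vi v0g v0q vs vr j i : int) :
  s + r = d ->
  n * d + (d * vs + d * vr) <= d * vj + d * vi + n * (j + i) ->
  d * vi + n * i <= d * vr + n * r -> d * vj + n * j <= d * vs + n * s ->
  d * vi + n * i <= d * v0q + n * 0 -> d * vj + n * j <= d * v0g + n * 0 ->
  v0g + v0q = n + (vs + vr) -> d * (v0q - vr) = n * r.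
Proof.
move=> <- h1 h2 h3 h4 h5 h6.
have : (s + r) * (v0g + v0q) = (s + r) * (n + (vs + vr)) by rewrite h6.
lia.
Qed.

Section Dumas.
Variables (d : nat) (n : int).

(** [d] times the height at abscissa 0 of the line of slope [- n / d] through the point of index [i]
    of the Newton diagram. *)
Definition dumas_weight (p : {poly rat}) i : int := d%:Z * val2 p`_i + n * i%:Z.

Lemma dumas_argmin (p : {poly rat}) : p != 0 -> exists i,
  [/\ p`_i != 0, forall j, p`_j != 0 -> dumas_weight p i <= dumas_weight p j
   & forall j, (j < i)%N -> p`_j != 0 -> dumas_weight p i < dumas_weight p j].
Proof.
move=> p0.
have sp : (0 < size p)%N by rewrite size_poly_gt0.
have tp : ((size p).-1 < size p)%N by rewrite prednK.
pose top := Ordinal tp.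
have ltop : p`_top != 0 by rewrite -lead_coefE lead_coef_eq0.
case: (@arg_minP _ _ _ top (fun i : 'I_(size p) => p`_i != 0) (fun i => dumas_weight p i) ltop) => i0 pi0 mini0.
have ex : exists i, (p`_i != 0) && [forall j : 'I_(size p), (p`_j != 0) ==> (dumas_weight p i <= dumas_weight p j)].
  exists i0; rewrite pi0; apply/forallP => j; apply/implyP; exact: mini0.
case: (ex_minnP ex) => i /andP[pi0' /forallP hi] mini.
have hi' j : p`_j != 0 -> dumas_weight p i <= dumas_weight p j.
  move=> pj; have js : (j < size p)%N by rewrite ltnNge; apply: contra pj => js; rewrite nth_default.
  by have /implyP := hi (Ordinal js); apply.
exists i; split=> // j ji pj.
rewrite ltNge; apply/negP => h.
have : (i <= j)%N.
  apply: mini; rewrite pj; apply/forallP => k; apply/implyP => pk.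
  exact: le_trans h (hi' _ pk).
by rewrite leqNgt ji.
Qed.

(* In a product, the first indices minimizing the weight in each factor add up; if the
   minimum for [P] is attained exactly at both ends, the degree of a factor is a multiple
   of [d] by coprimality. *)
Lemma dumas_irreducible (P : {poly rat}) :
  (0 < d)%N -> coprime `|n| d -> size P = d.+1 -> P`_0 != 0 ->
  val2 P`_0 = n + val2 P`_d ->
  (forall i, P`_i != 0 -> n * d%:Z + d%:Z * val2 P`_d <= dumas_weight P i) ->
  irreducible_poly P.
Proof.
move=> d0 cop sP P0 vP0 hP; split; first by rewrite sP ltnS.
move=> q sq /dvdpP[g Pgq].
have Pn0 : P != 0 by rewrite -size_poly_gt0 sP.
have gn0 : g != 0 by apply: contraNneq Pn0 => g0; rewrite Pgq g0 mul0r.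
have qn0 : q != 0 by apply: contraNneq Pn0 => q0; rewrite Pgq q0 mulr0.
have [i [qi mini lti]] := dumas_argmin qn0.
have [j [gj minj ltj]] := dumas_argmin gn0.
have sg0 : (0 < size g)%N by rewrite size_poly_gt0.
have sq0 : (0 < size q)%N by rewrite size_poly_gt0.
have sz : (size g + size q = d.+2)%N.
  by rewrite -[LHS]prednK ?addn_gt0 ?sg0 // -size_mul // -Pgq sP.
pose r := (size q).-1; pose s := (size g).-1.
have rs : (s + r = d)%N.
  by move: sz sg0 sq0; rewrite /r /s; case: (size g) (size q) => [|?] [|?] //=; rewrite addSn addnS => -[].
have lq : q`_r != 0 by rewrite /r -lead_coefE lead_coef_eq0.
have lg : g`_s != 0 by rewrite /s -lead_coefE lead_coef_eq0.
have lP : P`_d = g`_s * q`_r.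
  have -> : P`_d = lead_coef P by rewrite lead_coefE sP.
  by rewrite Pgq lead_coefM !lead_coefE.
have P00 : P`_0 = g`_0 * q`_0 by rewrite Pgq coef0M.
have [g00 q00] : g`_0 != 0 /\ q`_0 != 0.
  by apply/andP; move: P0; rewrite P00 mulf_eq0 negb_or.
(* Any other pair of indices with sum [j + i] has its first entry below [j] or its second below [i];
   its weight is then strictly larger, because [j] and [i] are the first minimizers. *)
have dom : P`_(j + i) != 0 /\ val2 P`_(j + i) = val2 (g`_j * q`_i).
  rewrite Pgq coefM.
  have jlt : (j < (j + i).+1)%N by rewrite ltnS leq_addr.
  rewrite (bigD1 (Ordinal jlt)) //= addKn.
  apply: val2_dominant; first exact: mulf_neq0.
  move=> h; rewrite -lezD1.
  apply: val2_sum h => k; rewrite -val_eqE /= => kj.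
  rewrite mulf_eq0 negb_or => /andP[gk qk].
  rewrite !val2M //.
  have kle : (k <= j + i)%N by rewrite -ltnS.
  have dz : (0 < d%:Z) by rewrite ltz_nat.
  rewrite lezD1 -(ltr_pM2l dz).
  have [kj'|kj'] : (k < j)%N \/ (j < k)%N by apply/orP; rewrite -neq_ltn.
    by apply: weight_lt (ltj _ kj' gk) (mini _ qk) _; rewrite -!PoszD subnKC.
  have kj2 : (j + i - k < i)%N by rewrite ltn_subLR // ltn_add2r.
  rewrite [X in _ * X < _]addrC [X in _ < _ * X]addrC.
  by apply: weight_lt (lti _ kj2 qk) (minj _ gk) _; rewrite -!PoszD subnK // addnC.
have hsum := hP _ dom.1.
rewrite /dumas_weight dom.2 val2M // lP val2M // !(mulrDr _ (val2 _) (val2 _)) in hsum.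
have hq := mini _ lq; have hg := minj _ lg.
have hq0 := mini _ q00; have hg0 := minj _ g00.
have vP0' : val2 g`_0 + val2 q`_0 = n + (val2 g`_s + val2 q`_r).
  by rewrite -!val2M // -P00 -lP.
have key : d%:Z * (val2 q`_0 - val2 q`_r) = n * r%:Z.
  apply: (@dumas_arith _ _ s%:Z _ (val2 g`_j) (val2 q`_i) (val2 g`_0) _ (val2 g`_s) _ j%:Z i%:Z
    _ _ hq hg hq0 hg0 vP0'); first by rewrite -PoszD rs.
  by rewrite -PoszD.
have dr : (d %| r)%N.
  have : (d %| `|n| * r)%N.
    by have := congr1 absz key; rewrite !abszM => <-; rewrite dvdn_mulr.
  by rewrite Gauss_dvdr // coprime_sym.
have r0 : (0 < r)%N by rewrite /r -subn1 subn_gt0 ltn_neqAle eq_sym sq sq0.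
have rd : r = d by apply/eqP; rewrite eqn_leq -{1}rs leq_addl /=; apply: dvdn_leq.
have s0 : s = 0%N by apply/eqP; rewrite -(eqn_add2r r) rs rd.
have /eqP/size_poly1P[k k0 gk] : size g = 1%N by rewrite -[size g]prednK // -/s s0.
by rewrite Pgq gk mul_polyC eqp_sym eqp_scale.
Qed.

End Dumas.

(** * The universal solution and the Faber polynomial *)

Section Recurrence.
Variable R : comNzRingType.

Lemma sum_conv_inner (c : nat -> R) m : c 0%N = 1 -> c 1%N = 0 -> (1 < m)%N ->
  \sum_(i < m.+1) c i * c (m - i)%N = 2 * c m + \sum_(2 <= i < m.-1) c i * c (m - i)%N.
Proof.
move=> c0 c1 m1; rewrite -(big_mkord xpredT (fun i => c i * c (m - i)%N)).
rewrite big_ltn // subn0 c0 big_ltn; last by rewrite ltnS ltnW.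
rewrite c1 mul0r add0r mul1r.
case: m m1 => [|[|m]] // _; rewrite [m.+2.-1]/=.
rewrite big_nat_recr //= subnn c0 mulr1.
case: m => [|m]; first by rewrite !big_geq //; ring.
rewrite big_nat_recr //= (_ : (m.+3 - m.+2 = 1)%N); last by lia.
by rewrite c1 mulr0; ring.
Qed.

Lemma wp_recI (a b : R) (c : nat -> R) :
  c 0%N = 1 -> c 1%N = 0 -> - 5%:R * c 2%N = a -> - 7%:R * c 3%N = b ->
  (forall m, (3 < m)%N -> (2 * m%:R + 1) * (m%:R - 3) * c m =
                          3 * \sum_(2 <= i < m.-1) c i * c (m - i)%N) ->
  wp_rec a b c.
Proof.
move=> c0 c1 c2 c3 cm; split=> // m.
case: m => [|[|m]].
- by rewrite big_ord1 c0 /=; ring.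
- by rewrite !big_ord_recl big_ord0 /= c1 c0; ring.
rewrite sum_conv_inner //; case: m => [|[|m]].
- by rewrite big_geq // -c2 /=; ring.
- by rewrite big_geq //=; ring.
by rewrite (mulrDr 3) -cm //=; ring.
Qed.

Lemma wp_rec_c2 (a b : R) (c : nat -> R) : wp_rec a b c -> - 5%:R * c 2%N = a.
Proof.
move=> [c0 c1 _ /(_ 2%N)]; rewrite sum_conv_inner // big_geq // mulr1 => e.
have -> : a = 3 * (2 * c 2%N + 0) + a - 6 * c 2%N by ring.
by rewrite -e; ring.
Qed.

Lemma wp_rec_inner (a b : R) (c : nat -> R) m : wp_rec a b c -> (3 < m)%N ->
  (2 * m%:R + 1) * (m%:R - 3) * c m = 3 * \sum_(2 <= i < m.-1) c i * c (m - i)%N.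
Proof.
move=> [c0 c1 _ /(_ m)]; case: m => [|[|[|[|m]]]] //.
rewrite sum_conv_inner // mulr0 addr0 => e _.
transitivity ((2 * (m.+4%:R * m.+4%:R) - 5 * m.+4%:R + 3) * c m.+4 - 6 * c m.+4); first by ring.
rewrite e; ring.
Qed.

Lemma wp_rec_scale (a b r : R) c : wp_rec a b c ->
  wp_rec (r ^+ 2 * a) (r ^+ 3 * b) (fun m => r ^+ m * c m).
Proof.
move=> [c0 c1 c3 cm]; split.
- by rewrite c0 mulr1.
- by rewrite c1 mulr0.
- by rewrite -c3; ring.
move=> m; transitivity (r ^+ m * ((2 * (m%:R * m%:R) - 5 * m%:R + 3) * c m)); first by ring.
rewrite cm mulrDr; congr (_ + _); last by case: eqP => [->|_] /=; ring.
rewrite mulrCA !mulr_sumr; apply: eq_bigr => i _.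
have im : (i <= m)%N by rewrite -ltnS.
by rewrite -{1}(subnKC im) exprD; ring.
Qed.

End Recurrence.

Lemma wp_rec_map (R S : comNzRingType) (f : {rmorphism R -> S}) a b c :
  wp_rec a b c -> wp_rec (f a) (f b) (f \o c).
Proof.
move=> [c0 c1 c3 cm]; split=> /=.
- by rewrite c0 rmorph1.
- by rewrite c1 rmorph0.
- by rewrite -c3 rmorphM rmorphN rmorph_nat.
move=> m; have := congr1 f (cm m).
rewrite rmorphM rmorphD rmorphB !rmorphM !rmorph_nat => ->.
rewrite rmorphD !rmorphM !rmorph_nat rmorph_sum.
by congr (_ * _ + _); apply: eq_bigr => i _; rewrite rmorphM.
Qed.

Lemma wp_rec_unique (R : idomainType) (a b : R) c c' :
  (forall n : nat, (n.+1%:R : R) != 0) ->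
  wp_rec a b c -> wp_rec a b c' -> c =1 c'.
Proof.
move=> ch h h'; have [c0 c1 c3 c2] := h; have [c0' c1' c3' c2'] := h'.
have nz n m : (n.+1%:R : R) * m = 0 -> m = 0.
  by move/eqP; rewrite mulf_eq0 (negPf (ch n)) => /eqP.
move=> n; elim/ltn_ind: n => n IH.
case: (ltnP 3 n) => n3; last first.
  case: n IH n3 => [|[|[|[|n]]]] IH //; rewrite ?c0 ?c1 // => _.
    apply/eqP; rewrite -subr_eq0; apply/eqP; apply: (@nz 4).
    have h2 := wp_rec_c2 h; have h2' := wp_rec_c2 h'.
    transitivity (- 5 * c' 2%N - (- 5) * c 2%N); first by ring.
    by rewrite h2 h2' subrr.
  apply/eqP; rewrite -subr_eq0; apply/eqP; apply: (@nz 6).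
  transitivity (- 7 * c' 3%N - (- 7) * c 3%N); first by ring.
  by rewrite c3 c3' subrr.
have e := wp_rec_inner h n3; have e' := wp_rec_inner h' n3.
have sE : \sum_(2 <= i < n.-1) c i * c (n - i)%N = \sum_(2 <= i < n.-1) c' i * c' (n - i)%N.
  rewrite big_nat_cond [RHS]big_nat_cond; apply: eq_bigr => i /andP[/andP[i2 ni] _].
  by rewrite !IH //; lia.
apply/eqP; rewrite -subr_eq0; apply/eqP; apply: (@nz (2 * n)%N); apply: (@nz (n - 4)%N).
have -> : ((n - 4).+1 = n - 3)%N by lia.
rewrite natrB 1?ltnW // -[(2 * n).+1]addn1 natrD natrM.
transitivity ((2 * n%:R + 1) * (n%:R - 3) * c n - (2 * n%:R + 1) * (n%:R - 3) * c' n).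
  by ring.
by rewrite e e' sE subrr.
Qed.

(** Course-of-values recursion: the list carries all earlier terms. The entries at 2 and 3 solve
    [- 5 c_2 = - 3] and [- 7 c_3 = b]. *)
Fixpoint wp_seq n : seq {poly rat} :=
  if n is m.+1 then
    rcons (wp_seq m)
      (match m with
       | 0 => 1 | 1 => 0 | 2 => (3 / 5)%:P | 3 => (- 7^-1)%:P * 'X
       | _ => (3 / ((2 * m%:R + 1) * (m%:R - 3)))%:P *
              \sum_(2 <= i < m.-1) (wp_seq m)`_i * (wp_seq m)`_(m - i)
       end)
  else [::].

Definition wp_poly n : {poly rat} := (wp_seq n.+1)`_n.

Lemma size_wp_seq n : size (wp_seq n) = n.
Proof. by elim: n => //= n IH; rewrite size_rcons IH. Qed.

Lemma nth_wp_seq n i : (i < n)%N -> (wp_seq n)`_i = wp_poly i.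
Proof.
elim: n => // n IH; rewrite ltnS leq_eqVlt => /orP[/eqP -> //|lt].
by rewrite /= nth_rcons size_wp_seq lt IH.
Qed.

Lemma wp_polyE m : wp_poly m =
  match m with
  | 0 => 1 | 1 => 0 | 2 => (3 / 5)%:P | 3 => (- 7^-1)%:P * 'X
  | _ => (3 / ((2 * m%:R + 1) * (m%:R - 3)))%:P *
              \sum_(2 <= i < m.-1) wp_poly i * wp_poly (m - i)
  end.
Proof.
rewrite {1}/wp_poly [wp_seq _]/= nth_rcons size_wp_seq ltnn eqxx.
case: m => [|[|[|[|m]]]] //; congr (_ * _).
rewrite big_nat_cond [RHS]big_nat_cond; apply: eq_bigr => i /andP[/andP[i2 mi] _].
by rewrite !nth_wp_seq //; lia.
Qed.

Lemma wp_poly_rec : wp_rec (- 3) 'X wp_poly.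
Proof.
apply: wp_recI; rewrite ?wp_polyE //.
- rewrite -!polyC_natr -!polyCN -polyCM; congr _%:P.
- by rewrite -!polyC_natr -!polyCN mulrA -polyCM mulrNN mulfV // mul1r.
move=> m m3; rewrite wp_polyE; case: m m3 => [|[|[|[|m]]]] // _.
rewrite mulrA; congr (_ * _).
set x : rat := (_ + 1) * _.
have x0 : x != 0.
  apply: mulf_neq0; last by rewrite subr_eq0 eqr_nat.
  have -> : 2 * m.+4%:R + 1 = (2 * m.+4 + 1)%:R :> rat by rewrite natrD natrM.
  by rewrite pnatr_eq0; lia.
have -> : (2 * m.+4%:R + 1) * (m.+4%:R - 3) = x%:P :> {poly rat}.
  by rewrite /x polyCM polyCB polyCD polyCM !polyC_natr.
by rewrite -polyCM mulrC divfK // polyC_natr.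
Qed.

(** The term of index [m] is isobaric of weight [m] when [a] has weight 2 and [b] weight 3. Once [a]
    is specialized to -3, this leaves the powers [b ^ i] with [m - 3 * i] nonnegative and even. *)
Definition graded m (p : {poly rat}) := forall i, (m < 3 * i)%N || odd (m + i) -> p`_i = 0.

Lemma gradedM m n p q : graded m p -> graded n q -> graded (m + n) (p * q).
Proof.
move=> hp hq k hk; rewrite coefM big1 // => -[j /=]; rewrite ltnS => jk _.
case: (boolP ((m < 3 * j)%N || odd (m + j))) => [h|h]; first by rewrite hp ?mul0r.
rewrite hq ?mulr0 //; move: hk h; lia.
Qed.

Lemma gradedC m c p : graded m p -> graded m (c%:P * p).
Proof. by move=> hp i hi; rewrite coefCM hp ?mulr0. Qed.

Lemma wp_graded m : graded m (wp_poly m).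
Proof.
elim/ltn_ind: m => m IH; rewrite wp_polyE.
case: m IH => [|[|[|[|m]]]] IH.
- by case=> [|i]; rewrite // coef1.
- by move=> i _; rewrite coef0.
- by case=> [|i]; rewrite // coefC.
- move=> i hi; rewrite coefCM coefX; case: eqP hi => [->|] //; by rewrite mulr0.
apply: gradedC => i hi; rewrite coef_sum big_nat_cond big1 // => j /andP[/andP[j2 jm] _].
apply: (@gradedM j (m.+4 - j)%N) => //; first by apply: IH; lia.
  by apply: IH; lia.
by rewrite subnKC //; lia.
Qed.

(** Homogeneity: [wp_poly] only covers [a = - 3], and an arbitrary [a] is reached by rescaling with
    a square root [r] of [- a / 3]. *)
Lemma wp_value (F : numFieldType) (e : nat -> F) (r w : F) :
  wp_rec (- 3 * r ^+ 2) (r ^+ 3 * w) e ->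
  forall m, e m = r ^+ m * (map_poly ratr (wp_poly m)).[w].
Proof.
move=> he; have h := wp_rec_map (map_poly (@ratr F)) wp_poly_rec.
have h' := wp_rec_map (horner_eval w) h.
rewrite /= map_polyX in h'.
have h2 := wp_rec_scale r h'.
apply: wp_rec_unique he _; first by move=> n; rewrite pnatr_eq0.
rewrite /horner_eval !rmorphN /= !rmorph_nat hornerX hornerN -polyC_natr hornerC mulrC in h2.
exact: h2.
Qed.

(* When [E4 = 1], [w = 2 E6] satisfies [w ^ 2 = 4 - 27 x] with [x = 256 / j], and
   [wp_poly (6 * m)] is even in [w]; [wp_disc m] is its expression in [x]. *)
Definition wp_disc (m : nat) : {poly rat} :=
  even_poly (wp_poly (6 * m)) \Po (4%:P - 27%:P * 'X).

Lemma wp_poly_even m : even_poly (wp_poly (6 * m)) \Po 'X^2 = wp_poly (6 * m).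
Proof.
have := poly_even_odd (wp_poly (6 * m)).
suff -> : odd_poly (wp_poly (6 * m)) = 0 by rewrite comp_poly0 mul0r addr0.
apply/polyP => i; rewrite coef_odd_poly coef0; apply: wp_graded; lia.
Qed.

Lemma wp_disc_horner (F : numFieldType) m (w x : F) : w ^+ 2 = 4 - 27 * x ->
  (map_poly ratr (wp_disc m)).[x] = (map_poly ratr (wp_poly (6 * m))).[w].
Proof.
move=> hw; rewrite -[in RHS]wp_poly_even /wp_disc !map_comp_poly !horner_comp.
congr (_.[_]).
rewrite rmorphB rmorphM /= !map_polyC /= map_polyX map_polyXn !(hornerE, hornerXn) hw.
by rewrite !rmorph_nat.
Qed.

Lemma size_wp_even m : (size (even_poly (wp_poly (6 * m))) <= m.+1)%N.
Proof.
apply/leq_sizeP => j hj; rewrite coef_even_poly; apply: wp_graded; lia.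
Qed.

Lemma size_linear_rat : (size (4%:P - 27%:P * 'X : {poly rat})) = 2.
Proof.
rewrite addrC size_polyDl; first by rewrite size_polyN mul_polyC size_scale // size_polyX.
by rewrite size_polyN mul_polyC size_scale // size_polyX size_polyC.
Qed.

Lemma size_wp_disc m : (size (wp_disc m) <= m.+1)%N.
Proof.
apply: leq_trans (size_comp_poly_leq _ _) _; rewrite size_linear_rat muln1 ltnS.
by have := size_wp_even m; case: (size _).
Qed.

Lemma Zloc2_inv1D2 x : x \in Zloc2 -> (1 + 2 * x)^-1 \in Zloc2 /\ 1 + 2 * x != 0.
Proof.
move=> /Zloc2P[n [m om e]].
have m0 : (m%:R : rat) != 0 by rewrite pnatr_eq0; case: m om {e}.
have ex : (1 + 2 * x) * m%:R = (m%:Z + 2 * n)%:~R.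
  by rewrite mulrDl mul1r -mulrA e rmorphD rmorphM.
have o : odd `|(m%:Z + 2 * n)%R| by lia.
have k0 : (m%:Z + 2 * n)%:~R != 0 :> rat by rewrite intr_eq0; lia.
have nz : 1 + 2 * x != 0 by apply: contra_neq k0 => h; rewrite -ex h mul0r.
split=> //; apply/Zloc2P.
set k := (m%:Z + 2 * n)%R in ex o k0 *.
exists (Num.sg k * m%:Z), `|k|%N => //.
have -> : (1 + 2 * x)^-1 = m%:R / k%:~R by rewrite -ex invfM mulrCA mulfV ?mulr1.
rewrite -[`|k|%N%:R]/((`|k|%N : int)%:~R) abszE normrEsg !intrM.
by rewrite [X in _ * X = _]mulrC mulrA divfK // mulrC.
Qed.

(** * The universal solution in the variable [256 / j] *)

Section PowerOfTwo.
Variable m : nat.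
Let D := (2 ^ m)%N.

(** Since -27 is 1 modulo 4, the substitution [b ^ 2 = 4 - 27 x] is [b ^ 2 = x] modulo 4. *)
Lemma wp_disc_mod4 : exists2 r, r \is a Z2X & wp_disc D = 2 + 'X ^+ D + 4 * r.
Proof.
have /dvd2P[s hs e] := wp_mod4 wp_poly_rec m.
rewrite -/D in e.
have eg : even_poly (wp_poly (6 * D)) = 2 + 'X^D + 4 * even_poly s.
  have e4 : 2 ^+ 2 = 4 :> {poly rat} by ring.
  apply/polyP => i; rewrite coef_even_poly -[wp_poly _](subrK (2 + 'X^(2 * D))) e e4.
  rewrite -(polyC_natr _ 2) -(polyC_natr _ 4) !(coefD, coefCM, coefC, coefXn, coef_even_poly).
  by rewrite double_eq0 -mul2n eqn_pmul2l // addrC.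
have lZ : (4%:P - 27%:P * 'X : {poly rat}) \is a Z2X.
  by rewrite rpredB ?rpredM ?polyOverX // polyOverC rpred_nat.
have [t ht et] : exists2 t, t \is a Z2X & (4%:P - 27%:P * 'X) ^+ D = 'X^D + 4 * t :> {poly rat}.
  elim: D => [|n [t ht et]].
    by exists 0; rewrite ?rpred0 // mulr0 addr0 !expr0.
  exists ((4%:P - 27%:P * 'X) * t + 'X^n * (1 - 7 * 'X)).
    by rewrite rpredD ?rpredM // ?rpredX ?rpredB ?rpredM ?polyOverX ?rpred1 ?rpred_nat.
  rewrite !exprS et !polyC_natr; ring.
exists (t + (even_poly s \Po (4%:P - 27%:P * 'X))).
  apply: rpredD => //; rewrite comp_polyE; apply: rpred_sum => i _.
  rewrite -mul_polyC rpredM ?rpredX // polyOverC coef_even_poly.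
  by move/polyOverP: hs; apply.
rewrite /wp_disc eg -(polyC_natr _ 2) -(polyC_natr _ 4) !comp_polyD comp_polyM !comp_polyC comp_Xn_poly et.
by rewrite !polyC_natr mulrDr !addrA.
Qed.

(** The constant term is [2 * eta] with [eta] a 2-adic unit. Division by it turns the coefficient of
    ['X^D] into [t = 1 / (2 * eta)], of valuation -1, and the error [4 * r] into twice an integral
    polynomial. *)
Lemma wp_disc_normal : (wp_disc D)`_0 != 0 /\
  exists t s, [/\ ((wp_disc D)`_0)^-1 *: wp_disc D = 1 + t *: 'X^D + 2 * s,
    s \is a Z2X, s`_0 = 0 & exists2 t1, t1 \in Zloc2 & 2 * t = 1 + 2 * t1].
Proof.
have [r hr e] := wp_disc_mod4.
have hri i : r`_i \in Zloc2 by move/polyOverP: hr; apply.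
have D0 : (0 < D)%N by rewrite expn_gt0.
have q0 : (wp_disc D)`_0 = 2 * (1 + 2 * r`_0).
  rewrite e -!(polyC_natr _ 2) -(polyC_natr _ 4) !(coefD, coefCM, coefC, coefXn) /=.
  rewrite (_ : (0%N == D) = false); last by apply/negbTE; lia.
  by rewrite /=; ring.
have [iZ nz] := Zloc2_inv1D2 (hri 0%N).
set eta := 1 + 2 * r`_0 in q0 iZ nz.
split; first by rewrite q0 mulf_neq0.
exists ((2 * eta)^-1), (eta^-1 *: (r - (r`_0)%:P)); split.
- rewrite q0 e.
  have h1 : (1 : {poly rat}) = (2 * eta)^-1 *: (2 * eta%:P).
    by rewrite -(polyC_natr _ 2) -polyCM -mul_polyC -polyCM mulVf ?mulf_neq0.
  rewrite [X in _ = X + _ + _]h1 -(polyC_natr _ 4) -(polyC_natr _ 2) -!mul_polyC.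
  have -> : eta%:P = 1 + 2%:P * (r`_0)%:P :> {poly rat} by rewrite /eta polyCD polyCM.
  have -> : (eta^-1)%:P = 2%:P * ((2 * eta)^-1)%:P :> {poly rat}.
    by rewrite -polyCM invfM mulrA mulfV // mul1r.
  by rewrite !polyC_natr; ring.
- by rewrite -mul_polyC rpredM ?rpredB ?polyOverC.
- by rewrite coefZ coefB coefC subrr mulr0.
(* Half of [eta^-1 - 1 = (1 - eta) / eta], where [1 - eta] is minus twice the constant term of
   [r]. *)
exists (- r`_0 * eta^-1); first by rewrite rpredM ?rpredN.
rewrite invfM mulrA mulfV // mul1r.
by apply: (mulfI nz); rewrite mulfV // mulrDr mulr1 mulNr mulrN mulrN mulrCA mulrA mulrCA mulfK //; rewrite /eta; ring.
Qed.

End PowerOfTwo.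

(** Its value at [256 / j], times [E_4 ^ (3 D)], is [E_(12 D)]. Dividing by the constant term
    normalizes at [x = 0], the cusp. *)
Definition eis_poly (D : nat) : {poly rat} := ((wp_disc D)`_0)^-1 *: wp_disc D.

Definition half_sum_poly (D : nat) : {poly rat} :=
  2^-1 *: (eis_poly D * eis_poly D + eis_poly (2 * D)).

(* [2 * x ^ (2 D) * half_sum_poly.[256 / x]] *)
Definition faber_poly (D : nat) : {poly rat} :=
  \poly_(i < (2 * D).+1) (2 * (half_sum_poly D)`_(2 * D - i) * 256 ^+ (2 * D - i)).

Lemma val2_odd_unit (x t : rat) : t \in Zloc2 -> x = 1 + 2 * t -> x != 0 /\ val2 x = 0.
Proof.
move=> ht ->; have [iZ nz] := Zloc2_inv1D2 ht; split=> //.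
apply/eqP; rewrite eq_le -{1}oppr_ge0 -val2V // -val2_Zloc2 ?invr_eq0 // iZ /=.
by rewrite -val2_Zloc2 // rpredD ?rpredM ?rpred1 ?rpred_nat.
Qed.

(** * The Newton polygon of the Faber polynomial *)

Section Faber.
Variable m : nat.
Let D := (2 ^ m)%N.

(** The only denominators come from [t] and [t'], both of valuation -1. The coefficient
    [(t ^ 2 + t') / 2] at [2 * D] has valuation -3 because [t ^ 2] dominates [t']. *)
Lemma half_sum_coef : let h := half_sum_poly D in
  [/\ h`_0 = 1,
      forall i, (0 < i < 2 * D)%N -> i != D -> h`_i \in Zloc2,
      2 * h`_D \in Zloc2 &
      exists2 t, t \in Zloc2 & 8 * h`_(2 * D) = 1 + 2 * t].
Proof.
have [_ [t [s [es sZ s0 [t1 t1Z e1]]]]] := wp_disc_normal m.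
have [_ [t' [s' [es' sZ' s0' [t1' t1Z' e1']]]]] := wp_disc_normal m.+1.
have D0 : (0 < D)%N by rewrite expn_gt0.
have DD : (2 ^ m.+1 = 2 * D)%N by rewrite expnS.
rewrite DD in es'.
have sZi i : s`_i \in Zloc2 by move/polyOverP: sZ; apply.
(* Everything without a denominator; the cross term of the square belongs here because [2 * t] is
   integral. *)
pose u := 2 * (s * s) + 2 * s + (2 * t) *: ('X^D * s) + s'.
have t2Z : 2 * t \in Zloc2 by rewrite e1 rpredD ?rpredM ?rpred1 ?rpred_nat.
have t2Z' : 2 * t' \in Zloc2 by rewrite e1' rpredD ?rpredM ?rpred1 ?rpred_nat.
have uZ : u \is a Z2X.
  by rewrite /u -mul_polyC !rpredD // !rpredM ?rpredX ?polyOverX ?polyOverC ?rpred_nat.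
have uZi i : u`_i \in Zloc2 by move/polyOverP: uZ; apply.
have u0 : u`_0 = 0.
  rewrite /u -mul_polyC -(polyC_natr _ 2) !coefD !coefCM coefXnM s0' !coef0M s0; case: ifP => _; by ring.
have eh : half_sum_poly D = 1 + t *: 'X^D + ((t * t + t') / 2) *: 'X^(2 * D) + u.
  rewrite /half_sum_poly /eis_poly es es' /u -!mul_polyC.
  have -> : 'X^(2 * D) = 'X^D * 'X^D :> {poly rat} by rewrite -exprD addnn mul2n.
  have h2 : (2^-1)%:P * 2 = 1 :> {poly rat} by rewrite -(polyC_natr _ 2) -polyCM mulVf.
  rewrite [(2 * t)%:P]polyCM polyC_natr [(_ / _)%:P]polyCM polyCD polyCM.
  set k := (2^-1)%:P in h2 *.
  transitivity (k * 2 * (1 + t%:P * 'X^D + 2 * (s * s) + 2 * s + 2 * t%:P * ('X^D * s) + s') +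
    (t%:P * t%:P + t'%:P) * k * ('X^D * 'X^D)); first by ring.
  by rewrite h2; ring.
have hi i : (half_sum_poly D)`_i = (i == 0%N)%:R + t * (i == D)%:R + ((t * t + t') / 2) * (i == 2 * D)%N%:R + u`_i.
  by rewrite eh !coefD !coefZ !coefXn coef1.
have e0D : (0%N == D) = false by rewrite eq_sym; case: (D) D0.
have eD0 : (D == 0%N) = false by case: (D) D0.
have e02 : (0%N == 2 * D)%N = false by rewrite eq_sym muln_eq0 eD0.
have e20 : (2 * D == 0)%N = false by rewrite muln_eq0 eD0.
have e2D : (2 * D == D)%N = false by rewrite -{2}[D]mul1n eqn_pmul2r.
have eD2 : (D == 2 * D)%N = false by rewrite eq_sym.
split.
- by rewrite hi u0 e0D e02 !mulr0 !addr0.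
- move=> i /andP[i0 i2] iD.
  by rewrite hi (negbTE iD) (gtn_eqF i0) (ltn_eqF i2) !mulr0 !addr0 add0r.
- rewrite hi eqxx eD0 eD2 mulr0 addr0 add0r mulr1.
  by rewrite mulrDr; apply: rpredD => //; rewrite rpredM ?rpred_nat.
rewrite hi eqxx e20 e2D mulr0 addr0 add0r mulr1.
exists (2 * t1 + 2 * (t1 * t1) + (1 + 2 * t1') + 4 * u`_(2 * D)).
  by rewrite !rpredD ?rpredM ?rpred1 ?rpred_nat.
transitivity ((2 * t) * (2 * t) + 2 * (2 * t') + 8 * u`_(2 * D)); first by field.
by rewrite e1 e1'; ring.
Qed.

Theorem faber_poly_irreducible : irreducible_poly (faber_poly D).
Proof.
have [h0 hi hD [t tZ ht]] := half_sum_coef.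
set h := half_sum_poly D in h0 hi hD ht.
have D0 : (0 < D)%N by rewrite expn_gt0.
have v256 k : val2 (256 ^+ k) = 8 * k%:Z.
  by rewrite val2X // mulrC; congr (_ * _).
have n256 k : (256 : rat) ^+ k != 0 by rewrite expf_neq0.
have ci i : (i <= 2 * D)%N -> (faber_poly D)`_i = 2 * h`_(2 * D - i) * 256 ^+ (2 * D - i).
  by move=> hi2; rewrite coef_poly ltnS hi2.
have [n8 v8] := val2_odd_unit tZ ht.
have hn : h`_(2 * D) != 0 by apply: contraNneq n8 => ->; rewrite mulr0.
have vh : val2 h`_(2 * D) = - 3.
  have : val2 (8 * h`_(2 * D)) = 3 + val2 h`_(2 * D) by rewrite val2M.
  by rewrite v8; lia.
have cD : (faber_poly D)`_(2 * D) = 2 by rewrite ci // subnn h0 !mulr1.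
have c0 : (faber_poly D)`_0 = 2 * h`_(2 * D) * 256 ^+ (2 * D) by rewrite ci // subn0.
apply: (@dumas_irreducible (2 * D) (8 * (2 * D)%N%:Z - 3)).
- by lia.
- rewrite /D -expnS coprime_sym coprimeXl // coprime2n; lia.
- rewrite /faber_poly size_poly_eq // subnn -/h h0 //.
- by rewrite c0 !mulf_neq0.
- rewrite c0 cD !val2M ?mulf_neq0 // v256 vh val2_2; lia.
move=> i; rewrite cD val2_2.
case: (leqP i (2 * D)) => iD; last first.
  by rewrite (_ : _`_i = 0) ?eqxx // coef_poly ltnS leqNgt iD.
rewrite /dumas_weight ci // => nz.
have hnz : h`_(2 * D - i) != 0 by apply: contraNneq nz => ->; rewrite mulr0 mul0r.
rewrite !val2M ?mulf_neq0 // v256 val2_2.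
set k := (2 * D - i)%N in nz hnz *.
have kd : (k <= 2 * D)%N by rewrite leq_subr.
have -> : i = (2 * D - k)%N by rewrite subKn.
(* Lying on or above the segment amounts to this inequality for [k = 2 * D - i]. Negative valuations
   are possible only at [k = D], where the left side is at least [- 2 D + 3 D], and at [k = 2 * D],
   where it is [- 6 D + 6 D]. *)
have key : 0 <= (2 * D)%N%:Z * val2 h`_k + 3 * k%:Z.
  have nn : 0 <= val2 h`_k -> 0 <= (2 * D)%N%:Z * val2 h`_k + 3 * k%:Z.
    by move=> ?; rewrite addr_ge0 ?mulr_ge0.
  have [k0|k0] := posnP k; first by apply: nn; rewrite k0 h0.
  have [k2|k2] := eqVneq k (2 * D)%N; first by rewrite k2 vh; lia.
  have [kD|kD] := eqVneq k D; last first.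
    by apply: nn; rewrite -val2_Zloc2 // hi // k0 ltn_neqAle k2.
  have : 0 <= val2 (2 * h`_k) by rewrite -val2_Zloc2 ?mulf_neq0 // kD.
  rewrite val2M // val2_2 => v1.
  have : 0 <= (2 * D)%N%:Z * (1 + val2 h`_k) by rewrite mulr_ge0.
  rewrite kD mulrDr; lia.
move: (val2 h`_k) key kd => v; move: (2 * D)%N => d key kd.
rewrite -subzn // -subr_ge0.
have -> : d%:Z * (1 + v + 8 * k%:Z) + (8 * d%:Z - 3) * (d%:Z - k%:Z) - ((8 * d%:Z - 3) * d%:Z + d%:Z * 1)
  = d%:Z * v + 3 * k%:Z by ring.
exact: key.
Qed.

End Faber.

(** * Unconditional sums *)

Section Summation.
Variable K : numFieldType.

(** Unconditional convergence in epsilon form, with duplicate-free lists for finite sets, over the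
    reals and the complex numbers alike; [hassum_sumE] connects it with [summability.sum]. *)
Definition hassum (I : choiceType) (u : I -> K) (l : K) : Prop :=
  forall e : K, 0 < e -> exists A : seq I, forall B : seq I, uniq B ->
    {subset A <= B} -> `|\sum_(i <- B) u i - l| < e.

Definition asum (I : choiceType) (u : I -> K) : Prop :=
  exists M : K, forall B : seq I, uniq B -> \sum_(i <- B) `|u i| <= M.

Lemma eq_hassum (I : choiceType) (u v : I -> K) l : u =1 v -> hassum u l -> hassum v l.
Proof. by move=> /funext ->. Qed.

Lemma hassum_unique (I : choiceType) (u : I -> K) l l' : hassum u l -> hassum u l' -> l = l'.
Proof.
move=> h h'; apply/eqP; rewrite -subr_eq0 -normr_eq0; apply/negPn/negP => nz.
have e0 : 0 < `|l - l'| / 2 by rewrite divr_gt0 // lt_def nz normr_ge0.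
have [A hA] := h _ e0; have [A' hA'] := h' _ e0.
pose B := undup (A ++ A').
have uB : uniq B by exact: undup_uniq.
have h1 : `|\sum_(i <- B) u i - l| < `|l - l'| / 2.
  by apply: hA => // i iA; rewrite mem_undup mem_cat iA.
have h2 : `|\sum_(i <- B) u i - l'| < `|l - l'| / 2.
  by apply: hA' => // i iA; rewrite mem_undup mem_cat iA orbT.
have := ltrD h1 h2; rewrite -splitr distrC => h3.
have := le_lt_trans (ler_normD _ _) h3.
by rewrite addrA subrK ltxx.
Qed.

Lemma hassum0 (I : choiceType) : hassum (fun _ : I => 0) 0.
Proof. by move=> e e0; exists [::] => B _ _; rewrite big1 // subrr normr0. Qed.

Lemma hassumD (I : choiceType) (u v : I -> K) l l' :
  hassum u l -> hassum v l' -> hassum (fun i => u i + v i) (l + l').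
Proof.
move=> h h' e e0; have e2 : 0 < e / 2 by rewrite divr_gt0.
have [A hA] := h _ e2; have [A' hA'] := h' _ e2.
exists (A ++ A') => B uB sB; rewrite big_split /= opprD addrACA (splitr e).
apply: le_lt_trans (ler_normD _ _) _; apply: ltrD.
  by apply: hA => // i iA; apply: sB; rewrite mem_cat iA.
by apply: hA' => // i iA; apply: sB; rewrite mem_cat iA orbT.
Qed.

Lemma hassumZ (I : choiceType) (u : I -> K) l k :
  hassum u l -> hassum (fun i => k * u i) (k * l).
Proof.
have [->|k0] := eqVneq k 0.
  by move=> _; rewrite mul0r; apply: eq_hassum (@hassum0 I) => i; rewrite mul0r.
move=> h e e0; have [|A hA] := h (e / `|k|); first by rewrite divr_gt0 // normr_gt0.
exists A => B uB sB; rewrite -mulr_sumr -mulrBr normrM mulrC -ltr_pdivlMr ?normr_gt0 //.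
exact: hA.
Qed.

Lemma hassumN (I : choiceType) (u : I -> K) l : hassum u l -> hassum (fun i => - u i) (- l).
Proof. by move=> /(hassumZ (-1)); rewrite mulN1r; apply: eq_hassum => i; rewrite mulN1r. Qed.

Lemma hassumB (I : choiceType) (u v : I -> K) l l' :
  hassum u l -> hassum v l' -> hassum (fun i => u i - v i) (l - l').
Proof. by move=> h /hassumN h'; apply: hassumD. Qed.

Lemma hassum_sum (I : choiceType) (T : Type) (s : seq T) (P : pred T) (u : T -> I -> K) (l : T -> K) :
  (forall t, P t -> hassum (u t) (l t)) ->
  hassum (fun i => \sum_(t <- s | P t) u t i) (\sum_(t <- s | P t) l t).
Proof.
move=> h; elim: s => [|t s IH].
  by rewrite big_nil; apply: eq_hassum (@hassum0 I) => i; rewrite big_nil.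
rewrite big_cons; case: ifP => Pt; last by apply: eq_hassum IH => i; rewrite big_cons Pt.
apply: eq_hassum (hassumD (h _ Pt) IH) => i; by rewrite big_cons Pt.
Qed.

Lemma partial_inverse (I J : choiceType) (phi : J -> I) : injective phi ->
  exists psi : I -> option J, ocancel psi phi /\ forall j, psi (phi j) = Some j.
Proof.
move=> inj.
have ex i : exists o : option J,
    (forall j, o = Some j -> phi j = i) /\ forall j, phi j = i -> o = Some j.
  have [[j <-]|h] := pselect (exists j, phi j = i).
    by exists (Some j); split=> [? [->]|? /inj ->].
  by exists None; split=> // j e; case: h; exists j.
have [psi hpsi] := choice ex.
exists psi; split=> [i|j]; last by apply: (hpsi (phi j)).2.
by case e: (psi i) => [j|] //=; apply: (hpsi i).1.
Qed.

Lemma hassum_reindex (I J : choiceType) (phi : J -> I) (u : I -> K) l :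
  injective phi -> (forall i, (forall j, phi j <> i) -> u i = 0) ->
  hassum (u \o phi) l -> hassum u l.
Proof.
move=> /partial_inverse[psi [psiK phiK]] u0 h e e0.
have [A hA] := h e e0; exists (map phi A) => B uB sB.
have -> : \sum_(i <- B) u i = \sum_(j <- pmap psi B) u (phi j).
  elim: {uB sB} B => [|i B IH] /=; first by rewrite !big_nil.
  rewrite big_cons IH /=; have := psiK i; case e': (psi i) => [j|] /=.
    by rewrite big_cons => ->.
  rewrite u0 ?add0r // => j ji; move: e'; rewrite -ji phiK //.
apply: hA; first exact: pmap_uniq psiK _ uB.
move=> j jA; rewrite mem_pmap; apply/mapP; exists (phi j) => //.
by apply: sB; apply: map_f.
Qed.

Lemma hassum_bij (I : choiceType) (phi psi : I -> I) (u : I -> K) l :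
  cancel phi psi -> cancel psi phi -> hassum (u \o phi) l -> hassum u l.
Proof.
move=> c1 c2; apply: hassum_reindex; first exact: can_inj c1.
by move=> i h; case: (h (psi i)).
Qed.

Lemma hassum_iter (I J : choiceType) (u : I * J -> K) (f : I -> K) l :
  hassum u l -> (forall i, hassum (fun j => u (i, j)) (f i)) -> hassum f l.
Proof.
move=> h hf e e0; have e2 : 0 < e / 2 by rewrite divr_gt0.
have [A hA] := h _ e2; exists (map fst A) => B uB sB.
have e3 : 0 < e / 2 / (size B).+1%:R by rewrite divr_gt0.
have [J0 hJ0] := choice (fun i => hf i _ e3).
(* One finite set of columns serves all rows of [B]: each row is then within [e / 2 / (size B + 1)]
   of its sum. *)
pose S := undup (flatten (map J0 B) ++ map snd A).
have uS : uniq S by exact: undup_uniq.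
have h1 : `|\sum_(p <- [seq (i, j) | i <- B, j <- S]) u p - l| < e / 2.
  apply: hA; first by apply: allpairs_uniq => // -[? ?] [? ?] _ _ [-> ->].
  move=> [i j] ijA; apply/allpairsP; exists (i, j); split=> //.
    by apply: sB; apply/mapP; exists (i, j).
  rewrite mem_undup mem_cat; apply/orP; right; by apply/mapP; exists (i, j).
rewrite big_allpairs in h1.
have h2 : `|\sum_(i <- B) f i - \sum_(i <- B) \sum_(j <- S) u (i, j)| <= e / 2.
  rewrite -sumrB; apply: le_trans (ler_norm_sum _ _ _) _.
  apply: (@le_trans _ _ (\sum_(i <- B) e / 2 / (size B).+1%:R)).
    rewrite big_seq [leRHS]big_seq; apply: ler_sum => i iB; rewrite distrC; apply: ltW.
    apply: hJ0 => // j jJ; rewrite mem_undup mem_cat; apply/orP; left.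
    by apply/flattenP; exists (J0 i) => //; apply: map_f.
  rewrite big_const_seq count_predT iter_addr_0 -(mulr_natr (e / 2 / _)) -(mulrA (e / 2)).
  by rewrite ler_piMr ?(ltW e2) // mulrC ler_pdivrMr // mul1r ler_nat.
rewrite (splitr e) -(subrK (\sum_(i <- B) \sum_(j <- S) u (i, j)) (\sum_(i <- B) f i)) -addrA.
apply: le_lt_trans (ler_normD _ _) _; exact: ler_ltD.
Qed.

Lemma ler_sum_subset (I : eqType) (B B' : seq I) (F : I -> K) : uniq B -> uniq B' ->
  {subset B <= B'} -> (forall i, 0 <= F i) -> \sum_(i <- B) F i <= \sum_(i <- B') F i.
Proof.
move=> uB uB' sB F0; rewrite [leRHS](bigID (mem B)) /=.
rewrite -(big_filter B' (fun i => i \in B)) [X in _ <= X + _](perm_big B) /=.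
  by rewrite lerDl sumr_ge0.
apply: uniq_perm => //; first exact: filter_uniq.
by move=> i; rewrite mem_filter /=; case: (boolP (i \in B)) => // /sB ->.
Qed.

Lemma asum_dom (I : choiceType) (u v : I -> K) :
  (forall i, `|u i| <= `|v i|) -> asum v -> asum u.
Proof. by move=> h [M hM]; exists M => B uB; apply: le_trans (hM B uB); apply: ler_sum. Qed.

Lemma asum_comp (I J : choiceType) (phi : J -> I) (u : I -> K) :
  injective phi -> asum u -> asum (u \o phi).
Proof.
move=> inj [M hM]; exists M => B uB; rewrite -(big_map phi xpredT (fun i => `|u i|)).
by apply: hM; rewrite map_inj_uniq.
Qed.

Lemma asumD (I : choiceType) (u v : I -> K) : asum u -> asum v -> asum (fun i => `|u i| + `|v i|).
Proof.
move=> [M hM] [N hN]; exists (M + N) => B uB.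
under eq_bigr do rewrite ger0_norm ?addr_ge0 //.
by rewrite big_split lerD ?hM ?hN.
Qed.

Lemma asumZ (I : choiceType) (u : I -> K) k : asum u -> asum (fun i => k * u i).
Proof.
move=> [M hM]; exists (`|k| * M) => B uB; under eq_bigr do rewrite normrM.
by rewrite -mulr_sumr ler_wpM2l ?hM.
Qed.

Lemma asumM (I J : choiceType) (u : I -> K) (v : J -> K) :
  asum u -> asum v -> asum (fun p : I * J => u p.1 * v p.2).
Proof.
move=> [M hM] [N hN]; exists (M * N) => B uB.
pose B1 := undup (map fst B); pose B2 := undup (map snd B).
have uB1 : uniq B1 by exact: undup_uniq.
have uB2 : uniq B2 by exact: undup_uniq.
apply: (@le_trans _ _ (\sum_(p <- [seq (i, j) | i <- B1, j <- B2]) `|u p.1 * v p.2|)).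
  apply: ler_sum_subset => //.
    by apply: allpairs_uniq => // -[? ?] [? ?] _ _ [-> ->].
  move=> [i j] ijB; apply/allpairsP; exists (i, j); split=> //; rewrite mem_undup;
  by apply/mapP; exists (i, j).
rewrite big_allpairs /=; under eq_bigr => i _.
  by under eq_bigr => j _ do rewrite normrM; rewrite -mulr_sumr; over.
rewrite -mulr_suml; apply: ler_pM; rewrite ?sumr_ge0 ?hM ?hN //.
Qed.

End Summation.

Local Open Scope complex_scope.

(** * Absolutely summable families converge *)

Section Existence.
Variable R : realType.
Notation C := R[i].

Lemma asum_ge0_hassum (I : choiceType) (u : I -> R) :
  (forall i, 0 <= u i) -> asum u -> exists l, hassum u l.
Proof.
move=> u0 [M hM].
pose E : set R := [set x | exists2 B : seq I, uniq B & x = \sum_(i <- B) u i]%classic.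
have supE : has_sup E.
  split; first by exists 0, [::]; rewrite ?big_nil.
  exists M => x [B uB ->]; apply: le_trans (hM B uB).
  by apply: ler_sum => i _; exact: ler_norm.
exists (sup E) => e e0.
have [_ [A uA ->] hA] := sup_adherent e0 supE.
exists A => B uB sB.
have h1 : \sum_(i <- B) u i <= sup E by apply: ub_le_sup; [case: supE | exists B].
have h2 : \sum_(i <- A) u i <= \sum_(i <- B) u i by exact: ler_sum_subset.
by rewrite distrC ger0_norm ?subr_ge0 //; lra.
Qed.

Lemma asum_hassumR (I : choiceType) (u : I -> R) : asum u -> exists l, hassum u l.
Proof.
move=> hu.
have [l1 h1] : exists l, hassum (fun i => `|u i| + u i) l.
  apply: asum_ge0_hassum; first by move=> i; have := ler_norm (- u i); rewrite normrN; lra.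
  apply: asum_dom (asumZ 2 hu) => i; rewrite (le_trans (ler_normD _ _)) // normr_id normrM.
  by rewrite gtr0_norm //; lra.
have [l2 h2] : exists l, hassum (fun i => `|u i|) l.
  by apply: asum_ge0_hassum => //; apply: asum_dom hu => i; rewrite normr_id.
by exists (l1 - l2); apply: eq_hassum (hassumB h1 h2) => i; rewrite addrC addKr.
Qed.

Lemma gt0_complexP (e : C) : 0 < e -> exists2 x : R, 0 < x & e = x%:C.
Proof.
by case: e => x y; rewrite ltcE /= => /andP[/eqP -> x0]; exists x.
Qed.

Lemma normc_real (x : R) : `|x%:C| = `|x|%:C.
Proof. by rewrite normc_def /= expr0n addr0 sqrtr_sqr. Qed.

Lemma hassum_complex (I : choiceType) (u : I -> R) l :
  hassum u l -> hassum (fun i => (u i)%:C) l%:C.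
Proof.
move=> h e /gt0_complexP[x x0 ->]; have [A hA] := h x x0.
exists A => B uB sB; rewrite -rmorph_sum -rmorphB normc_real ltcR; exact: hA.
Qed.

Lemma asum_hassum (I : choiceType) (u : I -> C) : asum u -> exists l, hassum u l.
Proof.
move=> [M hM].
have le_Re (x : C) : `|complex.Re x| <= complex.Re `|x|.
  by have := normc_ge_Re x; rewrite lecE => /andP[].
have le_Im (x : C) : `|complex.Im x| <= complex.Re `|x|.
  have := le_Re (x * 'i); rewrite ReiNIm normrN normrM.
  by rewrite [`|_ *i|]normc_def /= expr0n expr1n add0r sqrtr1 mulr1 mulr0 subr0.
have dom (v : I -> R) : (forall i, `|v i| <= complex.Re `|u i|) -> asum v.
  move=> hv; exists (complex.Re M) => B uB.
  apply: (@le_trans _ _ (\sum_(i <- B) complex.Re `|u i|)); first exact: ler_sum.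
  have := hM B uB; rewrite lecE => /andP[_].
  by rewrite (raddf_sum (@complex.Re R : Rcomplex R -> R)).
have [l1 h1] := asum_hassumR (dom _ (fun i => le_Re (u i))).
have [l2 h2] := asum_hassumR (dom _ (fun i => le_Im (u i))).
exists (l1%:C + 'i * l2%:C).
apply: eq_hassum (hassumD (hassum_complex h1) (hassumZ 'i (hassum_complex h2))) => i.
by rewrite -complexE.
Qed.

Lemma hassumM (I J : choiceType) (u : I -> C) (v : J -> C) s t : asum u -> asum v ->
  hassum u s -> hassum v t -> hassum (fun z : I * J => u z.1 * v z.2) (s * t).
Proof.
move=> au av hu hv; have [l hl] := asum_hassum (asumM au av).
have h1 := hassum_iter hl (fun x => hassumZ (u x) hv).
have h2 : hassum (fun x => u x * t) (s * t).
  by rewrite mulrC; apply: eq_hassum (hassumZ t hu) => x; rewrite mulrC.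
by rewrite -(hassum_unique h1 h2).
Qed.

Lemma hassum_sumE (I : choiceType) (u : I -> C) l :
  hassum u l -> summability.sum (u : I -> C^o) = l.
Proof.
move=> h; have FF := @totally_filter I; apply: cvg_lim => //.
apply/cvgrPdist_lt => e e0; have [A hA] := h e e0.
exists (finmap.seq_fset tt A) => // B /finmap.fsubsetP sB.
rewrite /= distrC /partial_sum -(finmap.big_seq_fsetE _ B xpredT u); apply: hA.
  exact: finmap.fset_uniq.
by move=> i iA; apply: sB; rewrite finmap.seq_fsetE.
Qed.

End Existence.

(** * The recurrence for lattice sums *)

Section Algebra.
Variable F : fieldType.

(** [conv1] and [conv2] are the coefficients of [s ^ n] in [1 / ((1 - u s)^2 (1 - v s))] and
    [1 / ((1 - u s)^2 (1 - v s)^2)]; the closed forms below are their partial fractions. *)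
Definition conv1 n (u v : F) := \sum_(p < n.+1) p.+1%:R * (u ^+ p * v ^+ (n - p)).
Definition conv2 n (u v : F) := \sum_(p < n.+1) (p.+1 * (n - p).+1)%:R * (u ^+ p * v ^+ (n - p)).

Lemma conv1S n u v : conv1 n.+1 u v = v * conv1 n u v + n.+2%:R * u ^+ n.+1.
Proof.
rewrite /conv1 big_ord_recr /= subnn expr0 mulr1 mulr_sumr; congr (_ + _).
apply: eq_bigr => i _; rewrite subSn 1?exprS; last by rewrite -ltnS.
by rewrite !mulrA; congr (_ * _); ring.
Qed.

Lemma conv2S n u v : conv2 n.+1 u v = v * conv2 n u v + conv1 n.+1 u v.
Proof.
rewrite /conv2 /conv1 big_ord_recr [X in _ = _ + X]big_ord_recr /= subnn muln1 addrA; congr (_ + _).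
rewrite mulr_sumr -big_split; apply: eq_bigr => i _ /=.
have -> : (n.+1 - i = (n - i).+1)%N by rewrite subSn // -ltnS.
by rewrite mulnS natrD exprS; ring.
Qed.

Lemma conv1E n u v :
  conv1 n u v * (v - u) ^+ 2 = v ^+ n.+2 - n.+2%:R * u ^+ n.+1 * v + n.+1%:R * u ^+ n.+2.
Proof.
elim: n => [|n IH]; first by rewrite /conv1 big_ord1 /=; ring.
rewrite conv1S mulrDl -mulrA IH !exprS -!natr1; ring.
Qed.

Lemma conv2E n u v : conv2 n u v * (v - u) ^+ 3 =
  n.+1%:R * (u ^+ n.+2 + v ^+ n.+2) * (v - u) + 2 * (u * v) * (u ^+ n.+1 - v ^+ n.+1).
Proof.
elim: n => [|n IH]; first by rewrite /conv2 big_ord1 /= subnn muln1; ring.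
rewrite conv2S mulrDl -mulrA IH [(v - u) ^+ 3]exprSr [conv1 _ _ _ * _]mulrA conv1E.
rewrite !exprS -!natr1; ring.
Qed.

Lemma conv1_diag n : 2 * conv1 n 1 1 = (n.+1 * n.+2)%:R.
Proof.
elim: n => [|n IH]; first by rewrite /conv1 big_ord1 /= !expr1n -[(1 * 2)%N]/2%N; ring.
by rewrite conv1S mulrDr mul1r IH !expr1n mulr1 -natrM -natrD; congr _%:R; lia.
Qed.

Lemma conv2_diag n : 6 * conv2 n 1 1 = (n.+1 * n.+2 * n.+3)%:R.
Proof.
elim: n => [|n IH]; first by rewrite /conv2 big_ord1 /= subnn !expr1n -[(1 * 2 * 3)%N]/6%N; ring.
rewrite conv2S mulrDr mul1r IH.
have -> : 6 * conv1 n.+1 1 1 = 3 * (2 * conv1 n.+1 1 1) by ring.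
by rewrite conv1_diag -natrM -natrD; congr _%:R; lia.
Qed.

(** [u ^ 2 * v ^ 2 * conv2] without its two end terms. These contain an exponent 2, and inverse
    squares are not absolutely summable over a lattice of rank two. *)
Definition conv_in n (u v : F) :=
  \sum_(3 <= q < n.+2) (q.-1 * (n.+3 - q))%:R * (u ^+ q * v ^+ (n.+4 - q)).

Lemma conv_inE n u v : (1 < n)%N ->
  u ^+ 2 * v ^+ 2 * conv2 n u v = conv_in n u v + n.+1%:R * (u ^+ 2 * v ^+ n.+2 + u ^+ n.+2 * v ^+ 2).
Proof.
case: n => [|[|n]] // _.
rewrite /conv2 -(big_mkord xpredT (fun p => (p.+1 * (n.+2 - p).+1)%:R * (u ^+ p * v ^+ (n.+2 - p)))).
rewrite big_nat_recr //= big_ltn // subn0 subnn /conv_in.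
rewrite [X in _ = X + _](big_addn 1 n.+4 2 xpredT) subSS subn1 /=.
rewrite !mulrDr mulr_sumr.
rewrite (_ : \sum_(1 <= i < n.+2) _ = \sum_(1 <= i < n.+2)
   ((i + 2).-1 * (n.+2.+3 - (i + 2)))%:R * (u ^+ (i + 2) * v ^+ (n.+2.+4 - (i + 2)))); last first.
  rewrite big_nat_cond [RHS]big_nat_cond; apply: eq_bigr => i /andP[/andP[i1 i2] _].
  have -> : ((i + 2).-1 = i.+1)%N by lia.
  have -> : (n.+2.+3 - (i + 2) = (n.+2 - i).+1)%N by lia.
  have -> : (n.+2.+4 - (i + 2) = 2 + (n.+2 - i))%N by lia.
  rewrite addn2 !exprS; ring.
rewrite !exprS mul1n muln1; ring.
Qed.

End Algebra.

Section LatticeSums.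
Variables (R : realType) (I : zmodType) (omega : {additive I -> R[i]}).
Notation C := R[i].
Hypothesis omega_inj : forall x, omega x = 0 -> x = 0.

(** As [0^-1 = 0], sums over all of [I] omit the origin by themselves. *)
Definition recip (x : I) : C := (omega x)^-1.
Notation iv := recip.
Hypothesis iv_le1 : forall x, `|iv x| <= 1.

Lemma recip0 : iv 0 = 0. Proof. by rewrite /iv raddf0 invr0. Qed.
Lemma recipN x : iv (- x) = - iv x. Proof. by rewrite /iv raddfN invrN. Qed.

Lemma omega_neq0 x : x != 0 -> omega x != 0.
Proof. by apply: contra_neq; exact: omega_inj. Qed.

Lemma recip_eq0 x : (iv x == 0) = (x == 0).
Proof.
rewrite /iv invr_eq0; apply/eqP/eqP => [|->]; [exact: omega_inj | exact: raddf0].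
Qed.

Lemma recip_sub x y : x != 0 -> y != 0 -> x != y ->
  iv (x - y) * (iv y - iv x) = iv x * iv y.
Proof.
move=> x0 y0 xy; have ox := omega_neq0 x0; have oy := omega_neq0 y0.
have := omega_neq0 (_ : x - y != 0); rewrite subr_eq0 => /(_ xy).
rewrite /iv raddfB => od; field.
by rewrite ox oy od.
Qed.

Lemma subK_inv (x : I) : cancel (fun y => x - y) (fun y => x - y).
Proof. by move=> y; rewrite subKr. Qed.

Lemma hassum_anti (J : choiceType) (u : J -> C) (phi : J -> J) :
  cancel phi phi -> (forall y, u (phi y) = - u y) -> asum u -> hassum u 0.
Proof.
move=> inv anti /asum_hassum[l h].
have h' : hassum u (- l).
  apply: (hassum_bij inv inv); apply: eq_hassum (hassumN h) => y /=; by rewrite anti.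
suff l0 : l = 0 by rewrite -l0.
have e := hassum_unique h h'.
have /eqP : l *+ 2 = 0 by rewrite mulr2n {1}e addNr.
by rewrite mulrn_eq0 /= => /eqP.
Qed.

Lemma hassum_recip_odd q : odd q -> asum (fun x => iv x ^+ q) -> hassum (fun x => iv x ^+ q) 0.
Proof.
move=> oq; apply: (@hassum_anti _ _ (fun x => - x)); first exact: opprK.
by move=> y; rewrite recipN exprNn -signr_odd oq expr1 mulN1r.
Qed.

Lemma asum_recip_ge p q : (p <= q)%N -> asum (fun x => iv x ^+ p) -> asum (fun x => iv x ^+ q).
Proof.
move=> pq; apply: asum_dom => x; rewrite !normrX.
by rewrite ler_wiXn2l ?normr_ge0.
Qed.

Lemma asum_pairs p q : asum (fun x => iv x ^+ p) -> asum (fun x => iv x ^+ q) ->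
  asum (fun z : I * I => iv z.1 ^+ p * iv (z.1 - z.2) ^+ q).
Proof.
move=> hp hq.
have inj : injective (fun z : I * I => (z.1, z.1 - z.2)).
  by move=> [x y] [x' y'] [-> /(congr1 (fun t => x' - t))]; rewrite !subKr => ->.
exact: (asum_comp inj (asumM hp hq)).
Qed.

Lemma hassum_double0 (u : I * I -> C) : asum u ->
  (forall x, hassum (fun y => u (x, y)) 0) -> hassum u 0.
Proof.
move=> /asum_hassum[l h] hs; have h0 := hassum_iter h hs.
by have <- := hassum_unique h0 (@hassum0 _ I).
Qed.

Lemma hassum_swap (u : I * I -> C) l : hassum u l -> hassum (fun z => u (z.2, z.1)) l.
Proof.
move=> h; apply: (@hassum_bij _ _ (fun z => (z.2, z.1)) (fun z => (z.2, z.1))); try by case.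
by apply: eq_hassum h; case.
Qed.

Lemma hassum_diag p s : hassum (fun x => iv x ^+ p) s ->
  hassum (fun z : I * I => (z.1 == z.2)%:R * iv z.1 ^+ p) s.
Proof.
move=> h; apply: (@hassum_reindex _ _ _ (fun x => (x, x))).
- by move=> x y [].
- move=> [x y] /= hxy; case: eqP => [e|_]; last by rewrite mul0r.
  by case: (hxy x); rewrite -e.
- by apply: eq_hassum h => x /=; rewrite eqxx mul1r.
Qed.

Lemma hassum_axis p s : hassum (fun x => iv x ^+ p) s ->
  hassum (fun z : I * I => (z.2 == 0)%:R * iv z.1 ^+ p) s.
Proof.
move=> h; apply: (@hassum_reindex _ _ _ (fun x => (x, 0))).
- by move=> x y [].
- move=> [x y] /= hxy; case: eqP => [e|_]; last by rewrite mul0r.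
  by case: (hxy x); rewrite -e.
- by apply: eq_hassum h => x /=; rewrite eqxx mul1r.
Qed.

Section Quadratic.
Hypothesis asum3 : asum (fun x => iv x ^+ 3).

(* For fixed [z.1] both summands cancel under [z.2 |-> z.1 - z.2] and [z.2 |-> - z.2],
   so [kern] sums to zero, and [conv_in] is [kern] symmetrized up to terms supported on
   the diagonal and the axes. *)
Definition kern n (z : I * I) : C :=
  n.+1%:R * iv z.1 ^+ n.+2 * (iv (z.1 - z.2) ^+ 2 - iv z.2 ^+ 2)
  + 2 * iv z.1 ^+ n.+1 * iv (z.1 - z.2) ^+ 3.

(* [x^-1 * ((x - y)^-2 - y^-2) = ((x - y)^-1 - y^-1) * (x - y)^-1 * y^-1] *)
Lemma kern_decay x y :
  `|iv x * (iv (x - y) ^+ 2 - iv y ^+ 2)| <= `|iv (x - y)| ^+ 3 + `|iv y| ^+ 3.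
Proof.
have [->|x0] := eqVneq x 0; first by rewrite recip0 mul0r normr0 addr_ge0 ?exprn_ge0.
have [->|y0] := eqVneq y 0.
  by rewrite subr0 recip0 expr0n subr0 -exprS normrX normr0 expr0n addr0.
have [->|xy] := eqVneq x y.
  by rewrite subrr recip0 expr0n sub0r mulrN normrN -exprS normrX normr0 expr0n add0r.
have e := recip_sub x0 y0 xy; set d := iv (x - y) in e *.
have -> : iv x * (d ^+ 2 - iv y ^+ 2) = (d - iv y) * d * iv y.
  have ivx : iv x != 0 by rewrite recip_eq0.
  have e2 : iv x * (d + iv y) = d * iv y by rewrite mulrDr -e; ring.
  by rewrite subr_sqr mulrCA e2 mulrA.
have -> : (d - iv y) * d * iv y = d ^+ 2 * iv y - d * iv y ^+ 2 by ring.
apply: le_trans (ler_normB _ _) _; rewrite (normrM (d ^+ 2)) (normrX 2 d) (normrM d) normrX.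
rewrite -subr_ge0.
have -> : `|d| ^+ 3 + `|iv y| ^+ 3 - (`|d| ^+ 2 * `|iv y| + `|d| * `|iv y| ^+ 2) =
  (`|d| + `|iv y|) * (`|d| - `|iv y|) ^+ 2 by ring.
by rewrite mulr_ge0 ?addr_ge0 // real_exprn_even_ge0 // rpredB ?normr_real.
Qed.

(** One of the factors [iv z.1] is spent in [kern_decay] on cubic decay of the difference of inverse
    squares; at least three remain for summability in [z.1]. *)
Lemma asum_kern n : (1 < n)%N -> asum (kern n).
Proof.
move=> n1.
have a1 : asum (fun x => iv x ^+ n.+1) by apply: asum_recip_ge asum3.
pose v (z : I * I) := `|iv z.1 ^+ n.+1 * iv (z.1 - z.2) ^+ 3| + `|iv z.1 ^+ n.+1 * iv z.2 ^+ 3|.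
have av : asum v by apply: asumD; [exact: asum_pairs a1 asum3 | exact: asumM a1 asum3].
apply: asum_dom (asumZ (n.+1%:R + 2) av) => -[x y]; rewrite /kern /v /=.
have -> : n.+1%:R * iv x ^+ n.+2 * (iv (x - y) ^+ 2 - iv y ^+ 2) =
  n.+1%:R * (iv x ^+ n.+1 * (iv x * (iv (x - y) ^+ 2 - iv y ^+ 2))) by rewrite [iv x ^+ n.+2]exprSr; ring.
have dec := kern_decay x y; rewrite -!normrX in dec.
move: (iv x ^+ n.+1) (_ * (_ - _)) (iv (x - y) ^+ 3) (iv y ^+ 3) dec => A W B D dec.
apply: le_trans (ler_normD _ _) _.
rewrite [leRHS]ger0_norm ?mulr_ge0 ?addr_ge0 //.
rewrite -[2 * _ * _]mulrA !normrM !normr_nat [leRHS]mulrDl; apply: lerD.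
  by rewrite ler_wpM2l // -mulrDr ler_wpM2l.
by rewrite ler_wpM2l // lerDl mulr_ge0.
Qed.

Lemma asum_kern_section x : x != 0 -> asum (fun y => iv (x - y) ^+ 2 - iv y ^+ 2).
Proof.
move=> x0; have ox := omega_neq0 x0.
have av : asum (fun y => `|iv (x - y) ^+ 3| + `|iv y ^+ 3|).
  apply: asumD => //; apply: (@asum_comp _ _ _ (fun y => x - y) (fun y => iv y ^+ 3)) => //.
  exact: can_inj (@subK_inv x).
apply: asum_dom (asumZ (omega x) av) => y.
rewrite (normrM (omega x)) [X in _ <= _ * X]ger0_norm ?addr_ge0 // !normrX.
have := kern_decay x y; move: (_ - _) (`|_| ^+ 3 + _) => W D; rewrite (normrM (iv x)) => h.
have e : `|omega x| * `|iv x| = 1 by rewrite -normrM mulfV // normr1.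
by rewrite -[leLHS]mul1r -e -mulrA ler_wpM2l.
Qed.

Lemma hassum_kern n : (1 < n)%N -> hassum (kern n) 0.
Proof.
move=> n1; apply: hassum_double0 (asum_kern n1) _ => x.
have [->|x0] := eqVneq x 0.
  by apply: eq_hassum (@hassum0 _ I) => y; rewrite /kern /= recip0 !expr0n /=; ring.
have h2 : hassum (fun y => iv (x - y) ^+ 2 - iv y ^+ 2) 0.
  apply: (hassum_anti (@subK_inv x)) (asum_kern_section x0) => y.
  by rewrite subKr opprB.
have h3 : hassum (fun y => iv (x - y) ^+ 3) 0.
  apply: (hassum_bij (@subK_inv x) (@subK_inv x)).
  by apply: eq_hassum (hassum_recip_odd _ asum3) => // y /=; rewrite subKr.
have := hassumD (hassumZ (n.+1%:R * iv x ^+ n.+2) h2) (hassumZ (2 * iv x ^+ n.+1) h3).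
by rewrite !mulr0 addr0.
Qed.

(** Off the diagonal and the axes this is [conv2E] divided by [(v - u) ^ 3], as [recip_sub] gives
    [d = u v / (v - u)]. On the diagonal the value of [conv2] itself is left over. On an axis
    [conv_in] vanishes while one [kern] is [(n + 3) * iv x ^ (n + 4)], to be subtracted. The factor
    6 clears the denominator of [conv2_diag]. *)
Lemma conv_in_kern n x y : (1 < n)%N ->
  6 * conv_in n (iv x) (iv y) = 6 * kern n (x, y) + 6 * kern n (y, x)
   + (n.+1 * n.+2 * n.+3)%:R * ((x == y)%:R * iv x ^+ n.+4)
   - 6 * n.+3%:R * ((y == 0)%:R * iv x ^+ n.+4) - 6 * n.+3%:R * ((x == 0)%:R * iv y ^+ n.+4).
Proof.
move=> n1; have e := conv_inE (iv x) (iv y) n1.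
have -> : conv_in n (iv x) (iv y) = iv x ^+ 2 * iv y ^+ 2 * conv2 n (iv x) (iv y)
   - n.+1%:R * (iv x ^+ 2 * iv y ^+ n.+2 + iv x ^+ n.+2 * iv y ^+ 2) by rewrite e addrK.
rewrite /kern /= !natrM -[n.+3%:R]natr1 -[n.+2%:R]natr1 -[n.+1%:R]natr1.
have f0 : false%:R = 0 :> C by [].
have [x0|x0] := eqVneq x 0.
  rewrite x0 recip0 sub0r recipN subr0 !expr0n /= [0 == y]eq_sym.
  case: eqP => [->|_]; rewrite ?recip0 ?expr0n /= !exprS ?f0; ring.
have [y0|y0] := eqVneq y 0.
  rewrite y0 recip0 sub0r recipN subr0 !expr0n /= ?(negbTE x0) !exprS ?f0; ring.
have [<-|xy] := eqVneq x y.
  rewrite subrr recip0 !expr0n /= mul0r.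
  have d : 6 * (iv x ^+ 2 * iv x ^+ 2 * conv2 n (iv x) (iv x)) = (n.+1 * n.+2 * n.+3)%:R * iv x ^+ n.+4.
    have -> : conv2 n (iv x) (iv x) = iv x ^+ n * conv2 n 1 1.
      rewrite /conv2 mulr_sumr; apply: eq_bigr => i _.
      by rewrite -exprD subnKC 1?mulrC ?expr1n ?mulr1 // -ltnS.
    rewrite -conv2_diag !exprS; ring.
  rewrite !natrM -[n.+3%:R]natr1 -[n.+2%:R]natr1 -[n.+1%:R]natr1 in d.
  rewrite mulrBr d !exprS ?f0; ring.
have h := recip_sub x0 y0 xy.
have yx : iv (y - x) = - iv (x - y) by rewrite -recipN opprB.
have cE := conv2E n (iv x) (iv y); rewrite -[n.+1%:R]natr1 in cE.
have ux : iv x != 0 by rewrite recip_eq0.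
have vy : iv y != 0 by rewrite recip_eq0.
rewrite yx; move: (iv x) (iv y) (iv (x - y)) (conv2 n _ _) h cE ux vy => u v d f h cE ux vy.
have D0 : v - u != 0.
  by apply: contra_eq_neq h => ->; rewrite mulr0 eq_sym mulf_neq0.
have key : u ^+ 2 * v ^+ 2 * f = (n%:R + 1) * (u ^+ n.+2 + v ^+ n.+2) * d ^+ 2
    + 2 * (u ^+ n.+1 - v ^+ n.+1) * d ^+ 3.
  apply: (mulIf (expf_neq0 3 D0)); rewrite -(mulrA (u ^+ 2 * v ^+ 2)) cE.
  transitivity ((n%:R + 1) * (u ^+ n.+2 + v ^+ n.+2) * (d * (v - u)) ^+ 2 * (v - u)
    + 2 * (u ^+ n.+1 - v ^+ n.+1) * (d * (v - u)) ^+ 3); last by ring.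
  rewrite h; ring.
rewrite key ?f0; ring.
Qed.

(** Summed over all pairs, both [kern] terms vanish, so only the diagonal and the two axes
    contribute to the right side. *)
Lemma lattice_sum_conv n (g : nat -> C) : (1 < n)%N ->
  (forall q, (2 < q)%N -> hassum (fun x => iv x ^+ q) (g q)) ->
  6 * \sum_(3 <= q < n.+2) (q.-1 * (n.+3 - q))%:R * (g q * g (n.+4 - q)%N) =
  ((n.+1 * n.+2 * n.+3)%:R - 12 * n.+3%:R) * g n.+4.
Proof.
move=> n1 hg.
have h1 : hassum (fun z : I * I => 6 * conv_in n (iv z.1) (iv z.2))
    (6 * \sum_(3 <= q < n.+2) (q.-1 * (n.+3 - q))%:R * (g q * g (n.+4 - q)%N)).
  apply: hassumZ; rewrite [X in hassum _ X]big_nat_cond.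
  apply: (@eq_hassum _ _ (fun z : I * I => \sum_(3 <= q < n.+2 | (3 <= q < n.+2)%N && true)
     (q.-1 * (n.+3 - q))%:R * (iv z.1 ^+ q * iv z.2 ^+ (n.+4 - q)))).
    by move=> z; rewrite /conv_in [RHS]big_nat_cond.
  apply: hassum_sum => q /andP[/andP[q3 qn] _]; apply: hassumZ.
  have q4 : (3 <= n.+4 - q)%N by lia.
  apply: (@hassumM _ _ _ (fun x => iv x ^+ q) (fun x => iv x ^+ (n.+4 - q)));
    by [exact: asum_recip_ge asum3 | exact: hg].
have hN := hg n.+4 isT.
have hk := hassum_kern n1.
have h2 := hassumD (hassumZ 6 hk) (hassumZ 6 (hassum_swap hk)).
have h3 := hassumD h2 (hassumZ (n.+1 * n.+2 * n.+3)%:R (hassum_diag hN)).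
have h4 := hassumB h3 (hassumZ (6 * n.+3%:R) (hassum_axis hN)).
have h5 := hassumB h4 (hassumZ (6 * n.+3%:R) (hassum_swap (hassum_axis hN))).
have e := hassum_unique h1 (eq_hassum _ h5).
rewrite e; first by ring.
by move=> [x y] /=; rewrite conv_in_kern.
Qed.

(** The parameters are minus a quarter of the Weierstrass invariants [60 G_4] and [140 G_6]. Odd
    exponents sum to zero, so only the even ones survive in [lattice_sum_conv]. *)
Lemma lattice_wp_rec (g : nat -> C) :
  (forall q, (2 < q)%N -> hassum (fun x => iv x ^+ q) (g q)) ->
  wp_rec (- 15%:R * g 4) (- 35%:R * g 6)
    (fun m => match m with 0 => 1 | 1 => 0 | _ => (2 * m - 1)%:R * g (2 * m)%N end).
Proof.
move=> hg.
have godd q : odd q -> (2 < q)%N -> g q = 0.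
  move=> oq q2; apply: hassum_unique (hg _ q2) _.
  by apply: hassum_recip_odd => //; apply: asum_recip_ge asum3.
set c := (X in wp_rec _ _ X).
have cE k : (1 < k)%N -> c k = (2 * k - 1)%:R * g (2 * k)%N by case: k => [|[|k]].
apply: wp_recI => //.
- by rewrite /c -[(2 * 2 - 1)%N]/3%N -[(2 * 2)%N]/4%N; ring.
- by rewrite /c -[(2 * 3 - 1)%N]/5%N -[(2 * 3)%N]/6%N; ring.
move=> m m3.
have [n [n1 nm]] : exists n, (1 < n)%N /\ (2 * m = n.+4)%N by exists (2 * m - 4)%N; lia.
have := lattice_sum_conv n1 hg; rewrite -nm => e.
apply: (@mulfI _ 2); first by rewrite pnatr_eq0.
transitivity (((n.+1 * n.+2 * n.+3)%:R - 12 * n.+3%:R) * g (2 * m)%N).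
  rewrite cE; last by lia.
  have -> : n.+3 = (2 * m - 1)%N by lia.
  have -> : n.+2 = (2 * m - 2)%N by lia.
  have -> : n.+1 = (2 * m - 3)%N by lia.
  by rewrite !natrM !natrB ?natrM; try lia; ring.
rewrite -e; set S := \sum_(2 <= i < m.-1) _.
rewrite (_ : 2 * (3 * S) = 6 * S); last by ring.
congr (_ * _); rewrite /S.
pose F q : C := (q.-1 * (n.+3 - q))%:R * (g q * g (2 * m - q)%N).
have e1 : \sum_(2 <= q < n.+2) F q = F 2 + \sum_(3 <= q < n.+2) F q.
  by rewrite big_ltn //; lia.
have e2 : \sum_(2 <= q < n.+2) F q = F 2 + \sum_(2 <= j < m.-1) (F (2 * j)%N + F (2 * j).+1).
  have -> : n.+2 = (2 * m.-2.+1)%N by lia.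
  rewrite sum_pairs big_ltn; last by lia.
  rewrite (_ : F (2 * 1).+1 = 0) ?addr0; last by rewrite /F godd // mul0r mulr0.
  by congr (_ + \sum_(_ <= _ < _) _); lia.
rewrite -/(\sum_(3 <= q < n.+2) F q) (addrI _ (etrans (esym e1) e2)) big_nat_cond [RHS]big_nat_cond.
apply: eq_bigr => j /andP[/andP[j2 jm] _].
rewrite [F (2 * j).+1](_ : _ = 0) ?addr0; last by rewrite /F godd ?mul0r ?mulr0 //=; lia.
rewrite /F; have -> : (2 * m - 2 * j = 2 * (m - j))%N by lia.
have -> : ((2 * j).-1 = 2 * j - 1)%N by lia.
have -> : (n.+3 - 2 * j = 2 * (m - j) - 1)%N by lia.
rewrite !cE; try lia.
by rewrite natrM; ring.
Qed.

End Quadratic.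
End LatticeSums.

(** * The integers and the lattice spanned by [i y] and 1 *)

Section Majorant.
Variable R : realType.

(* [|n| + 1] to the power [-3/2]: by AM-GM, products of two of these dominate the
   inverse cubes on the lattice. *)
Definition majorant (n : nat) : R := (n.+1%:R * Num.sqrt n.+1%:R)^-1.

Lemma majorant_ge0 n : 0 <= majorant n.
Proof. by rewrite invr_ge0 mulr_ge0 ?sqrtr_ge0. Qed.

Lemma majorant_sqr n : majorant n ^+ 2 = (n.+1%:R ^+ 3)^-1.
Proof. by rewrite exprVn exprMn sqr_sqrtr // -exprSr. Qed.

(** The bound is the first term plus the integral of [x ^ (-3/2)] from 1 to [N + 1]. *)
Lemma majorant_sum N : \sum_(0 <= n < N.+1) majorant n <= 3 - 2 / Num.sqrt N.+1%:R.
Proof.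
elim: N => [|N IH].
  by rewrite big_nat1 /majorant sqrtr1 mulr1 invr1; lra.
rewrite big_nat_recr //=; apply: le_trans (lerD IH (lexx _)) _.
rewrite /majorant; set s := Num.sqrt N.+1%:R; set t := Num.sqrt N.+2%:R.
have s0 : 0 < s by rewrite sqrtr_gt0.
have t0 : 0 < t by rewrite sqrtr_gt0.
have st : s <= t by rewrite ler_sqrt // ler_nat.
have s2 : s ^+ 2 = N.+1%:R by rewrite sqr_sqrtr.
have t2 : t ^+ 2 = s ^+ 2 + 1 by rewrite sqr_sqrtr // s2 natr1.
have -> : N.+2%:R = t ^+ 2 by rewrite sqr_sqrtr.
have -> : (t ^+ 2 * t)^-1 = 3 - 2 / t - (3 - 2 / s) - (2 * (t - s) * t ^+ 2 - s) / (s * t ^+ 3).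
  field; by rewrite !gt_eqF.
suff : 0 <= (2 * (t - s) * t ^+ 2 - s) / (s * t ^+ 3) by lra.
apply: divr_ge0; last by rewrite mulr_ge0 ?exprn_ge0 ?ltW.
have ts : (t - s) * (t + s) = 1 by rewrite -subr_sqr t2; ring.
have h : 0 <= (t - s) * (t - s) by rewrite mulr_ge0 ?subr_ge0.
have h2 : 0 <= t * s by rewrite mulr_ge0 ?ltW.
have d0 : 0 <= t - s by rewrite subr_ge0.
have -> : 2 * (t - s) * t ^+ 2 - s = (t - s) * (2 * t ^+ 2) - s * ((t - s) * (t + s)) by rewrite ts; ring.
have -> : (t - s) * (2 * t ^+ 2) - s * ((t - s) * (t + s)) = (t - s) * ((t ^+ 2 - s ^+ 2) + t * (t - s)) by ring.
rewrite mulr_ge0 // addr_ge0 // ?mulr_ge0 ?(ltW t0) //.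
by rewrite t2; lra.
Qed.

Lemma majorant_seq (B : seq nat) : uniq B -> \sum_(n <- B) majorant n <= 3.
Proof.
move=> uB; pose N := \max_(n <- B) n.
have sB : {subset B <= index_iota 0 N.+1}.
  by move=> n nB; rewrite mem_index_iota ltnS; apply: (@leq_bigmax_seq _ _ xpredT id).
apply: le_trans (ler_sum_subset uB (iota_uniq _ _) sB majorant_ge0) _.
apply: le_trans (majorant_sum N) _; rewrite gerBl divr_ge0 ?sqrtr_ge0 //.
Qed.

Lemma asum_majorant : asum (fun n : int => (majorant `|n|)%:C : R[i]).
Proof.
exists ((3 + 3)%:C) => B uB.
have -> : \sum_(i <- B) `|(majorant `|i|)%:C : R[i]| = (\sum_(i <- B) majorant `|i|)%:C.
  rewrite rmorph_sum; apply: eq_bigr => i _.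
  by rewrite normc_real ger0_norm ?majorant_ge0.
rewrite lecR (bigID (fun i : int => 0 <= i)) /=; apply: lerD.
  rewrite -big_filter -(big_map absz xpredT majorant); apply: majorant_seq.
  rewrite map_inj_in_uniq ?filter_uniq // => i j.
  by rewrite !mem_filter => /andP[i0 _] /andP[j0 _]; lia.
rewrite -big_filter -(big_map absz xpredT majorant); apply: majorant_seq.
rewrite map_inj_in_uniq ?filter_uniq // => i j.
by rewrite !mem_filter => /andP[i0 _] /andP[j0 _]; lia.
Qed.

End Majorant.

(** * Euler's relations on a lattice of rank one *)

Section Euler.
Variables (R : realType) (I : zmodType) (omega : {additive I -> R[i]}).
Notation C := R[i].
Hypothesis omega_inj : forall x, omega x = 0 -> x = 0.
Hypothesis iv_le1 : forall x, `|recip omega x| <= 1.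
Hypothesis asum2 : asum (fun x => recip omega x ^+ 2).
Notation iv := (recip omega).

Lemma cot_decay x y : `|iv x * (iv (x - y) + iv y)| <= `|iv (x - y)| ^+ 2 + `|iv y| ^+ 2.
Proof.
have [->|x0] := eqVneq x 0; first by rewrite recip0 mul0r normr0 addr_ge0 ?exprn_ge0.
have [->|y0] := eqVneq y 0; first by rewrite subr0 recip0 addr0 -expr2 normrX normr0 expr0n addr0.
have [->|xy] := eqVneq x y; first by rewrite subrr recip0 add0r -expr2 normrX normr0 expr0n add0r.
have e := recip_sub omega_inj x0 y0 xy.
have -> : iv x * (iv (x - y) + iv y) = iv (x - y) * iv y by rewrite mulrDr -e; ring.
rewrite normrM -subr_ge0; set p := `|_|; set q := `|_|.
have pq : p * q = `|iv (x - y) * iv y| by rewrite normrM.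
have -> : p ^+ 2 + q ^+ 2 - p * q = (p - q) ^+ 2 + p * q by ring.
apply: addr_ge0; last by rewrite /p /q mulr_ge0.
by rewrite /p /q real_exprn_even_ge0 // rpredB ?normr_real.
Qed.

Lemma asum_cot x : x != 0 -> asum (fun y => iv (x - y) + iv y).
Proof.
move=> x0; have ox := omega_neq0 omega_inj x0.
have av : asum (fun y => `|iv (x - y) ^+ 2| + `|iv y ^+ 2|).
  apply: asumD => //; apply: (@asum_comp _ _ _ (fun y => x - y) (fun y => iv y ^+ 2)) => //.
  exact: can_inj (@subK_inv _ x).
apply: asum_dom (asumZ (omega x) av) => y.
rewrite (normrM (omega x)) [X in _ <= _ * X]ger0_norm ?addr_ge0 // !normrX.
have := cot_decay x y; move: (_ + iv y) (`|_| ^+ 2 + _) => W D; rewrite (normrM (iv x)) => h.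
have e : `|omega x| * `|iv x| = 1 by rewrite -normrM mulfV // normr1.
by rewrite -[leLHS]mul1r -e -mulrA ler_wpM2l.
Qed.

Section Cotangent.
Hypothesis cot_sum : forall x, hassum (fun y => iv (x - y) + iv y) 0.

Definition cot_kern n (z : I * I) : C := - iv z.1 ^+ n.+3 * (iv (z.1 - z.2) + iv z.2).

Lemma hassum_cot_kern n : hassum (cot_kern n) 0.
Proof.
have a1 : asum (fun x => iv x ^+ n.+2) by apply: asum_recip_ge asum2.
apply: hassum_double0 => [|x]; last first.
  by have := hassumZ (- iv x ^+ n.+3) (cot_sum x); rewrite mulr0.
pose v (z : I * I) := `|iv z.1 ^+ n.+2 * iv (z.1 - z.2) ^+ 2| + `|iv z.1 ^+ n.+2 * iv z.2 ^+ 2|.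
have av : asum v by apply: asumD; [exact: asum_pairs a1 asum2 | exact: asumM a1 asum2].
apply: asum_dom av => -[x y]; rewrite /cot_kern /v /=.
have dec := cot_decay x y; rewrite -!normrX in dec.
rewrite mulNr normrN exprSr -mulrA.
move: (iv x ^+ n.+2) (_ * (_ + _)) (iv (x - y) ^+ 2) (iv y ^+ 2) dec => A W B D dec.
by rewrite [leRHS]ger0_norm ?addr_ge0 // !normrM -mulrDr ler_wpM2l.
Qed.

(** [J] stands for the sum of the [u ^ p * v ^ (n + 4 - p)] with [p] from 2 to [n + 2], that is
    [u ^ 2 v ^ 2] times a geometric sum. The exponent 2 is now admissible because inverse squares
    are summable in rank one. *)
Lemma cot_kernE n x y (J : C -> C -> C) :
  (forall u v d, d * (v - u) = u * v ->
     J u v = - u ^+ n.+3 * (d + v) + - v ^+ n.+3 * (- d + u)) ->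
  (forall u, J u 0 = 0) -> (forall u, J 0 u = 0) -> (forall u, J u u = n.+1%:R * u ^+ n.+4) ->
  J (iv x) (iv y) = cot_kern n (x, y) + cot_kern n (y, x)
    + n.+3%:R * ((x == y)%:R * iv x ^+ n.+4)
    + (y == 0)%:R * iv x ^+ n.+4 + (x == 0)%:R * iv y ^+ n.+4.
Proof.
move=> hJ J0 J0' Jd; rewrite /cot_kern /=.
have f0 : false%:R = 0 :> C by [].
have [->|x0] := eqVneq x 0.
  rewrite recip0 sub0r recipN subr0 J0' !expr0n /= [0 == y]eq_sym.
  case: eqP => [->|_]; rewrite ?recip0 ?expr0n /= ?exprS ?f0; ring.
have [->|y0] := eqVneq y 0.
  by rewrite recip0 sub0r recipN subr0 J0 !expr0n /= ?(negbTE x0) !exprS ?f0; ring.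
have [<-|xy] := eqVneq x y.
  by rewrite Jd subrr recip0 -[n.+3%:R]natr1 -[n.+2%:R]natr1 !exprS ?f0 /=; ring.
have h := recip_sub omega_inj x0 y0 xy.
have -> : iv (y - x) = - iv (x - y) by rewrite -recipN opprB.
by rewrite (hJ _ _ _ h) f0; ring.
Qed.

Lemma hassum_cotE n g (J : C -> C -> C) : hassum (fun x => iv x ^+ n.+4) g ->
  (forall u v d, d * (v - u) = u * v ->
     J u v = - u ^+ n.+3 * (d + v) + - v ^+ n.+3 * (- d + u)) ->
  (forall u, J u 0 = 0) -> (forall u, J 0 u = 0) -> (forall u, J u u = n.+1%:R * u ^+ n.+4) ->
  hassum (fun z : I * I => J (iv z.1) (iv z.2)) (n.+4.+1%:R * g).
Proof.
move=> hN h1 h2 h3 h4; have hk := hassum_cot_kern n.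
have k2 := hassumD hk (hassum_swap hk).
have k3 := hassumD k2 (hassumZ n.+3%:R (hassum_diag hN)).
have k4 := hassumD k3 (hassum_axis hN).
have k5 := hassumD k4 (hassum_swap (hassum_axis hN)).
have -> : n.+4.+1%:R * g = 0 + 0 + n.+3%:R * g + g + g by rewrite -[n.+4.+1%:R]natr1 -natr1; ring.
apply: eq_hassum k5 => -[x y] /=; by rewrite (cot_kernE x y h1 h2 h3 h4).
Qed.

Variable g : nat -> C.
Hypothesis hg : forall q, (1 < q)%N -> hassum (fun x => iv x ^+ q) (g q).

(** For the integers [g q] is [2 zeta(q)] at even [q], and this is Euler's
    [zeta(2)^2 = 5/2 zeta(4)]; the next relation is [zeta(2) zeta(4) = 7/4 zeta(6)]. *)
Lemma euler4 : g 2 ^+ 2 = 5%:R * g 4.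
Proof.
have a2 := asum2.
have h2g := hg (isT : (1 < 2)%N); have h4g := hg (isT : (1 < 4)%N).
have h1 := hassumM a2 a2 h2g h2g.
have h2 := @hassum_cotE 0 (g 4) (fun u v => u ^+ 2 * v ^+ 2) h4g.
rewrite expr2; apply: hassum_unique h1 (h2 _ _ _ _).
- move=> u v d e; transitivity ((d * (v - u)) * (u * v)); first by rewrite e; ring.
  transitivity (d * (v - u) * (v ^+ 2 + u * v + u ^+ 2) - (u * v) * (u ^+ 2 + v ^+ 2)); last by ring.
  rewrite e; ring.
- by move=> u; rewrite expr0n mulr0.
- by move=> u; rewrite expr0n mul0r.
- by move=> u; ring.
Qed.

Lemma euler6 : 2 * (g 2 * g 4) = 7%:R * g 6.
Proof.
have a2 := asum2.
have h2g := hg (isT : (1 < 2)%N); have h4g := hg (isT : (1 < 4)%N).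
have a3 : asum (fun x => iv x ^+ 3) by apply: asum_recip_ge a2.
have a4 : asum (fun x => iv x ^+ 4) by apply: asum_recip_ge a2.
have h3g := hg (isT : (1 < 3)%N); have h6g := hg (isT : (1 < 6)%N).
have g3 : g 3 = 0 by apply: hassum_unique h3g _; apply: hassum_recip_odd.
have h24 := hassumM a2 a4 h2g h4g.
have h42 := hassumM a4 a2 h4g h2g.
have h33 := hassumM a3 a3 h3g h3g.
have h1 := hassumD (hassumD h24 h42) h33.
have h2 := @hassum_cotE 2 (g 6) (fun u v => u ^+ 2 * v ^+ 4 + u ^+ 4 * v ^+ 2 + u ^+ 3 * v ^+ 3) h6g.
have -> : 2 * (g 2 * g 4) = g 2 * g 4 + g 4 * g 2 + g 3 * g 3 by rewrite g3; ring.
apply: hassum_unique h1 (h2 _ _ _ _).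
- move=> u v d e.
  transitivity (d * (v - u) * (v ^+ 4 + u * v ^+ 3 + u ^+ 2 * v ^+ 2 + u ^+ 3 * v + u ^+ 4)
    - (u * v) * (u ^+ 4 + v ^+ 4)); last by ring.
  rewrite e; ring.
- by move=> u; rewrite !expr0n /=; ring.
- by move=> u; rewrite !expr0n /=; ring.
- by move=> u; ring.
Qed.

End Cotangent.
End Euler.

(** * The lattice of integers *)

Section Integers.
Variable R : realType.
Notation C := R[i].

Definition intC : {additive int -> C} := *~%R 1.

Lemma intC_inj x : intC x = 0 -> x = 0.
Proof. by move/eqP; rewrite intr_eq0 => /eqP. Qed.

Notation iv := (recip intC).

Lemma norm_recip_int (n : int) : `|iv n| = `|n|%N%:R^-1.
Proof.
rewrite /iv normfV; congr _^-1; rewrite /intC /= -intr_norm.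
by rewrite -[`|n|%N%:R]/((`|n|%N : int)%:~R) abszE.
Qed.

Lemma recip_int_le1 n : `|iv n| <= 1.
Proof.
rewrite norm_recip_int; have [->|n0] := posnP `|n|%N; first by rewrite invr0.
by rewrite invf_le1 ?ltr0n // ler1n.
Qed.

Lemma asum_recip_int2 : asum (fun n => iv n ^+ 2).
Proof.
apply: asum_dom (asumZ 4 (asum_majorant R)) => n.
rewrite normrX norm_recip_int normrM normr_nat normc_real (ger0_norm (majorant_ge0 R _)).
set k := `|n|%N.
have -> : (k%:R^-1 ^+ 2 : C) = (k%:R^-1 ^+ 2)%:C by rewrite rmorphXn /= fmorphV rmorph_nat.
have -> : 4 * (majorant R k)%:C = (4 * majorant R k)%:C by rewrite rmorphM rmorph_nat.
rewrite lecR.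
have m0 := majorant_ge0 R k; have ms := majorant_sqr R k.
have [->|k0] := posnP k; first by rewrite invr0 expr0n mulr_ge0 ?majorant_ge0.
rewrite -(@ler_pXn2r _ 2) ?nnegrE ?mulr_ge0 ?exprn_ge0 ?invr_ge0 ?mulr_ge0 ?sqrtr_ge0 //.
rewrite [leRHS]exprMn ms -exprM exprVn ler_pdivlMr ?exprn_gt0 ?ltr0n // mulrC ler_pdivrMr ?exprn_gt0 ?ltr0n //.
rewrite -!natrX -natrM ler_nat.
apply: (@leq_trans ((2 * k) ^ 3)); first by rewrite leq_exp2r //; lia.
by rewrite expnMn (expnS k 3); have := expn_gt0 k 3; rewrite k0 /=; nia.
Qed.

Lemma inv_succ_small (e : C) : 0 < e -> exists N0 : nat, forall N, (N0 <= N)%N -> N.+1%:R^-1 < e.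
Proof.
move=> /gt0_complexP[x x0 ->]; exists (Num.bound x^-1) => N hN.
have -> : (N.+1%:R^-1 : C) = (N.+1%:R^-1)%:C by rewrite fmorphV rmorph_nat.
rewrite ltcR -[x]invrK ltf_pV2 ?posrE ?invr_gt0 //.
have h := archi_boundP (ltW (_ : 0 < x^-1)); rewrite invr_gt0 in h.
apply: lt_le_trans (h x0) _; by rewrite ler_nat; lia.
Qed.

(** The limit exists by absolute summability, so symmetric intervals suffice to find it: over
    [-N .. N] the sum telescopes to [1 / N + 1 / (N + 1)]. *)
Lemma cot_sum1 : hassum (fun y => iv (1 - y) + iv y) 0.
Proof.
have a := asum_cot intC_inj asum_recip_int2 (isT : (1 : int) != 0).
have [l h] := asum_hassum a; suff l0 : l = 0 by rewrite -l0.
apply/eqP; rewrite -normr_eq0; apply/negPn/negP => nz.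
have e0 : 0 < `|l| / 4 by rewrite divr_gt0 // lt_def nz normr_ge0.
have [A hA] := h _ e0; have [N0 hN0] := inv_succ_small e0.
pose N := (maxn N0 (\max_(a <- A) `|a|)).+1.
pose F (i : nat) : C := iv (i%:Z - 1 - N%:Z).
pose B := [seq (i%:Z - N%:Z) | i <- iota 0 (2 * N).+1].
have uB : uniq B by rewrite map_inj_uniq ?iota_uniq // => i j; lia.
have sB (x : int) : x \in A -> x \in B.
  move=> xA; have : (`|x| <= N)%N.
    apply: leqW; apply: leq_trans (leq_maxr _ _).
    exact: (@leq_bigmax_seq _ A xpredT absz).
  move=> xN; apply/mapP; exists (absz (x + N%:Z)%R); last by lia.
  by rewrite mem_iota; lia.
have hB := hA B uB sB.
have sumB : \sum_(y <- B) (iv (1 - y) + iv y) = N%:R^-1 + N.+1%:R^-1.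
  rewrite big_map -[iota _ _]/(index_iota 0 (2 * N).+1).
  rewrite (@eq_bigr _ _ _ _ _ _ _ (fun i => F i.+1 - F i)); last first.
    move=> i _; rewrite /F [RHS]addrC -recipN; congr (iv _ + iv _); lia.
  rewrite telescope_sumr // /F.
  have -> : (2 * N).+1%:Z - 1 - N%:Z = N%:Z by lia.
  have -> : 0%:Z - 1 - N%:Z = - (N.+1%:Z) by lia.
  by rewrite recipN opprK.
rewrite sumB in hB.
have h1 : N%:R^-1 < `|l| / 4 by apply: hN0; apply: leq_maxl.
have h2 : N.+1%:R^-1 < `|l| / 4 by apply: hN0; apply: leqW; apply: leq_maxl.
have : `|l| < `|l| / 4 + (`|l| / 4 + `|l| / 4).
  rewrite -{1}[l](subrK (N%:R^-1 + N.+1%:R^-1)).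
  apply: le_lt_trans (ler_normD _ _) _; apply: ltrD; first by rewrite distrC.
  by rewrite ger0_norm ?addr_ge0 ?invr_ge0 // ltrD.
have -> : `|l| / 4 + (`|l| / 4 + `|l| / 4) = `|l| - `|l| / 4 by field.
by rewrite ltrBrDr gtrDl lt_gtF.
Qed.

Lemma cot_sum x : hassum (fun y => iv (x - y) + iv y) 0.
Proof.
have step z : hassum (fun y => iv (z - y) + iv y) 0 ->
    hassum (fun y => iv (z + 1 - y) + iv y) 0.
  move=> hz; have hz' : hassum (fun y => iv (z - (y - 1)) + iv (y - 1)) 0.
    apply: (@hassum_bij _ _ (fun y => y + 1) (fun y => y - 1)).
    - by move=> y; rewrite addrK.
    - by move=> y; rewrite subrK.
    - by apply: eq_hassum hz => y /=; rewrite addrK.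
  have := hassumD hz' cot_sum1; rewrite addr0; apply: eq_hassum => y.
  by rewrite (opprB y 1) [z + (1 - y)]addrA -[y - 1](opprB 1 y) recipN addrA subrK.
have nn n : hassum (fun y => iv (n%:Z - y) + iv y) 0.
  elim: n => [|n IH].
    by apply: eq_hassum (@hassum0 _ _) => y; rewrite sub0r recipN addNr.
  by rewrite (_ : n.+1%:Z = n%:Z + 1); [exact: step | lia].
case: x => n; first exact: nn.
have := hassumN (nn n.+1); rewrite oppr0 => h.
apply: (@hassum_bij _ _ -%R -%R); [exact: opprK | exact: opprK |].
by apply: eq_hassum h => y /=; rewrite NegzE opprK opprD -!recipN opprB [- _ + y]addrC.
Qed.

End Integers.

Section IntegerSums.
Variable R : realType.
Notation C := R[i].

Lemma asum_nat_inv q : (1 < q)%N -> asum (fun n : nat => (n.+1%:R^-1 : C) ^+ q).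
Proof.
move=> q1.
have a : asum (fun n : int => recip (intC R) n ^+ q).
  by apply: asum_recip_ge (asum_recip_int2 R) => //; exact: recip_int_le1.
have inj : injective (fun n : nat => n.+1%:Z) by move=> m n; lia.
exact: (asum_comp inj a).
Qed.

Lemma hassum_bool : hassum (fun _ : bool => 1 : C) 2.
Proof.
move=> e e0; exists [:: true; false] => B uB sB.
rewrite (perm_big [:: true; false]) /=; last first.
  by apply: uniq_perm => // -[]; rewrite sB ?inE.
by rewrite big_cons big_seq1 subrr normr0.
Qed.

Lemma asum_bool : asum (fun _ : bool => 1 : C).
Proof.
exists 2 => B uB; apply: le_trans (ler_sum_subset uB (isT : uniq [:: true; false]) _ _) _.
- by case.
- by move=> i; rewrite normr1.
- by rewrite big_cons big_seq1 normr1.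
Qed.

Lemma hassum_int_even q t : ~~ odd q -> (1 < q)%N ->
  hassum (fun n : nat => (n.+1%:R^-1 : C) ^+ q) t ->
  hassum (fun n => recip (intC R) n ^+ q) (t * 2).
Proof.
move=> oq q1 h.
have h1 := hassumM (asum_nat_inv q1) asum_bool h hassum_bool.
pose phi (z : nat * bool) : int := if z.2 then z.1.+1%:Z else - z.1.+1%:Z.
apply: (@hassum_reindex _ _ _ phi).
- by move=> [m [|]] [n [|]]; rewrite /phi /= => e; congr (_, _); lia.
- move=> n hn; have -> : n = 0; last by rewrite recip0 expr0n; case: q q1 {oq h h1}.
  case: n hn => [[|n]|n] hn //; first by case: (hn (n, true)).
  by case: (hn (n, false)).
apply: eq_hassum h1 => -[n b] /=; rewrite mulr1 /phi /=; case: b => //.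
by rewrite recipN exprNn -signr_odd (negbTE oq) expr0 mul1r.
Qed.

Lemma hassum_int_neq0 q l : ~~ odd q -> (0 < q)%N ->
  hassum (fun n => recip (intC R) n ^+ q) l -> l != 0.
Proof.
move=> oq q0 h; apply/negP => /eqP l0; rewrite l0 in h.
have [A hA] := h 1 ltr01.
pose B := undup (1 :: A).
have := hA B (undup_uniq _).
have sB : {subset A <= B} by move=> x xA; rewrite mem_undup inE xA orbT.
move=> /(_ sB); rewrite subr0.
have B1 : 1 \in B by rewrite mem_undup inE eqxx.
rewrite (bigD1_seq 1) ?undup_uniq //= /recip /= invr1 expr1n.
set S := \sum_(_ <- _ | _) _.
have S0 : 0 <= S.
  by apply: sumr_ge0 => n _; rewrite real_exprn_even_ge0 // rpredV realz.
by rewrite ger0_norm ?addr_ge0 // gtrDl le_gtF.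
Qed.

End IntegerSums.

(** * The lattice of rank two *)

Section Lattice.
Variable R : realType.
Notation C := R[i].
Variable y : R.
Hypothesis y1 : 1 < y.

Definition lattice_map (p : int * int) : C := p.1%:~R * (0 +i* y) + p.2%:~R.

Lemma lattice_map_is_additive : {morph lattice_map : p q / p - q}.
Proof. by move=> p q; rewrite /lattice_map /= !intrB; ring. Qed.
HB.instance Definition _ := GRing.isZmodMorphism.Build (int * int)%type C lattice_map
  lattice_map_is_additive.

Definition latC : {additive (int * int)%type -> C} := lattice_map.

Definition lat_norm (p : int * int) : R := (p.1%:~R * y) ^+ 2 + p.2%:~R ^+ 2.

Lemma lattice_mapE p : lattice_map p = p.2%:~R +i* (p.1%:~R * y).
Proof.
rewrite /lattice_map -!(rmorph_int (real_complex R)) /=.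
by apply/eqP; rewrite eq_complex /=; apply/andP; split; apply/eqP; ring.
Qed.

Lemma lat_norm_ge (p : int * int) : p != 0 -> 1 <= lat_norm p.
Proof.
case: p => a b p0; rewrite /lat_norm /= exprMn.
have [a0|a0] := eqVneq a 0.
  have b0 : b != 0 by apply: contra_neq p0 => ->; rewrite a0.
  rewrite a0 expr0n mul0r add0r -rmorphXn /= -[1]/(1%:~R) ler_int; nia.
have h : 1 <= a%:~R ^+ 2 :> R by rewrite -rmorphXn /= -[1]/(1%:~R) ler_int; nia.
have hy : 1 <= y ^+ 2 by rewrite expr_ge1 // ltW // ?(lt_trans ltr01).
apply: (@le_trans _ _ (a%:~R ^+ 2 * y ^+ 2)); last by rewrite lerDl sqr_ge0.
by have := ler_pM ler01 ler01 h hy; rewrite mulr1.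
Qed.

Lemma norm_lat (p : int * int) : `|latC p| = (Num.sqrt (lat_norm p))%:C.
Proof. by rewrite /= lattice_mapE normc_def /= addrC. Qed.

Lemma latC_inj p : latC p = 0 -> p = 0.
Proof.
move=> h; apply/eqP; apply/negPn/negP => p0; have := lat_norm_ge p0.
have /eqP := norm_lat p; rewrite h normr0 eq_sym -(rmorph0 (real_complex R)) (inj_eq (@complexI R)).
by rewrite sqrtr_eq0 => h0 h1; have := le_trans h1 h0; rewrite ler10.
Qed.

Notation iv := (recip latC).

Lemma norm_recip_lat p : `|iv p| = (Num.sqrt (lat_norm p))^-1%:C.
Proof. by rewrite /recip normfV norm_lat fmorphV. Qed.

Lemma recip_lat_le1 p : `|iv p| <= 1.
Proof.
rewrite norm_recip_lat -(rmorph1 (real_complex R)) lecR.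
have [->|p0] := eqVneq p 0.
  by rewrite /lat_norm /= mul0r expr0n addr0 sqrtr0 invr0.
have h := lat_norm_ge p0.
have s1 : 1 <= Num.sqrt (lat_norm p) by rewrite -sqrtr1 ler_wsqrtr.
by rewrite invf_le1 // (lt_le_trans ltr01).
Qed.

Lemma asum_recip_lat3 : asum (fun p => iv p ^+ 3).
Proof.
apply: asum_dom (asumZ 8 (asumM (asum_majorant R) (asum_majorant R))) => -[a b] /=.
rewrite normrX norm_recip_lat normrM (normrM (_%:C)) normr_nat !normc_real !(ger0_norm (majorant_ge0 R _)).
rewrite -[8](rmorph_nat (real_complex R)) -!rmorphM -rmorphXn lecR /=.
set m := majorant R `|a|; set n := majorant R `|b|.
have m0 : 0 <= m := majorant_ge0 R _; have n0 : 0 <= n := majorant_ge0 R _.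
have ms : m ^+ 2 = _ := majorant_sqr R _; have ns : n ^+ 2 = _ := majorant_sqr R _.
have [->|p0] := eqVneq (a, b) 0.
  by rewrite /lat_norm /= mul0r expr0n addr0 sqrtr0 invr0 expr0n mulr_ge0 ?mulr_ge0.
have N1 := lat_norm_ge p0; set N := lat_norm _ in N1 *.
have N0 : 0 < N by rewrite (lt_le_trans ltr01).
have lhs0 : 0 <= (Num.sqrt N)^-1 ^+ 3 by rewrite exprn_ge0 // invr_ge0 sqrtr_ge0.
have rhs0 : 0 <= 8 * (m * n) by rewrite mulr_ge0 // mulr_ge0.
rewrite -(@ler_pXn2r _ 2) ?nnegrE //.
rewrite -exprM mulnC exprM exprVn sqr_sqrtr ?(ltW N0) // [leRHS]exprMn (exprMn 2 m n) ms ns.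
rewrite -invfM -exprMn ler_pdivlMr ?exprn_gt0 ?mulr_gt0 ?ltr0n //.
rewrite -exprMn.
(* The bound, once squared, is a comparison of cubes; taking cube roots leaves
   [(|a| + 1) * (|b| + 1) <= 4 * N]. *)
have -> : 8 ^+ 2 = 4 ^+ 3 :> R by ring.
apply: lerXn2r; rewrite ?nnegrE ?mulr_ge0 ?invr_ge0 ?(ltW N0) //.
rewrite mulrC ler_pdivrMr //.
have ab : `|a|%N.+1%:R * `|b|%N.+1%:R <= 4 * (a%:~R ^+ 2 + b%:~R ^+ 2) :> R.
  have abn : a != 0 \/ b != 0 by apply/orP; rewrite -negb_and; apply: contra p0 => /andP[/eqP -> /eqP ->].
  have : ((`|a|%N.+1 * `|b|%N.+1)%N : int) <= 4 * (a ^+ 2 + b ^+ 2) by nia.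
  by rewrite -(ler_int R) PoszM !intrM !intrD !rmorphXn.
apply: le_trans ab _; rewrite ler_wpM2l // lerD2r exprMn ler_peMr ?sqr_ge0 //.
by rewrite expr_ge1 // ltW // (lt_trans ltr01).
Qed.

End Lattice.

(** * Eisenstein series on the imaginary axis *)

Definition primitive := {p : int * int | coprimez p.1 p.2}.

(** Each nonzero pair is in a unique way a positive multiple of a coprime one, so a lattice sum
    factors as [zeta(q)] times the sum over coprime pairs. *)
Definition multiple (z : nat * primitive) : int * int := val z.2 *+ z.1.+1.

Lemma multipleE n (t : primitive) :
  multiple (n, t) = (n.+1%:Z * (val t).1, n.+1%:Z * (val t).2).
Proof.
rewrite /multiple /=; case: (val t) => a b /=.
have -> : (a, b) *+ n.+1 = (a *+ n.+1, b *+ n.+1).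
  elim: n => [|n IH] //; by rewrite mulrS IH !mulrS.
by rewrite -(mulr_natl a) -(mulr_natl b) natz.
Qed.

Lemma multiple_inj : injective multiple.
Proof.
move=> [m [[a b] /= hs]] [n [[c d] /= ht]]; rewrite !multipleE /= => -[e1 e2].
have gm : gcdz (m.+1%:Z * a) (m.+1%:Z * b) = m.+1 by rewrite -mulz_gcdr (eqP hs) mulr1.
have gn : gcdz (n.+1%:Z * c) (n.+1%:Z * d) = n.+1 by rewrite -mulz_gcdr (eqP ht) mulr1.
have [mn] : Posz m.+1 = n.+1 by rewrite -gm -gn e1 e2.
subst n; congr (_, _); apply: val_inj => /=.
by congr (_, _); [apply: (@mulfI _ m.+1%:Z) e1 | apply: (@mulfI _ m.+1%:Z) e2].
Qed.

Lemma multiple_surj (p : int * int) : p != 0 -> exists z, multiple z = p.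
Proof.
case: p => a b p0.
have g0 : gcdz a b != 0.
  rewrite gcdz_eq0; apply: contra p0 => /andP[/eqP -> /eqP ->] //.
have gpos : 0 < gcdz a b by rewrite lt_def g0.
have cop : coprimez (a %/ gcdz a b)%Z (b %/ gcdz a b)%Z.
  apply/eqP; apply: (@mulfI _ (gcdz a b)) => //; rewrite mulr1.
  have := mulz_gcdr (gcdz a b) (a %/ gcdz a b)%Z (b %/ gcdz a b)%Z.
  rewrite ![gcdz a b * (_ %/ _)%Z]mulrC !divzK ?dvdz_gcdl ?dvdz_gcdr // => ->.
exists ((absz (gcdz a b)).-1, exist _ (_, _) cop).
rewrite multipleE prednK ?absz_gt0 // gez0_abs ?(ltW gpos) //=.
by rewrite ![gcdz a b * (_ %/ _)%Z]mulrC !divzK ?dvdz_gcdl ?dvdz_gcdr.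
Qed.

Section Eisenstein.
Variable R : realType.
Notation C := R[i].
Variable y : R.
Hypothesis y1 : 1 < y.
Notation iv := (recip (latC y)).
Notation z := (0 +i* y).

Lemma recip_multiple n t : iv (multiple (n, t)) = n.+1%:R^-1 * iv (val t).
Proof. by rewrite /multiple /recip raddfMn -(mulr_natl (latC y (val t))) invfM. Qed.

Lemma asum_recip_lat q : (2 < q)%N -> asum (fun p => iv p ^+ q).
Proof. by move=> q2; apply: asum_recip_ge (asum_recip_lat3 y1) => //; apply: recip_lat_le1. Qed.

Lemma hassum_primitive q : (2 < q)%N -> hassum (fun t : primitive => iv (val t) ^+ q) (2 * eisenstein q z).
Proof.
move=> q2; have a : asum (fun t : primitive => iv (val t) ^+ q).
  exact: (asum_comp val_inj (asum_recip_lat q2)).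
have [l hl] := asum_hassum a.
have hu : hassum (fun p : int * int =>
    if coprimez p.1 p.2 then ((p.1%:~R * z + p.2%:~R) ^+ q)^-1 else 0 : C) l.
  apply: (@hassum_reindex _ _ _ (val : primitive -> int * int)); first exact: val_inj.
    move=> p hp; case: ifP => // cp; by case: (hp (exist _ p cp)).
  by apply: eq_hassum hl => -[p cp] /=; rewrite cp /recip exprVn.
have q0 : (q == 0)%N = false by apply/negbTE; lia.
suff -> : eisenstein q z = 2^-1 * l by rewrite mulVKf ?pnatr_eq0 //; exact: hl.
by rewrite /eisenstein q0 -(hassum_sumE hu).
Qed.

(** Here [t] is [zeta(q)]; it stays abstract, to be cancelled against the sum over the integers. *)
Lemma hassum_lattice q : (2 < q)%N ->
  exists2 t, hassum (fun n : nat => (n.+1%:R^-1 : C) ^+ q) t &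
    hassum (fun p => iv p ^+ q) (t * (2 * eisenstein q z)).
Proof.
move=> q2; have q1 : (1 < q)%N by lia.
have [t ht] := asum_hassum (asum_nat_inv R q1); exists t => //.
have a : asum (fun t : primitive => iv (val t) ^+ q).
  exact: (asum_comp val_inj (asum_recip_lat q2)).
have h := hassumM (asum_nat_inv R q1) a ht (hassum_primitive q2).
apply: (hassum_reindex multiple_inj); last first.
  by apply: eq_hassum h => -[n s] /=; rewrite recip_multiple exprMn.
move=> p hp; have [->|p0] := eqVneq p 0; first by rewrite recip0 expr0n; case: q q2 {q1 ht a h}.
by have [w /hp] := multiple_surj p0.
Qed.

End Eisenstein.

(** * Eisenstein series as quotients of lattice sums *)

Section Normalization.
Variable R : realType.
Notation C := R[i].

(** The parameter value 2 is that of the cusp, where [E_4 = E_6 = 1]. *)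
Definition wp_cusp m : C := (map_poly ratr (wp_poly m)).[2].

Lemma hassum_intq : exists g : nat -> C, forall q, (1 < q)%N -> hassum (fun n => recip (intC R) n ^+ q) (g q).
Proof.
have ex q : exists l, (1 < q)%N -> hassum (fun n => recip (intC R) n ^+ q) l.
  case: (leqP q 1) => q1; first by exists 0.
  have a : asum (fun n => recip (intC R) n ^+ q).
    by apply: asum_recip_ge (asum_recip_int2 R) => //; exact: recip_int_le1.
  by have [l hl] := asum_hassum a; exists l.
by have [g hg] := choice ex; exists g => q; exact: hg.
Qed.

(** Rescaled by the same [l], both lattices solve the recurrence, and their terms of index [m]
    differ by the factor [E_(2m)] because each contains the same [zeta(2m)]. The terms of the
    integer lattice are nonzero since sums of even powers of real numbers are positive. *)
Theorem eisenstein_wp : (forall m, (1 < m)%N -> wp_cusp m != 0) /\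
  forall y : R, 1 < y -> exists2 e : nat -> C,
    wp_rec (- 3 * eisenstein 4 (0 +i* y)) (2 * eisenstein 6 (0 +i* y)) e &
    forall m, (1 < m)%N -> e m = wp_cusp m * eisenstein (2 * m) (0 +i* y).
Proof.
have [g hg] := hassum_intq.
have a2 := asum_recip_int2 R.
have inj := @intC_inj R.
have le1 := recip_int_le1 R.
have cot := @cot_sum R.
have e4 := euler4 inj le1 a2 cot hg.
have e6 := euler6 inj le1 a2 cot hg.
have gnz m : (0 < m)%N -> g (2 * m)%N != 0.
  move=> m0; apply: hassum_int_neq0 (hg _ _); rewrite ?oddM //; lia.
(* Euler's relations: the degenerate lattice [int] has [a = -3 l ^ 2], [b = 2 l ^ 3]. *)
pose l := - g 2.
have l0 : l != 0 by rewrite oppr_eq0 (gnz 1).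
have g4 : - 15%:R * g 4 = l ^+ 2 * - 3.
  transitivity (- 3 * (5%:R * g 4)); first by ring.
  by rewrite -e4 /l; ring.
have g6 : - 35%:R * g 6 = l ^+ 3 * 2.
  transitivity (- 5%:R * (7%:R * g 6)); first by ring.
  rewrite -e6; transitivity (- 2 * g 2 * (5%:R * g 4)); first by ring.
  by rewrite -e4 /l; ring.
have a3 : asum (fun n => recip (intC R) n ^+ 3) by apply: asum_recip_ge a2.
have hint := lattice_wp_rec inj le1 a3 (fun q h => hg q (ltnW h)).
have hcusp := wp_rec_scale l^-1 hint.
rewrite g4 g6 in hcusp.
have lE2 : l^-1 ^+ 2 * (l ^+ 2 * - 3) = - 3 * 1 ^+ 2.
  by rewrite mulrA -exprMn mulVf // !expr1n; ring.
have lE3 : l^-1 ^+ 3 * (l ^+ 3 * 2) = 1 ^+ 3 * 2.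
  by rewrite mulrA -exprMn mulVf // !expr1n; ring.
rewrite lE2 lE3 in hcusp.
have cuspE m : (1 < m)%N -> wp_cusp m = l^-1 ^+ m * ((2 * m - 1)%:R * g (2 * m)%N).
  move=> m1; have := wp_value hcusp m; rewrite expr1n mul1r /wp_cusp => <-.
  by case: m m1 => [|[|m]].
split=> [m m1|y y1].
  rewrite cuspE // mulf_neq0 ?expf_neq0 ?invr_eq0 // mulf_neq0 ?gnz ?pnatr_eq0 //; lia.
have ex q : exists t, (2 < q)%N ->
    hassum (fun n : nat => (n.+1%:R^-1 : C) ^+ q) t /\
    hassum (fun p => recip (latC y) p ^+ q) (t * (2 * eisenstein q (0 +i* y))).
  case: (leqP q 2) => q2; first by exists 0.
  by have [t h1 h2] := hassum_lattice y1 q2; exists t.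
have [t ht] := choice ex.
have htg m : (1 < m)%N -> g (2 * m)%N = t (2 * m)%N * 2.
  move=> m1; apply: hassum_unique (hg _ _) (hassum_int_even _ _ _); rewrite ?oddM //; try lia.
  by apply: (ht _ _).1; lia.
pose G q := t q * (2 * eisenstein q (0 +i* y)).
have hG q : (2 < q)%N -> hassum (fun p => recip (latC y) p ^+ q) (G q) by move=> q2; apply: (ht _ q2).2.
have hlat := lattice_wp_rec (latC_inj y1) (recip_lat_le1 y1) (asum_recip_lat3 y1) hG.
have GE m : (1 < m)%N -> G (2 * m)%N = g (2 * m)%N * eisenstein (2 * m) (0 +i* y).
  by move=> m1; rewrite /G htg // mulrA.
have G4 : G 4 = g 4 * eisenstein 4 (0 +i* y) by exact: (GE 2).
have G6 : G 6 = g 6 * eisenstein 6 (0 +i* y) by exact: (GE 3).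
rewrite G4 G6 (mulrA (- 15%:R)) (mulrA (- 35%:R)) g4 g6 in hlat.
have h := wp_rec_scale l^-1 hlat.
exists (fun m => l^-1 ^+ m * match m with 0 => 1 | 1 => 0 | _ => (2 * m - 1)%:R * G (2 * m)%N end).
  by move: h; rewrite (mulrA (l^-1 ^+ 2)) (mulrA (l^-1 ^+ 3)) lE2 lE3 !expr1n mulr1 mul1r.
move=> m m1; rewrite cuspE // -!mulrA -GE //.
by case: m m1 => [|[|m]].
Qed.

End Normalization.

(** * Geometric decay and limits of powers *)

Section Geometric.
Variable R : realType.

Lemma bernoulli_ineq (h : R) n : 0 <= h -> 1 + n%:R * h <= (1 + h) ^+ n.
Proof.
move=> h0; elim: n => [|n IH]; first by rewrite mul0r addr0 expr0.
rewrite exprS -natr1.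
apply: le_trans (ler_wpM2l _ IH); last by rewrite addr_ge0.
have : 0 <= n%:R * h * h by rewrite !mulr_ge0.
lra.
Qed.

Lemma geometric_small (q c e : R) : 0 <= q -> q < 1 -> 0 < e ->
  exists D0 : nat, forall D, (D0 <= D)%N -> c * q ^+ D < e.
Proof.
move=> q0 q1 e0; have [q00|qn0] := eqVneq q 0.
  by exists 1%N => -[|D] // _; rewrite q00 expr0n mulr0.
have qp : 0 < q by rewrite lt_def qn0.
pose h := q^-1 - 1; have h0 : 0 < h by rewrite subr_gt0 invf_gt1.
exists (Num.bound (`|c| / (e * h))) => D hD.
have b := archi_boundP (_ : 0 <= `|c| / (e * h)).
have c1 : `|c| / (e * h) < D%:R.
  by apply: lt_le_trans (b _) _; rewrite ?ler_nat // divr_ge0 // ltW // mulr_gt0.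
rewrite ltr_pdivrMr ?mulr_gt0 // in c1.
have c2 : `|c| < e * (1 + h) ^+ D.
  apply: lt_le_trans c1 _; rewrite mulrCA ler_wpM2l ?(ltW e0) //.
  apply: le_trans (bernoulli_ineq D (ltW h0)); lra.
have hq : 1 + h = q^-1 by rewrite /h addrC subrK.
rewrite hq exprVn ltr_pdivlMr ?exprn_gt0 // in c2.
by apply: le_lt_trans c2; rewrite ler_wpM2r ?exprn_ge0 // ler_norm.
Qed.

Notation normc := (@Normc.normc R).
Notation C := R[i].

Lemma normcE (w : C) : `|w| = (normc w)%:C. Proof. by []. Qed.

Lemma normc_ge0 (w : C) : 0 <= normc w.
Proof. by rewrite -ler0c -normcE. Qed.

Lemma normc_distrC (a b : C) : normc (a - b) = normc (b - a).
Proof. by apply: (@complexI R); rewrite -!normcE distrC. Qed.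

Lemma normc_real_ge0 (x : R) : 0 <= x -> normc x%:C = x.
Proof. by move=> x0; apply: (@complexI R); rewrite -normcE normc_real ger0_norm. Qed.

(** Consecutive powers differ by [M ^ D * (M - 1)], whose first factor is close to 1 in norm, while
    the difference tends to 0. *)
Lemma power_limit_1 (M : C) :
  (forall e : R, 0 < e -> exists D0 : nat, forall D, (D0 <= D)%N -> normc (M ^+ D - 1) < e) -> M = 1.
Proof.
move=> h; apply/eqP; rewrite -subr_eq0; apply/negPn/negP => nz.
pose d := normc (M - 1).
have d0 : 0 < d by rewrite -ltcR -normcE normr_gt0.
pose e := Num.min (2^-1) (d / 8).
have e0 : 0 < e by rewrite lt_min invr_gt0 ltr0n /= divr_gt0.
have e1 : e <= 2^-1 by rewrite ge_min lexx.
have e2 : e <= d / 8 by rewrite ge_min lexx orbT.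
have [D0 hD] := h e e0.
have h1 := hD D0 (leqnn _); have h2 := hD D0.+1 (leqnSn _).
have n1 : normc (M ^+ D0) * d <= normc (M ^+ D0.+1 - 1) + normc (M ^+ D0 - 1).
  rewrite -Normc.normcM [normc (M ^+ D0 - 1)]normc_distrC.
  apply: le_trans (le_normcD _ _).
  by rewrite addrA subrK mulrBr mulr1 exprSr.
have n2 : 1 <= normc (M ^+ D0) + normc (M ^+ D0 - 1).
  rewrite [normc (M ^+ D0 - 1)]normc_distrC -(@Normc.normc1 R).
  by apply: le_trans (le_normcD _ _); rewrite addrC subrK.
nra.
Qed.

End Geometric.

(** * Behaviour of [E_(12 D)] on the ray as [D] grows *)

Section Ray.
Variable R : realType.
Notation C := R[i].
Notation normc := (@Normc.normc R).

Section Asymptotics.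
Variable y : R.
Hypothesis y1 : 1 < y.
Notation iv := (recip (latC y)).
Notation z := (0 +i* y).

Definition prim (a b : int) (h : coprimez a b) : primitive := exist _ (a, b) h.
Definition prim_axes : seq primitive :=
  [:: @prim 0 1 isT; @prim 0 (- 1) isT; @prim 1 0 isT; @prim (- 1) 0 isT].

Lemma prim_axesP (t : primitive) : t \notin prim_axes -> (val t).1 != 0 /\ (val t).2 != 0.
Proof.
case: t => -[a b] /= h; rewrite !inE -!val_eqE /= => /norP[n1 /norP[n2 /norP[n3 n4]]].
split; apply/negP => /eqP e; move: h n1 n2 n3 n4; rewrite e /coprimez ?gcd0z ?gcdz0;
  rewrite -![(_, _) == _]/(_ && _) /=; lia.
Qed.

Lemma recip_lat_axes D : (0 < D)%N ->
  \sum_(t <- prim_axes) iv (val t) ^+ (12 * D) = 2 * (1 + ((y ^+ 2)^-1 ^+ (6 * D))%:C).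
Proof.
move=> D0; rewrite !big_cons big_nil /= /recip /= /lattice_map /=.
rewrite !mul0r !mul1r !add0r !addr0 mulN1r !invrN.
have -> : (12 * D = 2 * (6 * D))%N by lia.
rewrite !(exprM _ 2) sqrrN invr1 !expr1n sqrrN.
have -> : (0 +i* y)^-1 ^+ 2 = - ((y ^+ 2)^-1)%:C.
  rewrite exprVn; have -> : (0 +i* y) ^+ 2 = - (y ^+ 2)%:C.
    by apply/eqP; rewrite eq_complex /=; apply/andP; split; apply/eqP; ring.
  by rewrite invrN fmorphV.
have -> : (- ((y ^+ 2)^-1)%:C) ^+ (6 * D) = ((y ^+ 2)^-1 ^+ (6 * D))%:C.
  have -> : (6 * D = 2 * (3 * D))%N by lia.
  by rewrite !(exprM _ 2) sqrrN -!rmorphXn.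
by ring.
Qed.

(* The pairs [(0, +-1)] and [(+-1, 0)] contribute the two main terms [1] and [y ^ (-12 D)]. *)
Lemma eisenstein_asymptotic : exists2 M : R, 0 <= M & forall D, (0 < D)%N ->
  normc (eisenstein (12 * D) z - 1 - ((y ^+ 2)^-1 ^+ (6 * D))%:C) <= M * (1 + y ^+ 2)^-1 ^+ (6 * D).
Proof.
have r0 : 0 < 1 + y ^+ 2 by rewrite ltr_pwDl // sqr_ge0.
pose r := (1 + y ^+ 2)^-1; have rp : 0 <= r by rewrite invr_ge0 ltW.
have [M0 hM0] : asum (fun t : primitive => iv (val t) ^+ 4).
  exact: (asum_comp val_inj (asum_recip_lat y1 (isT : (2 < 4)%N))).
have M00 : 0 <= M0 by have := hM0 [::] isT; rewrite big_nil.
pose m := complex.Re M0; have mE : M0 = m%:C by rewrite [LHS]complexE (ger0_Im M00) rmorph0 mulr0 addr0.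
have m0 : 0 <= m by rewrite -lecR -mE.
exists (m * (1 + y ^+ 2) ^+ 2); first by rewrite mulr_ge0 // exprn_ge0 // ltW.
move=> D D0; set w := ((y ^+ 2)^-1 ^+ (6 * D))%:C.
have rD : (1 + y ^+ 2) ^+ 2 * r ^+ (6 * D) = r ^+ (6 * D - 2).
  have {1}-> : (6 * D = 2 + (6 * D - 2))%N by lia.
  by rewrite exprD mulrA -exprMn mulfV ?gt_eqF // expr1n mul1r.
rewrite -mulrA rD.
have q2 : (2 < 12 * D)%N by lia.
have h := hassum_primitive y1 q2.
have tail (B : seq primitive) : uniq B -> {subset prim_axes <= B} ->
    `|\sum_(t <- B) iv (val t) ^+ (12 * D) - 2 * (1 + w)| <= (m * r ^+ (6 * D - 2))%:C.
  move=> uB sB; rewrite (bigID (fun t => t \in prim_axes)) /=.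
  rewrite -(big_filter B (fun t => t \in prim_axes)) (perm_big prim_axes) /=; last first.
    apply: uniq_perm => //; first exact: filter_uniq.
    by move=> t; rewrite mem_filter; case: (boolP (t \in prim_axes)) => // /sB ->.
  rewrite recip_lat_axes // addrAC subrr add0r.
  apply: le_trans (ler_norm_sum _ _ _) _.
  have -> : (m * r ^+ (6 * D - 2))%:C = M0 * (r ^+ (6 * D - 2))%:C by rewrite mE -rmorphM.
  apply: (@le_trans _ _ (\sum_(t <- B) `|iv (val t) ^+ 4| * (r ^+ (6 * D - 2))%:C)).
    rewrite [leRHS](bigID (fun t => t \in prim_axes)) /=.
    rewrite -[leLHS]add0r; apply: lerD.
      by apply: sumr_ge0 => t _; rewrite mulr_ge0 // ler0c exprn_ge0.
    apply: ler_sum => t /prim_axesP[a0 b0].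
    (* Four factors keep the sum below [M0] for every [D]. The others give the decay, as [lat_norm]
       is at least [1 + y ^ 2] off the axes. *)
    have -> : (12 * D = 4 + 2 * (6 * D - 2))%N by lia.
    rewrite exprD normrM ler_wpM2l // exprM normrX rmorphXn.
    apply: lerXn2r; rewrite ?nnegrE ?normr_ge0 ?ler0c //.
    rewrite normrX norm_recip_lat -rmorphXn lecR /= exprVn sqr_sqrtr; last first.
      by rewrite addr_ge0 ?sqr_ge0.
    case: t a0 b0 => -[a b] /= h' a0 b0; rewrite lef_pV2 ?posrE //; last first.
      by rewrite (lt_le_trans ltr01) // (lat_norm_ge y1) //; apply: contra_neq a0 => -[->].
    have sq (k : int) : k != 0 -> 1 <= k%:~R ^+ 2 :> R.
      by move=> k0; rewrite -rmorphXn /= -[1]/(1%:~R) ler_int; nia.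
    rewrite /lat_norm /= addrC exprMn lerD ?sq // ler_peMl ?sqr_ge0 ?sq //.
  rewrite -mulr_suml ler_wpM2r ?hM0 // ler0c exprn_ge0 //.
have lim : normc (2 * eisenstein (12 * D) z - 2 * (1 + w)) <= m * r ^+ (6 * D - 2).
  apply/ler_addgt0Pr => e e0; have [|A hA] := h e%:C; first by rewrite ltcR.
  pose B := undup (prim_axes ++ A).
  have uB : uniq B by exact: undup_uniq.
  have h1 : `|\sum_(t <- B) iv (val t) ^+ (12 * D) - 2 * eisenstein (12 * D) z| < e%:C.
    by apply: hA => // t tA; rewrite mem_undup mem_cat tA orbT.
  have h2 := tail B uB; rewrite normcE lecR in h2.
  rewrite normcE ltcR in h1.
  rewrite -(subrK (\sum_(t <- B) iv (val t) ^+ (12 * D)) (2 * eisenstein (12 * D) z)) -addrA.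
  apply: le_trans (le_normcD _ _) _; rewrite [leLHS]addrC; apply: lerD.
    by apply: h2 => t tA; rewrite mem_undup mem_cat tA.
  by rewrite normc_distrC ltW.
rewrite -mulrBr Normc.normcM in lim.
rewrite -addrA -opprD; apply: le_trans lim.
have -> : normc 2 = 2 by apply: (@complexI R); rewrite -normcE normr_nat rmorph_nat.
by rewrite ler_peMl ?ler1n ?normc_ge0.
Qed.

End Asymptotics.

Lemma inv_sqr_lt1 (y : R) : 1 < y -> 0 < (y ^+ 2)^-1 /\ (y ^+ 2)^-1 < 1.
Proof.
move=> y1; have y0 : 0 < y by apply: lt_trans y1.
by rewrite invr_gt0 exprn_gt0 // invf_lt1 ?exprn_gt0 // exprn_egt1.
Qed.

Lemma inv1D_lt (x : R) : 0 < x -> (1 + x)^-1 < x^-1.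
Proof. by move=> x0; rewrite ltf_pV2 ?posrE ?addr_gt0 // ltrDr. Qed.

Lemma eisenstein_limit (y e : R) : 1 < y -> 0 < e ->
  exists D0, forall D, (D0 <= D)%N -> normc (eisenstein (12 * D.+1) (0 +i* y) - 1) < e.
Proof.
move=> y1 e0; have [M M0 hM] := eisenstein_asymptotic y1.
have [u0 u1] := inv_sqr_lt1 y1; set u := (y ^+ 2)^-1 in u0 u1 hM.
have ru : (1 + y ^+ 2)^-1 <= u.
  by rewrite ltW // inv1D_lt // exprn_gt0 // (lt_trans ltr01).
have r0 : 0 <= (1 + y ^+ 2)^-1 by rewrite invr_ge0 addr_ge0 // sqr_ge0.
have q1 : u ^+ 6 < 1 by rewrite exprn_ilt1 // ltW.
have [D0 hD] := geometric_small (M + 1) (exprn_ge0 6 (ltW u0)) q1 e0.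
exists D0 => D hDD; have := hD D.+1 (leqW hDD); apply: le_lt_trans.
have h := hM D.+1 isT; rewrite -exprM.
rewrite -(subrK ((u ^+ (6 * D.+1))%:C) (eisenstein _ _ - 1)).
apply: le_trans (le_normcD _ _) _; rewrite mulrDl mul1r; apply: lerD.
  by apply: le_trans h _; rewrite ler_wpM2l // lerXn2r ?nnegrE // ltW.
by rewrite normc_real_ge0 // exprn_ge0 // ltW.
Qed.

Lemma dominated_power (u t c : R) : 0 < u -> 0 <= t -> t < u ->
  (forall D, (0 < D)%N -> u ^+ (6 * D) <= c * t ^+ (6 * D)) -> False.
Proof.
move=> u0 t0 tu h.
have q0 : 0 <= (t / u) ^+ 6 by rewrite exprn_ge0 // divr_ge0 // ltW.
have q1 : (t / u) ^+ 6 < 1.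
  by rewrite exprn_ilt1 ?divr_ge0 ?(ltW u0) // ltr_pdivrMr // mul1r.
have [D0 hD] := geometric_small c q0 q1 ltr01.
have := hD D0.+1 (leqnSn _); rewrite -exprM expr_div_n mulrA ltr_pdivrMr ?exprn_gt0 // mul1r.
by rewrite ltNge h.
Qed.

Lemma eisenstein_not_1 (y : R) : 1 < y ->
  ~ (forall D, (0 < D)%N -> eisenstein (12 * D) (0 +i* y) = 1).
Proof.
move=> y1 h; have [M M0 hM] := eisenstein_asymptotic y1.
have [u0 _] := inv_sqr_lt1 y1.
have y20 : 0 < y ^+ 2 by rewrite exprn_gt0 // (lt_trans ltr01).
apply: (dominated_power (c := M) u0 _ (inv1D_lt y20)) => [|D D0].
  by rewrite invr_ge0 addr_ge0 // ltW.
have := hM D D0; rewrite h // subrr sub0r.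
by rewrite normcN normc_real_ge0 ?exprn_ge0 ?(ltW u0) //; exact.
Qed.

(** For [y < y'] the term [y ^ (- 12 D)] outgrows [y' ^ (- 12 D)] and both error terms, so equality
    for all [D] is impossible. *)
Lemma eisenstein_separates (y y' : R) : 1 < y -> y < y' ->
  ~ (forall D, (0 < D)%N -> eisenstein (12 * D) (0 +i* y) = eisenstein (12 * D) (0 +i* y')).
Proof.
move=> y1 yy h; have y1' : 1 < y' by apply: lt_trans yy.
have [M M0 hM] := eisenstein_asymptotic y1.
have [M' M0' hM'] := eisenstein_asymptotic y1'.
have [u0 _] := inv_sqr_lt1 y1; have [u0' _] := inv_sqr_lt1 y1'.
have y0 : 0 < y by apply: lt_trans y1.
have y0' : 0 < y' by apply: lt_trans y1'.
have y20 : 0 < y ^+ 2 by rewrite exprn_gt0.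
have y20' : 0 < y' ^+ 2 by rewrite exprn_gt0.
have yy2 : y ^+ 2 < y' ^+ 2 by rewrite ltrXn2r // ?nnegrE ?ltW.
set u := (y ^+ 2)^-1 in u0 hM *; set u' := (y' ^+ 2)^-1 in u0' hM'.
set r := (1 + y ^+ 2)^-1 in hM; set r' := (1 + y' ^+ 2)^-1 in hM'.
have uu : u' < u by rewrite ltf_pV2 ?posrE.
have ru : r < u by apply: inv1D_lt.
have ru' : r' < u' by apply: inv1D_lt.
have r0 : 0 <= r by rewrite invr_ge0 addr_ge0 // ltW.
have r0' : 0 <= r' by rewrite invr_ge0 addr_ge0 // ltW.
pose t := Num.max r u'.
have t0 : 0 <= t by rewrite le_max r0.
apply: (@dominated_power u t (1 + M + M') u0 t0); first by rewrite gt_max ru uu.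
move=> D D0; have h1 := hM D D0; have h2 := hM' D D0; rewrite -h // in h2.
set E := eisenstein _ _ in h1 h2; set n := (6 * D)%N in h1 h2 *.
have rt : r ^+ n <= t ^+ n by rewrite lerXn2r ?nnegrE // le_max lexx.
have ut : u' ^+ n <= t ^+ n by rewrite lerXn2r ?nnegrE ?(ltW u0') // le_max lexx orbT.
have rt' : r' ^+ n <= t ^+ n by apply: le_trans ut; rewrite lerXn2r ?nnegrE ?(ltW u0') // ltW.
have : u ^+ n <= normc (E - 1 - (u' ^+ n)%:C) + normc (E - 1 - (u ^+ n)%:C) + u' ^+ n.
  rewrite -[leLHS]normc_real_ge0 ?exprn_ge0 ?(ltW u0) //.
  rewrite -[X in _ <= _ + X]normc_real_ge0 ?exprn_ge0 ?(ltW u0') //.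
  rewrite [normc (E - 1 - (u ^+ n)%:C)]normc_distrC.
  apply: le_trans (lerD (le_normcD _ _) (lexx _)); apply: le_trans (le_normcD _ _).
  rewrite le_eqVlt; apply/orP; left; apply/eqP; congr normc; ring.
move=> h3; apply: le_trans h3 _.
rewrite mulrDl mulrDl mul1r.
have := le_trans h1 (ler_wpM2l M0 rt); have := le_trans h2 (ler_wpM2l M0' rt'); lra.
Qed.

End Ray.

Lemma eisenstein0 (R : realType) (w : R[i]) : eisenstein 0 w = 1.
Proof. by []. Qed.

Local Opaque eisenstein.

(** * Injectivity of [j] on the ray *)

Section Modular.
Variable R : realType.
Notation C := R[i].
Notation normc := (@Normc.normc R).
Notation E k y := (eisenstein k (0 +i* y%R)).

Lemma C_char0 n : (n.+1%:R : C) != 0. Proof. by rewrite pnatr_eq0. Qed.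

Lemma wp_cusp_rec : wp_rec (- 3 : C) 2 (wp_cusp R).
Proof.
have h := wp_rec_map (map_poly (@ratr C)) wp_poly_rec.
have h2 := wp_rec_map (horner_eval (2 : C)) h.
rewrite /= map_polyX /horner_eval !rmorphN /= !rmorph_nat hornerX hornerN -polyC_natr hornerC in h2.
exact: h2.
Qed.

(** Homogeneity and uniqueness for the recurrence take the place of the theorem that each [E_(2m)]
    is an isobaric polynomial in [E_4] and [E_6]. *)
Lemma eisenstein_scale (y y' : R) (s : C) : 1 < y -> 1 < y' ->
  E 4 y' = s ^+ 2 * E 4 y -> E 6 y' = s ^+ 3 * E 6 y ->
  forall m, (1 < m)%N -> E (2 * m) y' = s ^+ m * E (2 * m) y.
Proof.
move=> y1 y1' h4 h6 m m1; have [nz ex] := eisenstein_wp R.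
have [e he eE] := ex y y1; have [e' he' eE'] := ex y' y1'.
have hs := wp_rec_scale s he.
rewrite h4 h6 (mulrCA (- 3)) (mulrCA 2) in he'.
have := wp_rec_unique C_char0 he' hs m; rewrite eE // eE' // mulrCA.
by apply: mulfI; exact: nz.
Qed.

Lemma eisenstein_cusp_scale (y : R) (s : C) : 1 < y ->
  E 4 y = s ^+ 2 -> E 6 y = s ^+ 3 -> forall m, (1 < m)%N -> E (2 * m) y = s ^+ m.
Proof.
move=> y1 h4 h6 m m1; have [nz ex] := eisenstein_wp R.
have [e he eE] := ex y y1; have hs := wp_rec_scale s wp_cusp_rec.
rewrite h4 h6 mulrC [2 * _]mulrC in he.
have := wp_rec_unique C_char0 he hs m; rewrite eE // mulrC.
by apply: mulIf; exact: nz.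
Qed.

Lemma power_eisenstein (y : R) (M : C) : 1 < y ->
  (forall D, (0 < D)%N -> M ^+ D = E (12 * D) y) -> M = 1.
Proof.
move=> y1 h; apply: power_limit_1 => e e0.
have [D0 hD] := eisenstein_limit y1 e0; exists D0.+1 => -[|D] //; rewrite ltnS => DD.
by rewrite h // hD.
Qed.

(* If [Delta] vanished, [E (12 * D)] would be [s ^ (6 * D)]; tending to 1, it would be
   constantly 1. *)
Lemma Delta_neq0 (y : R) : 1 < y -> Delta (0 +i* y) != 0.
Proof.
move=> y1; apply/negP; rewrite /Delta mulf_eq0 invr_eq0 pnatr_eq0 orbF subr_eq0 => /eqP h.
(* The vanishing of [Delta] puts [(E_4, E_6)] on the cuspidal cubic, parametrized by the quotient
   [E_6 / E_4]. *)
have [s h4 h6] : exists2 s : C, E 4 y = s ^+ 2 & E 6 y = s ^+ 3.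
  have [A0|A0] := eqVneq (E 4 y) 0.
    exists 0; first by rewrite A0 expr0n.
    by move/eqP: h; rewrite A0 expr0n eq_sym expf_eq0 /= => /eqP ->.
  exists (E 6 y / E 4 y); rewrite expr_div_n.
    by rewrite -h exprS mulfK // expf_neq0.
  by rewrite h [in LHS](_ : E 6 y = E 6 y ^+ 3 / E 6 y ^+ 2) // exprS mulfK // -h expf_neq0.
have hs := eisenstein_cusp_scale y1 h4 h6.
have hD D : (0 < D)%N -> (s ^+ 6) ^+ D = E (12 * D) y.
  move=> D0; rewrite -exprM -hs; last by lia.
  by congr (eisenstein _ _); lia.
have s1 := power_eisenstein y1 hD.
by apply: (eisenstein_not_1 y1) => D D0; rewrite -hD // s1 expr1n.
Qed.

(* If the [j]-values agree, the values of [E (12 * D)] differ by [M ^ D]; both tend to 1,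
   so [M = 1], and then the asymptotics in [D] recover [y]. *)
Lemma jinv_inj (y y' : R) : 1 < y -> 1 < y' ->
  jinv (0 +i* y : C) = jinv (0 +i* y') -> y = y'.
Proof.
move=> y1 y1'.
have d := Delta_neq0 y1; have d' := Delta_neq0 y1'.
move=> hj.
pose M := Delta (0 +i* y') / Delta (0 +i* y) : C.
have M0 : M != 0 by rewrite mulf_neq0 ?invr_eq0.
have dM : Delta (0 +i* y') = M * Delta (0 +i* y) by rewrite /M divfK.
have hA : E 4 y' ^+ 3 = M * E 4 y ^+ 3.
  rewrite -[LHS](divfK d') -[_ / _]/(jinv (0 +i* y')) -hj /jinv /M.
  move: (E 4 y ^+ 3) (Delta (0 +i* y)) (Delta (0 +i* y')) => p q r; ring.
have hB : E 6 y' ^+ 2 = M * E 6 y ^+ 2.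
  have [k D1] : exists k : C, forall x : R, E 6 x ^+ 2 = E 4 x ^+ 3 - k * Delta (0 +i* x).
    exists 1728%:R => x; have : (1728%:R : C) != 0 by rewrite pnatr_eq0.
    rewrite /Delta; move: (1728%:R : C) => k k0.
    by rewrite mulrC divfK // opprB addrC subrK.
  rewrite (D1 y') (D1 y) hA dM; move: (E 4 y ^+ 3) (Delta (0 +i* y)) => p q; ring.
(* A square root of the ratio of the [E 4] gives [s] up to sign, and the [E 6] decide the sign. If
   [E 4 y] vanishes, a cube root of the ratio of the [E 6] is used. *)
have [s h4 h6] : exists2 s : C, E 4 y' = s ^+ 2 * E 4 y & E 6 y' = s ^+ 3 * E 6 y.
  have [A0|A0] := eqVneq (E 4 y) 0.
    have A0' : E 4 y' = 0.
      have : E 4 y' ^+ 3 == 0 by rewrite hA A0 expr0n mulr0.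
      by rewrite expf_eq0 => /eqP.
    have B0 : E 6 y != 0.
      by apply: contraNneq d => B0; rewrite /Delta A0 B0 !expr0n subrr mul0r.
    exists (3.-root (E 6 y' / E 6 y)); first by rewrite A0 A0' mulr0.
    by rewrite rootCK // divfK.
  pose s0 := sqrtc (E 4 y' / E 4 y).
  have s2 : s0 ^+ 2 = E 4 y' / E 4 y by rewrite sqr_sqrtc.
  have s4 : E 4 y' = s0 ^+ 2 * E 4 y by rewrite s2 divfK.
  have s6 : s0 ^+ 6 = M.
    apply: (mulIf (expf_neq0 3 A0)); rewrite -hA s4; ring.
  have : E 6 y' ^+ 2 = (s0 ^+ 3 * E 6 y) ^+ 2 by rewrite hB -s6; ring.
  move/eqP; rewrite eqf_sqr => /orP[/eqP e|/eqP e]; first by exists s0.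
  by exists (- s0); [rewrite sqrrN | rewrite e; ring].
have hs := eisenstein_scale y1 y1' h4 h6.
have hD D : (0 < D)%N -> E (12 * D) y' = (s ^+ 6) ^+ D * E (12 * D) y.
  move=> D0; have -> : (12 * D = 2 * (6 * D))%N by lia.
  by rewrite -exprM hs //; lia.
have s1 : s ^+ 6 = 1.
  apply: power_limit_1 => e e0.
  pose e' := Num.min (e / 4) 2^-1.
  have e0' : 0 < e' by rewrite lt_min divr_gt0 //= invr_gt0.
  have e1 : e' <= e / 4 by rewrite ge_min lexx.
  have e2 : e' <= 2^-1 by rewrite ge_min lexx orbT.
  have [D1 h1] := eisenstein_limit y1 e0'; have [D2 h2] := eisenstein_limit y1' e0'.
  exists (maxn D1 D2).+1 => -[|D] //; rewrite ltnS geq_max => /andP[d1 d2].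
  have := h1 D d1; have := h2 D d2; rewrite hD //.
  set F := E _ y; set Q := _ ^+ D.+1 => g2 g1.
  have n1 : normc (Q - 1) * normc F <= normc (Q * F - 1) + normc (F - 1).
    rewrite -Normc.normcM [normc (F - 1)]normc_distrC; apply: le_trans (le_normcD _ _).
    by rewrite addrA subrK mulrBl mul1r.
  have n2 : 1 <= normc F + normc (F - 1).
    rewrite [normc (F - 1)]normc_distrC -(@Normc.normc1 R).
    by apply: le_trans (le_normcD _ _); rewrite addrC subrK.
  have n0 := normc_ge0 (Q - 1); nra.
have eqE D : (0 < D)%N -> E (12 * D) y = E (12 * D) y'.
  by move=> D0; rewrite hD // s1 expr1n mul1r.
case: (ltgtP y y') => // yy; exfalso.
  exact: (eisenstein_separates y1 yy eqE).
by apply: (eisenstein_separates y1' yy) => D D0; rewrite eqE.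
Qed.

End Modular.

Lemma size_half_sum_poly D : (size (half_sum_poly D) <= (2 * D).+1)%N.
Proof.
have se n : (size (eis_poly n) <= n.+1)%N.
  exact: leq_trans (size_scale_leq _ _) (size_wp_disc n).
apply: leq_trans (size_scale_leq _ _) _.
apply: leq_trans (size_polyD _ _) _; rewrite geq_max se andbT.
by apply: leq_trans (size_polyMleq _ _) _; have := se D; lia.
Qed.

Lemma half_sum_poly_horner (F : numFieldType) D (x : F) :
  2 * (map_poly ratr (half_sum_poly D)).[x] =
  (map_poly ratr (eis_poly D)).[x] ^+ 2 + (map_poly ratr (eis_poly (2 * D))).[x].
Proof.
rewrite /half_sum_poly; move: (eis_poly D) (eis_poly _) => p q.
rewrite map_polyZ hornerZ fmorphV rmorph_nat mulVKf ?pnatr_eq0 //.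
by rewrite rmorphD rmorphM hornerD hornerM.
Qed.

Lemma horner_rev_poly (F : numFieldType) (c : rat) (h : {poly rat}) n (x : F) :
  x != 0 -> (size h <= n.+1)%N ->
  (map_poly ratr (\poly_(i < n.+1) (2 * h`_(n - i) * c ^+ (n - i)))).[x] =
  2 * x ^+ n * (map_poly ratr h).[ratr c / x].
Proof.
move=> x0 sh; set f := \poly_(i < _) _.
have sF : (size (map_poly (ratr : rat -> F) f) <= n.+1)%N.
  by rewrite size_map_poly size_poly.
have sh' : (size (map_poly (ratr : rat -> F) h) <= n.+1)%N by rewrite size_map_poly.
rewrite (horner_coef_wide _ sF) (horner_coef_wide _ sh') mulr_sumr.
rewrite (reindex_inj rev_ord_inj); apply: eq_bigr => -[i i_n] _.
rewrite /= !coef_map /= coef_poly subSS ltnS leq_subr subKn //.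
rewrite !rmorphM rmorphXn !rmorph_nat [(_ / x) ^+ i]expr_div_n /=.
have -> : x ^+ n = x ^+ (n - i) * x ^+ i by rewrite -exprD subnK.
have xi : x ^+ i != 0 by rewrite expf_neq0.
move: (ratr h`_i) (ratr c ^+ i) (x ^+ (n - i)) (x ^+ i) xi => a b v u u0.
by field.
Qed.

Lemma faber_poly_horner (F : numFieldType) D (x : F) : x != 0 ->
  (map_poly ratr (faber_poly D)).[x] =
  2 * x ^+ (2 * D) * (map_poly ratr (half_sum_poly D)).[256 / x].
Proof.
move=> x0; rewrite /faber_poly horner_rev_poly ?size_half_sum_poly //.
by rewrite rmorph_nat.
Qed.

(** * Identification of the Faber polynomial *)

Section Main.
Variable R : realType.
Notation C := R[i].
Notation E k y := (eisenstein k (0 +i* y%R)).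
Notation J y := (jinv (0 +i* y%R : C)).

(** Rescaling by a square root [r] of [E_4] reduces to the case [E_4 = 1]; only [w ^ 2] matters, so
    the choice of root is immaterial. The condition on [J y] keeps [E_4] from vanishing. *)
Lemma eisenstein_eis_poly (y : R) D : 1 < y -> J y != 0 -> (0 < D)%N ->
  E (12 * D) y = E 4 y ^+ (3 * D) * (map_poly ratr (eis_poly D)).[256 / J y].
Proof.
move=> y1 j0 D0; have d0 := Delta_neq0 y1.
have [nz ex] := eisenstein_wp R; have [e he eE] := ex y y1.
have A0 : E 4 y != 0.
  by apply: contraNneq j0 => A0; rewrite /jinv A0 expr0n mul0r.
pose r := sqrtc (E 4 y); have r2 : r ^+ 2 = E 4 y by rewrite sqr_sqrtc.
have r0 : r != 0 by apply: contraNneq A0 => h; rewrite -r2 h expr0n.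
pose w := 2 * E 6 y / r ^+ 3.
have e1 : wp_rec (- 3 * r ^+ 2) (r ^+ 3 * w) e.
  by rewrite r2 (_ : r ^+ 3 * w = 2 * E 6 y) // /w mulrC divfK ?expf_neq0.
have hw : w ^+ 2 = 4 - 27 * (256 / J y).
  (* [k] is 1728, and [4 * 1728 = 27 * 256] is what singles out the variable [256 / j]. *)
  have [k [k0 k1 D1]] : exists k : C, [/\ k != 0, 27 * 256 = 4 * k & Delta (0 +i* y) = (E 4 y ^+ 3 - E 6 y ^+ 2) / k].
    exists 1728%:R; split; [by rewrite pnatr_eq0 | by rewrite -!natrM; congr (_%:R) |].
    by rewrite /Delta.
  have D2 : k * Delta (0 +i* y) = E 4 y ^+ 3 - E 6 y ^+ 2 by rewrite D1 mulrC divfK.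
  have sq (B t : C) : t != 0 ->
      (2 * B / t ^+ 3) ^+ 2 = 4 - 4 * ((t ^+ 2) ^+ 3 - B ^+ 2) / (t ^+ 2) ^+ 3.
    by move=> t0; field.
  rewrite /w sq // r2 -D2 /jinv invf_div !mulrA k1.
  by [].
have v := wp_value e1 (6 * D).
have vc : wp_cusp R (6 * D) = ratr (wp_disc D)`_0.
  rewrite /wp_cusp -(@wp_disc_horner _ D 2 0); last by ring.
  by rewrite horner_coef0 coef_map.
have m1 : (1 < 6 * D)%N by lia.
have c0 := nz _ m1.
rewrite eE // -(wp_disc_horner D hw) exprM mulnA in v.
have -> : (12 * D = 2 * (6 * D))%N by lia.
apply: (mulfI c0); rewrite mulnA v vc /eis_poly map_polyZ hornerZ fmorphV /=.
rewrite vc in c0; rewrite mulrCA mulVKf // -exprM.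
by congr (_ * _); rewrite -r2 -exprM; congr (_ ^+ _); lia.
Qed.

Lemma faber_poly_jinv (y : R) D : 1 < y -> J y != 0 -> (0 < D)%N ->
  E (12 * D) y ^+ 2 + E (24 * D) y =
  Delta (0 +i* y) ^+ (2 * D) * (map_poly ratr (faber_poly D)).[J y].
Proof.
move=> y1 j0 D0.
have -> : (24 * D = 12 * (2 * D))%N by lia.
rewrite !eisenstein_eis_poly // ?muln_gt0 // faber_poly_horner //.
have d0 := Delta_neq0 y1.
have aux (a b c : C) n : c ^+ n * (2 * b ^+ n * a) = (b * c) ^+ n * (2 * a).
  by rewrite exprMn; ring.
rewrite aux.
have -> : J y * Delta (0 +i* y) = E 4 y ^+ 3 by rewrite /jinv divfK.
rewrite half_sum_poly_horner exprMn -!exprM.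
have -> : (3 * D * 2 = 3 * (2 * D))%N by lia.
exact: esym (mulrDr _ _ _).
Qed.

Lemma poly_eq_jinv (p q : {poly C}) :
  (forall y : R, 1 < y -> J y != 0 -> p.[J y] = q.[J y]) -> p = q.
Proof.
move=> h; apply/eqP; rewrite -subr_eq0; apply/eqP.
pose u n : C := J (n.+2%:R).
have y1 n : 1 < n.+2%:R :> R by rewrite ltr1n.
have u_inj : injective u.
  move=> a b /(jinv_inj (y1 a) (y1 b)) /eqP.
  by rewrite eqr_nat => /eqP [].
have pq n : u n != 0 -> root (p - q) (u n).
  by move=> u0; rewrite rootE hornerD hornerN h ?subrr.
apply/eqP; apply: contraT => nz.
(* One point more than [size (p - q)] is taken: the values are distinct, so at most one of them is 0
   and gets discarded. *)
pose s := [seq x <- [seq u n | n <- iota 0 (size (p - q)).+1] | x != 0].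
have us : uniq s by rewrite filter_uniq // map_inj_uniq ?iota_uniq.
have ss : all (root (p - q)) s.
  by apply/allP => x; rewrite mem_filter => /andP[x0 /mapP[n _ xE]]; rewrite xE pq // -xE.
have := max_poly_roots nz ss us; rewrite ltnNge => /negP; case.
have := count_predC (pred1 (0 : C)) [seq u n | n <- iota 0 (size (p - q)).+1].
rewrite count_uniq_mem ?map_inj_uniq ?iota_uniq // size_map size_iota /s size_filter.
rewrite (eq_count (a2 := predC (pred1 0))) //.
suff key (b : bool) a n : (b + a = n.+1)%N -> (n <= a)%N by exact: key.
by case: b; lia.
Qed.
End Main.

Theorem theorem2 (R : realType) (D k : nat)
  (hD : exists m : nat, D = (2 ^ m)%N)
  (hk : k = (12 * D)%N)
  (P : {poly R[i]})
  (hP : is_faber (2 * k)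
          (fun z : R[i] => eisenstein k z ^+ 2 + eisenstein (2 * k) z) P) :
  irreducible_over_rat P.
Proof.
have [m Dm] := hD.
have D0 : (0 < D)%N by rewrite Dm expn_gt0.
exists (faber_poly D); last by rewrite Dm; exact: faber_poly_irreducible.
have [d [K [kE Kin hPz]]] := hP.
(* The weight [24 * D] is a multiple of 12, and 0 is the only admissible [K'] that is one. *)
have [K0 dE] : K = 0%N /\ d = (2 * D)%N.
  by move: Kin; rewrite !inE => /or4P[|||/or3P[]] /eqP; lia.
apply: poly_eq_jinv => y y1 j0.
have d0 := Delta_neq0 y1.
have yi : 0 < complex.Im (0 +i* y : R[i]) by rewrite /=; apply: lt_trans y1.
have := hPz _ yi; rewrite K0 dE.
rewrite eisenstein0 mulr1 hk mulnA faber_poly_jinv // => /esym.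
by apply: mulfI; rewrite expf_neq0.
Qed.
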